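(* Let $\Gamma$ be a finite group and $\pi:\Gamma\to\mathrm{GL}_d(\mathbb{C})$ a representation such that (i) all the exterior powers $\bigwedge^m\pi$, $0\le m\le d$, are irreducible and pairwise non-isomorphic, and (ii) the group $\pi(\Gamma)$ is generated by pseudo-reflections. Then every finite, connected, loopless undirected graph $G$ (multiple edges allowed) has a one-sided Ramanujan $(\Gamma,\pi)$-covering; that is, there is a $\Gamma$-labeling $\gamma$ of $G$ such that all the eigenvalues of $A_{\gamma,\pi}$ are at most $\rho(G)$, the spectral radius of the universal covering tree of $G$.
   Context: A matrix $A\in\mathrm{GL}_d(\mathbb{C})$ is a pseudo-reflection if it has finite order and $\mathrm{rank}(A-I)=1$. For a finite connected graph $G$ with universal covering tree $T$, $\rho(G)$ denotes the spectral radius of the adjacency operator $(A_Tf)(v)=\sum_{u\sim v}f(u)$ acting on $\ell^2(V(T))$. Orient each edge of $G$ arbitrarily; $E^+(G)$ is the resulting set of oriented edges, $E^-(G)$ the set of their reverses, $E(G)=E^+(G)\sqcup E^-(G)$, $-e$ is the reverse of $e$, and $h(e),t(e)$ are the head and tail of $e$. A $\Gamma$-labeling of $G$ is a function $\gamma:E(G)\to\Gamma$ with $\gamma(-e)=\gamma(e)^{-1}$. With $n=|V(G)|$, $A_{\gamma,\pi}$ is the $nd\times nd$ matrix made of $d\times d$ blocks indexed by pairs $(u,v)\in V(G)^2$, where the $(u,v)$ block is $\sum_{e\in E(G):\,t(e)=u,\,h(e)=v}\pi(\gamma(e))$ (zero if there are no such edges). It is called a $(\Gamma,\pi)$-covering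 of $G$; its eigenvalues are all real because $\pi$ is conjugate to a unitary representation. *)

(* Defs.v *)
From mathcomp Require Import all_boot all_order all_algebra all_fingroup.
From mathcomp Require Import mxrepresentation.
From mathcomp Require Import complex.
From mathcomp Require Import boolp classical_sets functions cardinality fsbigop.
From mathcomp Require Import reals ereal esum.

Set Implicit Arguments.
Unset Strict Implicit.
Unset Printing Implicit Defensive.

Import Order.TTheory GRing.Theory Num.Theory.

Local Open Scope ring_scope.

Section ExteriorPower.

Variables (F : comNzRingType) (d m : nat).

(* The m-subsets I = {i_0 < ... < i_(m-1)} of 'I_d index the standard basis
   e_I = e_(i_0) /\ ... /\ e_(i_(m-1)) of the m-th exterior power of F^d. *)
Definition msubset : finType := {I : {set 'I_d} | #|I| == m}.

Definition msubset_nth (I : msubset) (k : 'I_m) : 'I_d :=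
  enum_val (cast_ord (esym (eqP (valP I))) k).

Definition ext_dim : nat := #|msubset|.

(* By multilinearity, e_(i_0)A /\ ... /\ e_(i_(m-1))A has e_J-coordinate the
   minor of A on the rows I and the columns J. *)
Definition ext_mx (A : 'M[F]_d) : 'M[F]_ext_dim :=
  \matrix_(i, j)
    \det (mxsub (msubset_nth (enum_val i)) (msubset_nth (enum_val j)) A).

Lemma msubset_nth_inj (I : msubset) : injective (msubset_nth I).
Proof. by move=> k l /enum_val_inj/cast_ord_inj. Qed.

Lemma mem_msubset_nth (I : msubset) k : msubset_nth I k \in val I.
Proof. exact: enum_valP. Qed.

Lemma msubset_nth_surj (I : msubset) x :
  x \in val I -> exists k, msubset_nth I k = x.
Proof.
move=> xI; exists (cast_ord (eqP (valP I)) (enum_rank_in xI x)).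
by rewrite /msubset_nth cast_ordK enum_rankK_in.
Qed.

Lemma msubset_eq (I J : msubset) :
  (forall k, msubset_nth I k \in val J) -> I = J.
Proof.
move=> IJ; apply/val_inj/eqP.
rewrite eqEcard (eqP (valP I)) (eqP (valP J)) leqnn andbT.
by apply/fintype.subsetP=> x /msubset_nth_surj[k <-]; apply: IJ.
Qed.

Lemma ext_mx1 : ext_mx 1%:M = 1%:M.
Proof.
apply/matrixP=> i j; rewrite !mxE; have [<- | neq_ij] := eqVneq i j.
  rewrite -[RHS](det1 F m); congr (\det _); apply/matrixP=> k l.
  by rewrite !mxE (inj_eq (@msubset_nth_inj _)).
have [k kJ]: exists k, msubset_nth (enum_val i) k \notin val (enum_val j).
  apply/existsP; apply: contraNT neq_ij => /existsPn IJ.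
  apply/eqP/enum_val_inj/msubset_eq => k; exact/negPn/IJ.
rewrite (expand_det_row _ k) big1 // => l _; rewrite !mxE.
case: eqP => [E | _]; last by rewrite mul0r.
by rewrite E mem_msubset_nth in kJ.
Qed.

Lemma CauchyBinet (A : 'M[F]_(m, d)) (B : 'M[F]_(d, m)) :
  \det (A *m B) = \sum_(I : msubset)
    \det (colsub (msubset_nth I) A) * \det (rowsub (msubset_nth I) B).
Proof.
transitivity (\sum_(f : {ffun 'I_m -> 'I_d})
    (\prod_i A i (f i)) * \det (rowsub f B)).
  transitivity (\sum_(f : {ffun 'I_m -> 'I_d}) \sum_(s : 'S_m)
      (-1) ^+ s * \prod_i (A i (f i) * B (f i) (s i))).
    rewrite exchange_big; apply: eq_bigr => s _; rewrite -big_distrr /=.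
    congr (_ * _).
    rewrite -(bigA_distr_bigA (fun i x => A i x * B x (s i))) /=.
    by apply: eq_bigr => x _; rewrite mxE.
  apply: eq_bigr => f _; rewrite /determinant big_distrr /=.
  apply: eq_bigr => s _; rewrite big_split /= mulrCA.
  by congr (_ * (_ * _)); apply: eq_bigr => x _; rewrite mxE.
rewrite (bigID (fun f : {ffun 'I_m -> 'I_d} => injectiveb f)) /=.
rewrite addrC big1 ?add0r => [|f /injectivePn[k [l neq_kl Ef]]]; last first.
  by rewrite (determinant_alternate neq_kl) ?mulr0 // => j; rewrite !mxE Ef.
transitivity (\sum_(f : {ffun 'I_m -> 'I_d} | injectiveb f)
    \sum_(I : msubset | val I == [set f k | k : 'I_m])
      (\prod_i A i (f i)) * \det (rowsub f B)).
  apply: eq_bigr => f /injectiveP inj_f.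
  have cardI: #|[set f k | k : 'I_m]| == m by rewrite card_imset // card_ord.
  pose If : msubset := exist (fun J : {set 'I_d} => #|J| == m) _ cardI.
  by rewrite (big_pred1 If).
rewrite (exchange_big_dep xpredT) //=; apply: eq_bigr => I _.
pose h (s : 'S_m) := [ffun k => msubset_nth I (s k)].
have inj_h: injective h.
  move=> s t /ffunP Est; apply/permP=> k.
  by have:= Est k; rewrite !ffunE => /msubset_nth_inj.
rewrite (eq_bigl (fun f => f \in [set h s | s : 'S_m])) => [|f]; last first.
  apply/andP/imsetP=> [[/injectiveP inj_f /eqP imI] | [s _ ->{f}]].
    have ex k: exists l, msubset_nth I l == f k.
      have fkI: f k \in val I by rewrite /= imI imset_f.
      by have [l <-] := msubset_nth_surj fkI; exists l.
    have inj_g: injective (fun k => xchoose (ex k)).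
      move=> k l E; apply: inj_f.
      by rewrite -(eqP (xchooseP (ex k))) -(eqP (xchooseP (ex l))) E.
    exists (perm inj_g) => //; apply/ffunP=> k.
    by rewrite !ffunE permE (eqP (xchooseP (ex k))).
  have inj_hs: injective (h s).
    by move=> k l; rewrite !ffunE => /msubset_nth_inj/perm_inj.
  split; first exact/injectiveP.
  rewrite eq_sym eqEcard (eqP (valP I)) card_imset // card_ord leqnn andbT.
  by apply/fintype.subsetP=> _ /imsetP[k _ ->]; rewrite ffunE mem_msubset_nth.
rewrite big_imset /=; last by move=> s t _ _ /inj_h.
rewrite big_distrl /=; apply: eq_big => [s | s _]; first by rewrite inE.
have ->: rowsub (h s) B = row_perm s (rowsub (msubset_nth I) B).
  by apply/matrixP=> k l; rewrite !mxE ffunE.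
rewrite row_permE det_mulmx det_perm mulrA; congr (_ * _).
rewrite mulrC; congr (_ * _).
by apply: eq_bigr => k _; rewrite !mxE ffunE.
Qed.

End ExteriorPower.

Lemma ext_mxM (F : comNzRingType) d m (A B : 'M[F]_d) :
  ext_mx m (A *m B) = ext_mx m A *m ext_mx m B.
Proof.
apply/matrixP=> i j; rewrite !mxE mxsub_mul CauchyBinet.
rewrite (big_enum_val (A := msubset d m)).
by apply: eq_bigr => k _; rewrite !mxE -!mxsub_comp.
Qed.

Section Representations.

Variables (F : fieldType) (gT : finGroupType) (Gam : {group gT}) (d : nat).
Variable pi : mx_representation F Gam d.

Lemma ext_mx_repr m : mx_repr Gam (fun x => ext_mx m (pi x)).
Proof.
by split=> [|x y xG yG]; rewrite ?repr_mx1 ?ext_mx1 // repr_mxM // ext_mxM.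
Qed.

Definition ext_repr m : mx_representation F Gam (ext_dim d m) :=
  MxRepresentation (ext_mx_repr m).

Definition ext_powers_irr_noniso : Prop :=
  (forall m, (m <= d)%N -> mx_irreducible (ext_repr m)) /\
  (forall m m', (m <= d)%N -> (m' <= d)%N -> m <> m' ->
     ~ mx_rsim (ext_repr m) (ext_repr m')).

Definition pseudo_reflection (A : 'M[F]_d) : Prop :=
  [/\ A \in unitmx,
      exists2 n : nat, (0 < n)%N & A ^+ n = 1%:M
    & \rank (A - 1%:M) = 1%N].

Inductive gen_GL (S : 'M[F]_d -> Prop) : 'M[F]_d -> Prop :=
| gen_GL_in A : S A -> gen_GL S A
| gen_GL_1 : gen_GL S 1%:M
| gen_GL_M A B : gen_GL S A -> gen_GL S B -> gen_GL S (A *m B)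
| gen_GL_V A : gen_GL S A -> gen_GL S (invmx A).

Definition image_gen_by_pseudo_reflections : Prop :=
  exists S : 'M[F]_d -> Prop,
    (forall A, S A -> pseudo_reflection A) /\
    (forall A, (exists2 x, x \in Gam & A = pi x) <-> gen_GL S A).

End Representations.

(* A finite undirected multigraph together with an orientation of its edges:
   [edge G] is E^+(G), and [e : edge G] points from [src e] to [dst e]. *)
Record multigraph := Multigraph {
  vertex : finType;
  edge : finType;
  src : edge -> vertex;
  dst : edge -> vertex
}.

Section Multigraph.

Variable G : multigraph.

(* E(G) = E^+(G) + E^-(G): (e, true) is e itself, (e, false) its reverse. *)
Definition oedge : finType := (edge G * bool)%type.

Definition oedge_opp (e : oedge) : oedge := (e.1, ~~ e.2).

Definition edge_tail (e : oedge) : vertex G := if e.2 then src e.1 else dst e.1.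

Definition edge_head (e : oedge) : vertex G := if e.2 then dst e.1 else src e.1.

Definition loopless : Prop := forall e : edge G, src e <> dst e.

Definition graph_connected : Prop :=
  forall u v : vertex G,
    connect [rel x y | [exists e : oedge,
      (edge_tail e == x) && (edge_head e == y)]] u v.

Definition nonbacktracking_walk (v0 : vertex G) (w : seq oedge) : bool :=
  if w is e :: w' then
    (edge_tail e == v0) &&
    path [rel e1 e2 |
      (edge_tail e2 == edge_head e1) && (e2 != oedge_opp e1)] e w'
  else true.

(* The universal covering tree of a connected G: its vertices are the
   non-backtracking walks of G issued from a base vertex v0, and two of them
   are adjacent when one extends the other by one step. *)
Definition cover_vertex (v0 : vertex G) : choiceType :=
  {w : seq oedge | nonbacktracking_walk v0 w}.

Definition cover_adj (v0 : vertex G) : rel (cover_vertex v0) :=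
  [rel x y | [exists e : oedge,
    (val y == rcons (val x) e) || (val x == rcons (val y) e)]].

Section Covering.

Variables (F : fieldType) (gT : finGroupType) (Gam : {group gT}) (d : nat).

Definition labeling (gamma : oedge -> gT) : Prop :=
  (forall e, gamma e \in Gam) /\
  (forall e, gamma (oedge_opp e) = (gamma e)^-1%g).

Variables (pi : mx_representation F Gam d) (gamma : oedge -> gT).

Definition covering_block (u v : vertex G) : 'M[F]_d :=
  \sum_(e : oedge | (edge_tail e == u) && (edge_head e == v)) pi (gamma e).

Definition covering_mx : 'M[F]_(\sum_(i < #|vertex G|) d) :=
  \mxblock_(i < #|vertex G|, j < #|vertex G|)
    covering_block (enum_val i) (enum_val j).

End Covering.

End Multigraph.

Local Open Scope classical_set_scope.

Section EllTwo.

Variables (R : realType) (T : choiceType).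

Definition l2sum (f : T -> R[i]) : \bar R :=
  (\esum_(v in [set: T]) (Normc.normc (f v) ^+ 2)%:E)%E.

Definition l2 (f : T -> R[i]) : Prop := (l2sum f < +oo)%E.

Definition l2norm (f : T -> R[i]) : R := Num.sqrt (fine (l2sum f)).

(* Operators on l2(T) are represented by maps on all functions T -> R[i], of
   which only the values on l2(T) are relevant. *)
Definition bounded_l2_operator (B : (T -> R[i]) -> (T -> R[i])) : Prop :=
  [/\ forall f, l2 f -> l2 (B f),
      forall (a : R[i]) f g, l2 f -> l2 g ->
        B (fun v => a * f v + g v) = (fun v => a * B f v + B g v)
    & exists c : R, forall f, l2 f -> l2norm (B f) <= c * l2norm f].

Definition l2_resolvent (A : (T -> R[i]) -> (T -> R[i])) : set R[i] :=
  [set z | exists B, bounded_l2_operator B /\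
     forall f, l2 f ->
       B (fun v => A f v - z * f v) = f /\
       (fun v => A (B f) v - z * B f v) = f].

Definition l2_spectrum (A : (T -> R[i]) -> (T -> R[i])) : set R[i] :=
  ~` l2_resolvent A.

Definition l2_spectral_radius (A : (T -> R[i]) -> (T -> R[i])) : R :=
  sup [set Normc.normc z | z in l2_spectrum A].

(* For a locally finite graph, as the universal cover of a finite graph is,
   the sum ranges over the finite set of the neighbours of v. *)
Definition adjacency_operator (adj : rel T) (f : T -> R[i]) (v : T) : R[i] :=
  \sum_(u \in [set u | adj v u]) f u.

End EllTwo.

(* The spectral radius of the universal covering tree of G: since G is
   connected, it does not depend on the base vertex v0. *)
Definition cover_spectral_radius (R : realType) (G : multigraph)
    (v0 : vertex G) : R :=
  l2_spectral_radius (@adjacency_operator R _ (@cover_adj G v0)).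

(* Main.v *)
(* The characteristic polynomials of all labelings of G are averaged. Expanding
   the determinants, only averages of products of complementary minors of
   pi(g) and pi(g^-1) enter, and Schur orthogonality for the exterior powers of
   pi makes them equal to those of the group of signed permutations. The average
   is therefore the mean of the matching polynomials of the d-covers of G. Such
   a matching polynomial is positive above the spectral radius of the covering
   tree, since a positive supersolution h of A h < x h on a large ball of the
   tree (produced by the resolvent) is propagated through the recursion deleting
   one vertex at a time.
   To pass from the average to one labeling, follow a lazy random walk on the
   labelings, each step multiplying the label of one edge by a pseudo-reflection.
   One such step changes two matrices by a rank-one modification, and a stability
   argument shows that every convex combination of the averages over the two
   branches is real-rooted; hence positivity of the mean on [y, +oo) passes to
   one of the branches. For long words the walk equidistributes from any start,
   so one finally reaches a labeling whose polynomial is positive on [y, +oo). *)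

Require Import Defs.
From mathcomp Require Import all_boot all_order all_algebra all_fingroup.
From mathcomp Require Import mxrepresentation complex reals.
From mathcomp Require Import ring lra.
From mathcomp Require Import boolp classical_sets cardinality fsbigop.
From mathcomp Require Import ereal esum.

Set Implicit Arguments.
Unset Strict Implicit.
Unset Printing Implicit Defensive.

Import Order.TTheory GRing.Theory Num.Theory.

Local Open Scope ring_scope.
Local Open Scope complex_scope.

(** * Real-rooted polynomials *)

(** The walk goes through reflections because they keep every choice binary and tractable.
    Conjugating one edge block by a reflection only multiplies its two off-diagonal blocks, relative
    to the axis, by [zeta] and its conjugate. These blocks have rank one, so the determinant is
    biaffine in two independent multipliers [s] and [t]. Being nonzero for [t = s^*] and [|s| <= 1]
    then passes to convex combinations. The obstacle is that the lazy walk is never exactly uniform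
    after finitely many steps, while its word has to be fixed before the point [x] of the half-line
    is known. Hence the quantitative form of the rest: the mean over all labelings is at least some
    [c > 0] on the whole of [[y, +oo)], each single polynomial is bounded below there, and [y] lies
    strictly above the spectral radius. This last gap closes at the end because there are finitely
    many labelings. Positive definiteness refers throughout to a form [H], later a sum of copies of
    a form invariant under [pi], one for each vertex. *)

Section Ellipse.
Variable R : rcfType.
Implicit Types a b c p q r s m : R.

Lemma quadratic_unit_crossing (a b u v : R) :
  a ^+ 2 + b ^+ 2 <= 1 -> (u != 0) || (v != 0) ->
  exists s, (a + s * u) ^+ 2 + (b + s * v) ^+ 2 = 1.
Proof.
move=> ab uv.
pose A := u ^+ 2 + v ^+ 2; pose B := a * u + b * v.
have A_gt0 : 0 < A.
  rewrite /A; case/orP: uv => h.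
    by rewrite ltr_wpDr ?sqr_ge0 // exprn_even_gt0.
  by rewrite ltr_wpDl ?sqr_ge0 // exprn_even_gt0.
pose D := B ^+ 2 + A * (1 - a ^+ 2 - b ^+ 2).
have D_ge0 : 0 <= D.
  by rewrite /D addr_ge0 ?sqr_ge0 // mulr_ge0 ?(ltW A_gt0) //; lra.
exists ((- B + Num.sqrt D) / A).
set w := Num.sqrt D; have w2 : w ^+ 2 = D by rewrite sqr_sqrtr.
have -> : (a + (- B + w) / A * u) ^+ 2 + (b + (- B + w) / A * v) ^+ 2
  = a ^+ 2 + b ^+ 2 + (w ^+ 2 - B ^+ 2) / A.
  have A0 := lt0r_neq0 A_gt0; rewrite /A in A0 *; rewrite /B; field; exact: A0.
have -> : w ^+ 2 - B ^+ 2 = A * (1 - a ^+ 2 - b ^+ 2) by rewrite w2 /D; ring.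
by rewrite mulrC mulKf ?lt0r_neq0 //; ring.
Qed.

(* In the nondegenerate case the ellipse [s |-> p a + q b, r a + s b] scaled by
   [k] from [0] to [1] sweeps the point [-(c + k^2 m)] which is outside of it
   at [k = 0]; were it inside at [k = 1], it would be hit at some [k]. *)
Lemma ellipse_real c1 c2 m1 m2 p q r s :
  (forall a b, a ^+ 2 + b ^+ 2 <= 1 ->
    c1 + (a ^+ 2 + b ^+ 2) * m1 + (p * a + q * b) = 0 ->
    c2 + (a ^+ 2 + b ^+ 2) * m2 + (r * a + s * b) = 0 -> False) ->
  forall a b, a ^+ 2 + b ^+ 2 <= 1 ->
    c1 + m1 + (p * a + q * b) = 0 -> c2 + m2 + (r * a + s * b) = 0 -> False.
Proof.
move=> H a b ab e1 e2.
have [D0|D0] := eqVneq (p * s - q * r) 0; last first.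
  pose D := p * s - q * r.
  pose T1 (x y : R) := (s * x - q * y) / D.
  pose T2 (x y : R) := (p * y - r * x) / D.
  (* Here [x] stands for [k^2]. With [T] the inverse of the linear map, [P.[x] = 0] says that
     [T (c + x m)] lies on the circle of radius [sqrt x]. *)
  pose P : {poly R} := ((T1 c1 c2)%:P + 'X * (T1 m1 m2)%:P) ^+ 2
                     + ((T2 c1 c2)%:P + 'X * (T2 m1 m2)%:P) ^+ 2 - 'X.
  have PE x : P.[x] = T1 (c1 + x * m1) (c2 + x * m2) ^+ 2
                    + T2 (c1 + x * m1) (c2 + x * m2) ^+ 2 - x.
    by rewrite /P !hornerE /T1 /T2 /=; field.
  have ea : a = - T1 (c1 + m1) (c2 + m2).
    have -> : c1 + m1 = - (p * a + q * b) by lra.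
    have -> : c2 + m2 = - (r * a + s * b) by lra.
    by rewrite /T1 /D; field.
  have eb : b = - T2 (c1 + m1) (c2 + m2).
    have -> : c1 + m1 = - (p * a + q * b) by lra.
    have -> : c2 + m2 = - (r * a + s * b) by lra.
    by rewrite /T2 /D; field.
  have P0 : 0 <= P.[0] by rewrite PE subr0 addr_ge0 ?sqr_ge0.
  have P1 : P.[1] <= 0.
    rewrite PE !mul1r -(sqrrN (T1 _ _)) -(sqrrN (T2 _ _)) -ea -eb; lra.
  have [x /andP[x0 x1]] := @poly_ivt _ (- P) 0 1 ler01
    ltac:(by rewrite !hornerN oppr_le0 oppr_ge0 P0 P1).
  rewrite rootN /root PE => /eqP Ex.
  set u := T1 _ _ in Ex; set v := T2 _ _ in Ex.
  have uv : u ^+ 2 + v ^+ 2 = x by lra.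
  apply: (H (- u) (- v)); rewrite ?sqrrN uv //.
    by rewrite /u /v /T1 /T2 /D; field.
  by rewrite /u /v /T1 /T2 /D; field.
(* Degenerate case: a kernel vector [(u, v)] moves [(a, b)] to the unit circle without changing the
   linear terms, and on the circle the hypothesis has the coefficient 1 before [m1] and [m2]. *)
have [u [v [uv f1 f2]]] : exists u v, [/\ (u != 0) || (v != 0),
    p * u + q * v = 0 & r * u + s * v = 0].
  have [pq|] := boolP ((q != 0) || (- p != 0)).
    by exists q, (- p); split => //; nra.
  rewrite negb_or !negbK oppr_eq0 => /andP[/eqP -> /eqP ->].
  have [rs|] := boolP ((s != 0) || (- r != 0)).
    by exists s, (- r); split => //; nra.
  rewrite negb_or !negbK oppr_eq0 => /andP[/eqP -> /eqP ->].
  by exists 1, 0; rewrite oner_eq0; split=> //; ring.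
have [t tE] := quadratic_unit_crossing ab uv.
apply: (H (a + t * u) (b + t * v)); rewrite ?tE // mul1r.
  transitivity (c1 + m1 + (p * a + q * b) + t * (p * u + q * v)); first ring.
  by rewrite f1 e1 mulr0 addr0.
transitivity (c2 + m2 + (r * a + s * b) + t * (r * u + s * v)); first ring.
by rewrite f2 e2 mulr0 addr0.
Qed.

Local Open Scope complex_scope.

(** In real coordinates [(a, b)] goes to [(a +i* b) L + (a -i* b) L'] by a real linear map of the
    plane, which is the map of [ellipse_real]. *)
Lemma ellipse (c M L L' : R[i]) :
  (forall a b : R, a ^+ 2 + b ^+ 2 <= 1 ->
    c + (a ^+ 2 + b ^+ 2)%:C * M + (a +i* b) * L + (a -i* b) * L' != 0) ->
  forall a b : R, a ^+ 2 + b ^+ 2 <= 1 ->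
    c + M + (a +i* b) * L + (a -i* b) * L' != 0.
Proof.
case: c => c1 c2; case: M => m1 m2; case: L => l1 l2; case: L' => n1 n2 H a b ab.
apply/negP; rewrite eq_complex /= => /andP[/eqP e1 /eqP e2].
apply: (@ellipse_real c1 c2 m1 m2 (l1 + n1) (n2 - l2) (l2 + n2) (l1 - n1)
  _ a b ab); [|lra|lra].
move=> a' b' ab' f1 f2; move: (H _ _ ab') => /negP; apply.
by rewrite eq_complex /=; apply/andP; split; apply/eqP; lra.
Qed.

End Ellipse.

(** * Passing from two real-rooted branches to one of them *)

Section Rounding.
Variable R : rcfType.
Implicit Types (f g : {poly R}) (s : seq R) (x y t : R).

Definition real_split (n : nat) f :=
  exists2 s, size s = n & f = \prod_(a <- s) ('X - a%:P).

Lemma horner_coef_ge0 f x :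
  (forall k, 0 <= f`_k) -> 0 <= x -> f`_0 <= f.[x].
Proof.
move=> f0 x0; rewrite horner_coef.
case E: (size f) => [|n].
  by rewrite big_ord0 nth_default ?lexx ?E.
rewrite big_ord_recl /= expr0 mulr1 lerDl sumr_ge0 // => i _.
by rewrite mulr_ge0 ?exprn_ge0.
Qed.

Lemma coef_prod_pos s :
  (forall a, a \in s -> a < 0) ->
  forall k, (k <= size s)%N -> 0 < (\prod_(a <- s) ('X - a%:P))`_k.
Proof.
elim: s => [|a s IH] hs k hk.
  by rewrite big_nil; move: hk; rewrite leqn0 => /eqP ->; rewrite coefC ltr01.
rewrite big_cons mulrBl coefB coefXM coefCM.
have a0 : a < 0 by apply: hs; rewrite mem_head.
have {}IH := IH (fun b hb => hs b (mem_behead (s := a :: s) hb)).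
case: k hk => [|k] hk /=; first by rewrite sub0r -mulNr mulr_gt0 ?oppr_gt0 ?IH.
have [hk'|hk'] := leqP k.+1 (size s).
  by rewrite -mulNr addr_gt0 ?mulr_gt0 ?oppr_gt0 ?IH // ltnW.
rewrite (nth_default _ (n := k.+1)) ?size_prod_XsubC //.
by rewrite mulr0 subr0 IH.
Qed.

Lemma real_split_pos n f :
  real_split n f -> (forall x, 0 <= x -> f.[x] != 0) ->
  forall k, (k <= n)%N -> 0 < f`_k.
Proof.
move=> [s <- fE] f0; rewrite fE; apply: coef_prod_pos => a sa.
rewrite ltNge; apply/negP => /f0 /negP; apply.
by rewrite fE -/(root _ _) root_prod_XsubC.
Qed.

(** A real-rooted polynomial has no vanishing coefficient among nonnegative ones once its value at 0
    is nonzero: such a polynomial has no root in [[0, +oo)], so all its roots are negative. *)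
Lemma real_split_pos_coef n f :
  real_split n f -> (forall k, (k <= n)%N -> 0 <= f`_k) -> f`_0 != 0 ->
  forall k, (k <= n)%N -> 0 < f`_k.
Proof.
move=> sf f0 f00; apply: real_split_pos => // x x0.
have h k : 0 <= f`_k.
  have [|hk] := leqP k n; first exact: f0.
  case: sf => s sz ->; rewrite nth_default // size_prod_XsubC sz //.
rewrite gt_eqF // (lt_le_trans _ (horner_coef_ge0 h x0)) //.
by rewrite lt_def f00 h.
Qed.

(** All coefficients of [f + g] are positive. If [f] had a nonpositive one, some mixture of [f] and
    [g] would have nonnegative coefficients, one of them zero, against [real_split_pos_coef]. *)
Lemma rounding0 n f g :
  (forall t, 0 <= t <= 1 -> real_split n ((1 - t) *: f + t *: g)) ->
  (forall x, 0 <= x -> 0 < (f + g).[x]) -> 0 < f.[0] ->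
  forall x, 0 <= x -> 0 < f.[x].
Proof.
move=> split_mix pos_mix f0 x x0.
have f00 : 0 < f`_0 by rewrite -horner_coef0.
have szf k : (n < k)%N -> f`_k = 0.
  have [|s sz] := split_mix 0; first by rewrite lexx ler01.
  rewrite subr0 scale1r scale0r addr0 => -> hk.
  by rewrite nth_default // size_prod_XsubC sz.
have cpos k : (k <= n)%N -> 0 < f`_k + g`_k.
  move=> hk; have [|s sz E] := split_mix 2^-1; first by lra.
  have sp : real_split n (2^-1 *: (f + g)).
    by exists s => //; rewrite -E scalerDr; congr (_ *: _ + _); lra.
  have := real_split_pos sp _ hk; rewrite coefZ coefD => h.
  have : 0 < 2^-1 * (f`_k + g`_k).
    apply: h => z z0; rewrite hornerZ mulf_neq0 ?invr_neq0 ?pnatr_eq0 //.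
    by rewrite gt_eqF // pos_mix.
  by rewrite pmulr_rgt0 // invr_gt0 ltr0n.
suff fpos k : (k <= n)%N -> 0 < f`_k.
  have fge k : 0 <= f`_k by case: (leqP k n) => [/fpos/ltW //|/szf ->].
  exact: lt_le_trans (horner_coef_ge0 fge x0).
rewrite -ltnS => hk; rewrite ltNge; apply/negP => fk.
(* [T i] is the time at which the coefficient [i] of [(1 - t) f + t g] vanishes. At the latest of
   these times no coefficient is negative any more. It comes before [1/2], where all are
   positive. *)
pose T (i : 'I_n.+1) := f`_i / (f`_i - g`_i).
case: (@arg_maxP _ _ _ (Ordinal hk) (fun i : 'I_n.+1 => f`_i <= 0) T fk) => j fj jmax.
have gj : 0 < f`_j + g`_j by apply: cpos; rewrite -ltnS.
have dj : f`_j - g`_j < 0 by lra.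
have Tj : T j * (f`_j - g`_j) = f`_j by rewrite mulfVK // lt_eqF.
have Tj0 : 0 <= T j by nra.
have Tj1 : T j < 2^-1.
  rewrite ltNge; apply/negP => h.
  have : T j * (f`_j - g`_j) <= 2^-1 * (f`_j - g`_j) by rewrite ler_wnM2r // ltW.
  by rewrite Tj; lra.
have /real_split_pos_coef H : real_split n ((1 - T j) *: f + T j *: g).
  by apply: split_mix; lra.
have : 0 < ((1 - T j) *: f + T j *: g)`_j.
  apply: H; last by rewrite -ltnS.
  move=> i; rewrite -ltnS => hi; rewrite coefD !coefZ.
    have gi : 0 < f`_i + g`_i by apply: cpos.
    have [fi|fi] := leP (f`_i) 0; last by nra.
    have h : f`_i / (f`_i - g`_i) <= T j := jmax (Ordinal hi) fi.
    have di : f`_i - g`_i < 0 by lra.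
    have : T j * (f`_i - g`_i) <= f`_i / (f`_i - g`_i) * (f`_i - g`_i).
      by rewrite ler_wnM2r // ltW.
    by rewrite mulfVK ?lt_eqF // => h'; lra.
  by rewrite gt_eqF // coefD !coefZ; have := cpos 0%N (leq0n n) => ?; nra.
rewrite coefD !coefZ => ?; lra.
Qed.

Lemma real_split_shift n f y : real_split n f -> real_split n (f \Po ('X + y%:P)).
Proof.
move=> [s sz ->]; exists [seq a - y | a <- s]; first by rewrite size_map.
rewrite big_map rmorph_prod; apply: eq_bigr => a _.
by rewrite rmorphB /= comp_polyX comp_polyC polyCB; ring.
Qed.

Lemma rounding n f g y :
  (forall t, 0 <= t <= 1 -> real_split n ((1 - t) *: f + t *: g)) ->
  (forall x, y <= x -> 0 < (f + g).[x]) ->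
  (forall x, y <= x -> 0 < f.[x]) \/ (forall x, y <= x -> 0 < g.[x]).
Proof.
move=> split_mix pos_mix.
wlog fy : f g split_mix pos_mix / 0 < f.[y].
  move=> H; have [fy|fy] := ltP 0 f.[y]; first exact: H.
  rewrite or_comm; apply: H.
  - move=> t ht; rewrite addrC -{1}[t](subKr 1); apply: split_mix; lra.
  - by move=> x /pos_mix; rewrite addrC.
  - by have := pos_mix y (lexx y); rewrite hornerD; lra.
left=> x yx.
have -> : f.[x] = (f \Po ('X + y%:P)).[x - y].
  by rewrite horner_comp !hornerE subrK.
apply: (@rounding0 n _ (g \Po ('X + y%:P))); last by rewrite subr_ge0.
- by move=> t /split_mix /(real_split_shift y); rewrite comp_polyD !comp_polyZ.
- move=> z z0; rewrite -comp_polyD horner_comp pos_mix // !hornerE lerDr //.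
- by rewrite horner_comp !hornerE.
Qed.

End Rounding.

(** * The lazy walk on labelings *)

Definition ffupd (E : finType) (T : Type) (g : {ffun E -> T}) e x : {ffun E -> T} :=
  [ffun e' => if e' == e then x else g e'].

Section LazyWalk.
Variables (R : archiRealFieldType) (E : finType) (gT : finGroupType).
Implicit Types (g : {ffun E -> gT}) (L W : seq (E * gT)).

Definition act_step (s : E * gT) g := ffupd g s.1 (s.2 * g s.1)%g.

Definition run L g := foldl (fun g s => act_step s g) g L.

(* The expectation of [F] after the lazy walk from [g] which performs each step
   of [L] with probability 1/2. *)
Fixpoint lazy_avg (V : lmodType R) L (F : {ffun E -> gT} -> V) g : V :=
  if L is s :: L' then
    2^-1 *: (lazy_avg L' F g + lazy_avg L' F (act_step s g))
  else F g.

Lemma lazy_avg_cat (V : lmodType R) L L' (F : {ffun E -> gT} -> V) g :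
  lazy_avg (L ++ L') F g = lazy_avg L (lazy_avg L' F) g.
Proof. by elim: L g => //= s L IH g; rewrite !IH. Qed.

Implicit Types F : {ffun E -> gT} -> R^o.

Lemma lazy_avg_shift L F (m : R) g :
  lazy_avg L F g = m + lazy_avg L (fun g => F g - m : R^o) g.
Proof.
elim: L g => [|s L IH] g /=; first by rewrite addrC subrK.
rewrite (IH g) (IH (act_step s g)) /GRing.scale /=; lra.
Qed.

Lemma lazy_avg_ge0 L F g : (forall g, 0 <= F g) -> 0 <= lazy_avg L F g.
Proof.
move=> F0; elim: L g => [|s L IH] g //=.
by rewrite mulr_ge0 ?addr_ge0 ?invr_ge0 ?ler0n.
Qed.

(** Among the [2 ^ size L] equally likely choices of performed steps, one performs exactly the
    letters of [W]. *)
Lemma lazy_avg_run L W F g : (forall g, 0 <= F g) -> subseq W L ->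
  2^-1 ^+ size L * F (run W g) <= lazy_avg L F g.
Proof.
move=> F0; elim: L W g => [|s L IH] W g.
  by rewrite subseq0 => /eqP ->; rewrite expr0 mul1r.
move=> WL; have [W' WL' E'] : exists2 W', subseq W' L &
    run W g = run W' g \/ run W g = run W' (act_step s g).
  case: W WL => [|t W] /=; first by exists [::]; [exact: sub0seq|left].
  by case: eqP => [-> |_] h; [exists W|exists (t :: W)]; auto.
rewrite /= exprS -mulrA /GRing.scale /= ler_pM2l ?invr_gt0 ?ltr0n //.
have h1 := IH W' g WL'; have h2 := IH W' (act_step s g) WL'.
have p1 := lazy_avg_ge0 L g F0; have p2 := lazy_avg_ge0 L (act_step s g) F0.
by case: E' => ->; [rewrite (le_trans h1) // lerDl
                  | rewrite (le_trans h2) // lerDr].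
Qed.

Lemma act_step_inj s : injective (act_step s).
Proof.
move=> g g' /ffunP h; apply/ffunP => e; move: (h e); rewrite !ffunE.
by case: eqP => // -> /mulgI.
Qed.

(** The uniform distribution is stationary, as each step permutes the labelings. *)
Lemma sum_lazy_avg L F : \sum_g lazy_avg L F g = \sum_g F g.
Proof.
elim: L => //= s L IH; rewrite -scaler_sumr big_split /=.
have <- : \sum_g lazy_avg L F g = \sum_g lazy_avg L F (act_step s g).
  by rewrite (reindex_inj (@act_step_inj s)).
rewrite IH /GRing.scale /=; lra.
Qed.

Section Generated.
Variable S : {set gT}.
Hypothesis genS : <<S>>%g = [set: gT].

Definition steps_in L := all (fun s => s.2 \in S) L.

Lemma steps_in_cat L L' : steps_in L -> steps_in L' -> steps_in (L ++ L').
Proof. by rewrite /steps_in all_cat => -> ->. Qed.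

Lemma run_cat L L' g : run (L ++ L') g = run L' (run L g).
Proof. exact: foldl_cat. Qed.

Lemma reach1 e x g : exists2 W, steps_in W & run W g = ffupd g e (x * g e)%g.
Proof.
have /gen_prodgP[n [c cS ->]] : x \in <<S>>%g by rewrite genS inE.
elim: n c cS => [|n IH] c cS.
  exists [::] => //; rewrite big_ord0 mul1g; apply/ffunP => e'.
  by rewrite ffunE; case: eqP => [-> |].
have [W WS WE] := IH (fun i => c (lift ord0 i)) (fun i => cS _).
(* Steps multiply on the left, so the first factor of the product is performed last. *)
exists (rcons W (e, c ord0)); first by rewrite /steps_in all_rcons /= cS; exact: WS.
rewrite -cats1 run_cat WE /= big_ord_recl; apply/ffunP => e'.
rewrite !ffunE /= eqxx; case: eqP => // _; exact: mulgA.
Qed.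

Lemma reach g g' : exists2 W, steps_in W & run W g = g'.
Proof.
suff [W WS WE] : exists2 W, steps_in W &
    run W g = [ffun e => if e \in enum E then g' e else g e].
  by exists W => //; rewrite WE; apply/ffunP => e; rewrite ffunE mem_enum.
elim: (enum E) => [|e s [W WS WE]].
  by exists [::] => //; apply/ffunP => e; rewrite ffunE.
have [V VS VE] := reach1 e (g' e * (run W g e)^-1)%g (run W g).
exists (W ++ V); first exact: steps_in_cat.
rewrite run_cat VE mulgKV WE; apply/ffunP => e'; rewrite !ffunE inE.
by case: eqP => // ->.
Qed.

Lemma covering_word :
  exists2 L, steps_in L & forall g g', exists2 W, subseq W L & run W g = g'.
Proof.
suff [L LS H] : exists2 L, steps_in L &
    forall p, p \in enum {: {ffun E -> gT} * {ffun E -> gT}} ->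
      exists2 W, subseq W L & run W p.1 = p.2.
  by exists L => // g g'; apply: (H (g, g')); rewrite mem_enum.
elim: (enum _) => [|p s [L LS H]]; first by exists [::].
have [W WS WE] := reach p.1 p.2.
exists (W ++ L); first exact: steps_in_cat.
move=> q; rewrite inE => /orP[/eqP ->|/H[V VL VE]].
  by exists W => //; apply: prefix_subseq.
by exists V => //; apply: subseq_trans VL (suffix_subseq _ _).
Qed.

(** A Doeblin argument: by [lazy_avg_run] for [F - m], each target [g'] forces the expected excess
    over [m] to be at least [2^-1 ^+ size L * (F g' - m)]. Averaging this over [g'] puts the mean
    [a] in place of [F g']. *)
Lemma lazy_avg_gap L :
  (forall g g', exists2 W, subseq W L & run W g = g') ->
  forall F (m a : R), (forall g, m <= F g) -> (\sum_g F g) = a *+ #|{ffun E -> gT}| ->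
  forall g, m + 2^-1 ^+ size L * (a - m) <= lazy_avg L F g.
Proof.
move=> cov F m a Fm avgF g; rewrite (lazy_avg_shift L F m) lerD2l.
set n := #|_| in avgF.
have n0 : 0 < n%:R :> R.
  by rewrite ltr0n; apply/card_gt0P; exists [ffun => 1%g].
rewrite -(ler_pM2l n0).
have -> : n%:R * (2^-1 ^+ size L * (a - m)) =
    \sum_g' 2^-1 ^+ size L * (F g' - m).
  rewrite -mulr_sumr sumrB avgF sumr_const -/n mulrCA; congr (_ * _).
  by rewrite mulrBr !mulr_natl.
rewrite mulr_natl /n -sumr_const; apply: ler_sum => g' _.
have [W WL <-] := cov g g'.
by apply: (@lazy_avg_run L W (fun g => F g - m)) => // h; rewrite subr_ge0.
Qed.

Lemma bernoulli_le (d : R) j : 0 <= d <= 1 -> (1 - d) ^+ j * (1 + j%:R * d) <= 1.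
Proof.
move=> /andP[d0 d1]; elim: j => [|j IH]; first by rewrite expr0 mul0r addr0 mul1r.
apply: le_trans IH; rewrite exprSr -mulrA ler_wpM2l ?exprn_ge0 ?subr_ge0 //.
have j0 : 0 <= j%:R :> R := ler0n _ _.
rewrite -natr1; nra.
Qed.

(* Each pass of the lazy walk along a word containing all the others shrinks
   the gap between the mean of [F] and its minimum by a fixed factor. *)
Lemma lazy_avg_pos (c B : R) : 0 < c ->
  exists2 L, steps_in L & forall F, (forall g, - B <= F g) ->
    c *+ #|{ffun E -> gT}| <= \sum_g F g -> forall g, 0 < lazy_avg L F g.
Proof.
move=> c0; have [L LS cov] := covering_word.
pose d : R := 2^-1 ^+ size L.
have d0 : 0 < d by rewrite exprn_gt0 // invr_gt0 ltr0n.
have d1 : d <= 1 by rewrite exprn_ile1 ?invr_ge0 ?ler0n // invf_le1 ?ler1n ?ltr0n.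
(* This [j] satisfies [j c d > c + |B|]. With the Bernoulli bound it makes the remaining gap
   [(1 - d) ^+ j * (c + |B|)] smaller than [c]. Neither [j] nor [L] depends on [F]. *)
pose j := Num.bound ((c + `|B|) / (c * d)).
exists (flatten (nseq j L)).
  by elim: (j) => //= k IH; apply: steps_in_cat.
move=> F FB avgF.
set n := #|_| in avgF.
have n0 : 0 < n%:R :> R.
  by rewrite ltr0n; apply/card_gt0P; exists [ffun => 1%g].
pose a := (\sum_g F g) / n%:R.
have aE : \sum_g F g = a *+ n by rewrite -mulr_natr /a divfK ?gt_eqF.
have ca : c <= a by rewrite /a ler_pdivlMr // mulr_natr.
have key k g : a - (1 - d) ^+ k * (a + `|B|) <= lazy_avg (flatten (nseq k L)) F g.
  elim: k g => [|k IH] g.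
    rewrite expr0 mul1r opprD addNKr /=; apply: le_trans (FB g).
    by rewrite lerN2 ler_norm.
  rewrite /= lazy_avg_cat.
  apply: le_trans (lazy_avg_gap cov IH (a := a) _ g); last by rewrite sum_lazy_avg.
  rewrite -/d exprS; set x := (1 - d) ^+ k.
  rewrite le_eqVlt; apply/orP; left; apply/eqP. ring.
move=> g; apply: lt_le_trans (key j g).
have hj : (c + `|B|) / (c * d) < j%:R.
  by rewrite archi_boundP // divr_ge0 ?addr_ge0 ?mulr_ge0 ?(ltW c0) ?(ltW d0).
have := @bernoulli_le d j; rewrite d1 (ltW d0) => /(_ isT).
set x := (1 - d) ^+ j => hx.
rewrite ltr_pdivrMr ?mulr_gt0 // in hj.
have B0 := normr_ge0 B; set b := `|B| in B0 hj *.
have x0 : 0 <= x by rewrite exprn_ge0 // subr_ge0.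
have x1 : x * (c + b) <= c * (1 - x).
  have h1 : x * (c + b) <= x * (j%:R * (c * d)) by rewrite ler_wpM2l // ltW.
  have h2 : c * (x * (1 + j%:R * d)) <= c * 1 by rewrite ler_pM2l.
  nra.
have [x00|xpos] := eqVneq x 0; first by rewrite x00 mul0r subr0 (lt_le_trans c0).
have {}xpos : 0 < x by rewrite lt_def xpos x0.
have x2 : x * (c + b) < c.
  by apply: le_lt_trans x1 _; rewrite mulrBr mulr1 ltrBlDl ltrDr mulr_gt0.
have x3 : x <= 1 by rewrite exprn_ile1 ?subr_ge0 // lerBlDr lerDl ltW.
nra.
Qed.

End Generated.
End LazyWalk.

(** * Stability of averaged determinants *)

Lemma det_add_mulmx (F : comNzRingType) n m (W : 'M[F]_n) (c : 'M_(n, m)) (r : 'M_(m, n)) :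
  \det (W + c *m r) = \det (block_mx W (- c) r 1%:M).
Proof.
have -> : block_mx W (- c) r (1%:M : 'M_m) =
    block_mx 1%:M (- c) 0 1%:M *m block_mx (W + c *m r) 0 r 1%:M.
  by rewrite mulmx_block !mul1mx !mul0mx !mulmx1 !add0r mulNmx addrK.
by rewrite det_mulmx det_ublock det_lblock !det1 !mul1r mulr1.
Qed.

(** In the bordered matrix of [det_add_mulmx] the scalar [s] occurs in the last row only, so the
    determinant is affine in [s]. *)
Lemma det_add_rank1 (F : comNzRingType) n (W : 'M[F]_n) (c : 'cV_n) (r : 'rV_n) (s : F) :
  \det (W + s *: (c *m r)) = \det W + s * (\det (W + c *m r) - \det W).
Proof.
pose i0 : 'I_(n + 1) := rshift n 0.
pose M (t : F) := block_mx W (- c) (t *: r) (1%:M : 'M_1).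
have cofE t j : cofactor (M t) i0 j = cofactor (M 0) i0 j.
  rewrite /cofactor; congr (_ * \det _); apply/matrixP => i k; rewrite !mxE.
  case: (split_ordP (lift i0 i)) => i' E; first by rewrite !mxE.
  by move: (neq_lift i0 i); rewrite E (ord1 i') eqxx.
have [A [B AB]] : exists A B, forall t, \det (W + t *: (c *m r)) = t * A + B.
  exists (\sum_j r 0 j * cofactor (M 0) i0 (lshift 1 j)).
  exists (cofactor (M 0) i0 (rshift n 0)) => t.
  rewrite scalemxAr det_add_mulmx -/(M t) (expand_det_row _ i0).
  rewrite (eq_bigr _ (fun j _ => congr1 _ (cofE t j))) big_split_ord /= big_ord1.
  rewrite {2}/M block_mxEdr mxE eqxx mul1r mulr_sumr; congr (_ + _).
  by apply: eq_bigr => j _; rewrite {1}/M block_mxEdl mxE mulrA.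
have e1 := AB 1; have e0 := AB 0.
rewrite scale1r mul1r in e1; rewrite scale0r addr0 mul0r add0r in e0.
by rewrite AB e1 e0; ring.
Qed.

Lemma zmod_AC (V : zmodType) (a b c d e : V) :
  a + d + c + b = a + c + (b + e) + (d - e).
Proof. by rewrite [d - e]addrC -!addrA addNKr (addrCA d) (addrC d). Qed.

Lemma biaffine (F : comNzRingType) (g : F -> F -> F) :
  (forall s t, g s t = g 0 t + s * (g 1 t - g 0 t)) ->
  (forall s t, g s t = g s 0 + t * (g s 1 - g s 0)) ->
  forall s t, g s t = g 0 0 + s * (g 1 0 - g 0 0) + t * (g 0 1 - g 0 0)
    + s * t * (g 1 1 - g 1 0 - g 0 1 + g 0 0).
Proof. by move=> h1 h2 s t; rewrite h1 (h2 0) (h2 1); ring. Qed.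

Section EllipseBiaffine.
Variable R : rcfType.
Local Notation C := R[i].

Lemma mulC_conj (x y : R) : (x +i* y) * (x -i* y) = (x ^+ 2 + y ^+ 2)%:C.
Proof. by apply/eqP; rewrite eq_complex /=; apply/andP; split; apply/eqP; ring. Qed.

Lemma ellipse_biaffine (g : C -> C -> C) (p a b : R) :
  0 <= p <= 1 -> a ^+ 2 + b ^+ 2 = 1 ->
  (forall s t, g s t = g 0 t + s * (g 1 t - g 0 t)) ->
  (forall s t, g s t = g s 0 + t * (g s 1 - g s 0)) ->
  (forall x y : R, x ^+ 2 + y ^+ 2 <= 1 -> g (x +i* y) (x -i* y) != 0) ->
  (1 - p)%:C * g 1 1 + p%:C * g (a +i* b) (a -i* b) != 0.
Proof.
move=> /andP[p0 p1] ab h1 h2 gn0.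
have gE := biaffine h1 h2; rewrite (gE 1) (gE (a +i* b)) mulC_conj ab.
have aE : (1 - p + p * a) +i* (p * b) = (1 - p)%:C + p%:C * (a +i* b).
  by apply/eqP; rewrite eq_complex /=; apply/andP; split; apply/eqP; ring.
have bE : (1 - p + p * a) -i* (p * b) = (1 - p)%:C + p%:C * (a -i* b).
  by apply/eqP; rewrite eq_complex /=; apply/andP; split; apply/eqP; ring.
have pE : (1 - p)%:C = 1 - p%:C by rewrite rmorphB.
have := @ellipse R (g 0 0) (g 1 1 - g 1 0 - g 0 1 + g 0 0)
  (g 1 0 - g 0 0) (g 0 1 - g 0 0) _ (1 - p + p * a) (p * b).
rewrite aE bE pE => ell; apply: contra (ell _ _); first by move/eqP => h; apply/eqP; rewrite -[RHS]h; ring.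
  move=> x y xy; apply: contra (gn0 x y xy) => /eqP h; apply/eqP.
  by rewrite gE mulC_conj -[RHS]h; ring.
have a1 : a <= 1 by nra.
have h := mulr_ge0 (mulr_ge0 p0 (_ : 0 <= 1 - p)) (_ : 0 <= 1 - a).
rewrite !subr_ge0 in h; have {}h := h p1 a1.
have -> : (1 - p + p * a) ^+ 2 + (p * b) ^+ 2 =
  1 - 2 * (p * (1 - p) * (1 - a)) + p ^+ 2 * (a ^+ 2 + b ^+ 2 - 1) by ring.
rewrite ab; lra.
Qed.

End EllipseBiaffine.

Section Stability.
Variables (R : rcfType) (N : nat).
Local Notation C := R[i].

Definition adjmx m n (A : 'M[C]_(m, n)) : 'M[C]_(n, m) := (map_mx conjc A)^T.

Lemma adjmxM m n p (A : 'M[C]_(m, n)) (B : 'M[C]_(n, p)) :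
  adjmx (A *m B) = adjmx B *m adjmx A.
Proof. by rewrite /adjmx map_mxM trmx_mul. Qed.

Lemma adjmxD m n (A B : 'M[C]_(m, n)) : adjmx (A + B) = adjmx A + adjmx B.
Proof. by rewrite /adjmx map_mxD linearD. Qed.

Lemma adjmxK m n : cancel (@adjmx m n) (@adjmx n m).
Proof. by move=> A; apply/matrixP => i j; rewrite !mxE conjcK. Qed.

Lemma adjmx1 n : adjmx (1%:M : 'M[C]_n) = 1%:M.
Proof. by rewrite /adjmx map_mx1 trmx1. Qed.

Lemma adjmxZ m n a (A : 'M[C]_(m, n)) : adjmx (a *: A) = a^* *: adjmx A.
Proof. by rewrite /adjmx map_mxZ linearZ. Qed.

Variable H : 'M[C]_N.
Hypothesis H_pos : forall v : 'rV_N, v != 0 -> 0 < (v *m H *m adjmx v) 0 0.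

Section Positivity.
Implicit Types (Z U V : 'M[C]_N).

Definition hform Z (v : 'rV_N) : C := (v *m Z *m H *m adjmx v) 0 0.

Lemma hformD Z Z' v : hform (Z + Z') v = hform Z v + hform Z' v.
Proof. by rewrite /hform mulmxDr !mulmxDl mxE. Qed.

Lemma hformZ a Z v : hform (a *: Z) v = a * hform Z v.
Proof. by rewrite /hform -scalemxAr -!scalemxAl mxE. Qed.

(** The analogue for matrices of the closed upper half-plane, relative to [H]. *)
Definition im_pos Z := forall v, 0 <= complex.Im (hform Z v).

Lemma ImD (x y : C) : complex.Im (x + y) = complex.Im x + complex.Im y.
Proof. by case: x => a b; case: y. Qed.

Lemma im_posD Z Z' : im_pos Z -> im_pos Z' -> im_pos (Z + Z').
Proof. by move=> p p' v; rewrite hformD ImD; apply: addr_ge0 (p v) (p' v). Qed.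

Lemma im_pos0 : im_pos 0.
Proof. by move=> v; rewrite /hform mulmx0 !mul0mx mxE; apply: lexx. Qed.

Lemma Im_realM (a : R) (z : C) : complex.Im (a%:C * z) = a * complex.Im z.
Proof. by case: z => x y /=; ring. Qed.

Lemma im_posZ (a : R) Z : 0 <= a -> im_pos Z -> im_pos (a%:C *: Z).
Proof. by move=> a0 p v; rewrite hformZ Im_realM; apply: mulr_ge0 (p v). Qed.

Lemma im_pos_congr U V Z : V *m H = H *m adjmx U -> im_pos Z -> im_pos (U *m Z *m V).
Proof.
move=> UV p v; suff -> : hform (U *m Z *m V) v = hform Z (v *m U) by [].
by rewrite /hform adjmxM -!mulmxA (mulmxA V) UV !mulmxA.
Qed.

Lemma im_pos_sum (I : finType) (F : I -> 'M_N) :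
  (forall i, im_pos (F i)) -> im_pos (\sum_i F i).
Proof. by move=> p; apply: (big_ind im_pos); [exact: im_pos0|exact: im_posD|]. Qed.

(** On a kernel vector [v] the form would vanish, whereas its imaginary part is [Im z] times the
    positive number [v H v^*], plus a nonnegative term. *)
Lemma im_pos_det z Z : 0 < complex.Im z -> im_pos Z -> \det (z%:M + Z) != 0.
Proof.
move=> z0 p; apply/det0P => -[v v0 vZ].
have e : hform (z%:M + Z) v = 0 by rewrite /hform vZ !mul0mx mxE.
have wp := H_pos v0; have pv := p v.
rewrite hformD -scalemx1 hformZ {1}/hform mulmx1 in e.
move: e wp pv; set w := (v *m H *m adjmx v) 0 0; set y := hform Z v.
case: w => c d; case: y => x y; case: z z0 {vZ} => a b /= b0.
move=> /eqP; rewrite eq_complex ltcE /= => /andP[_ /eqP e] /andP[/eqP d0 c0] y0.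
by have := mulr_gt0 b0 c0; move: e; rewrite d0; lra.
Qed.

End Positivity.

Variables (E : finType) (gT : finGroupType) (Rp : E -> gT -> 'M[C]_N).

Implicit Types (Z : E -> 'M[C]_N) (U V X Y : 'M[C]_N).

Definition upd (Z : E -> 'M[C]_N) e X := fun e' => if e' == e then X else Z e'.

Lemma updK Z e X Y : upd (upd Z e X) e Y = upd Z e Y.
Proof. by apply/boolp.funext => e'; rewrite /upd; case: eqP. Qed.

Lemma upd_id Z e : upd Z e (Z e) = Z.
Proof. by apply/boolp.funext => e'; rewrite /upd; case: eqP => [->|]. Qed.

Lemma updC Z e f X Y : e != f -> upd (upd Z e X) f Y = upd (upd Z f Y) e X.
Proof.
move=> ef; apply/boolp.funext => e'; rewrite /upd.
by case: (eqVneq e' f) => // ->; rewrite eq_sym (negbTE ef).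
Qed.

Lemma upd_eq Z e X : upd Z e X e = X.
Proof. by rewrite /upd eqxx. Qed.

Definition conj_step (s : E * gT) Z := upd Z s.1 (Rp s.1 s.2 *m Z s.1 *m Rp s.1 s.2^-1).

(** The slots are arbitrary matrices and not only those coming from labelings: the stability
    induction also evaluates the average at twisted slots, which no labeling produces. *)
Fixpoint avg_det (L : seq (E * gT)) (z : C) (Z : E -> 'M[C]_N) : C :=
  if L is s :: L' then
    (2^-1 : R)%:C * (avg_det L' z Z + avg_det L' z (conj_step s Z))
  else \det (z%:M + \sum_e Z e).

(** Conjugation sends a rank-one perturbation of a slot to a rank-one perturbation, so
    [det_add_rank1] survives along every branch of the walk. *)
Lemma avg_det_affine L z Z e X (c : 'cV_N) (r : 'rV_N) s :
  avg_det L z (upd Z e (X + s *: (c *m r))) =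
  avg_det L z (upd Z e X) +
    s * (avg_det L z (upd Z e (X + c *m r)) - avg_det L z (upd Z e X)).
Proof.
elim: L Z X c r => [|[f g] L IH] Z X c r.
  have sumE Y : \sum_e' upd Z e Y e' = \sum_(e' | e' != e) Z e' + Y.
    rewrite (bigD1 e) //= upd_eq addrC; congr (_ + _).
    by apply: eq_bigr => e' /negbTE h; rewrite /upd h.
  by rewrite /= !sumE !addrA det_add_rank1.
rewrite /= /conj_step /=; case: (eqVneq e f) => [<-|ef].
  rewrite !updK !upd_eq IH !mulmxDr !mulmxDl -scalemxAr -scalemxAl.
  rewrite !mulmxA -(mulmxA (Rp e g *m c)) IH; ring.
rewrite ![upd _ e _ f]/upd [f == e]eq_sym (negbTE ef).
rewrite !(updC _ _ _ ef) !IH; ring.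
Qed.

Definition stable L := forall z Z, 0 < complex.Im z -> (forall e, im_pos (Z e)) ->
  avg_det L z Z != 0.

(** [c *m r] is the [H]-selfadjoint projection onto the axis, [a +i* b] the eigenvalue there, of
    modulus 1, and [V] the inverse of [U]. *)
Definition hreflection U V := exists (c : 'cV[C]_N) (r : 'rV[C]_N) (a b : R),
  [/\ r *m c = 1%:M, c *m r *m H = H *m adjmx (c *m r), a ^+ 2 + b ^+ 2 = 1,
      U = 1%:M + ((a +i* b) - 1) *: (c *m r)
    & V = 1%:M + ((a -i* b) - 1) *: (c *m r)].

(** The block decomposition of [X] relative to [c *m r], with the two off-diagonal blocks scaled by
    [s] and [t]. These are written as a column times a row, the form to which [avg_det_affine]
    applies. *)
Definition twist (c : 'cV[C]_N) (r : 'rV[C]_N) X (s t : C) :=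
  (1%:M - c *m r) *m X *m (1%:M - c *m r) + c *m r *m X *m (c *m r)
   + s *: (c *m (r *m X *m (1%:M - c *m r)))
   + t *: ((1%:M - c *m r) *m X *m c *m r).

(** The product alone would also scale the block on the axis by [s t], which the last term corrects.
    For [t = s^*] and [|s| <= 1] the product is a congruence and the correction has the nonnegative
    factor [1 - |s|^2]. *)
Lemma twistE (c : 'cV[C]_N) (r : 'rV[C]_N) (s t : C) X :
  twist c r X s t = (1%:M + (s - 1) *: (c *m r)) *m X *m (1%:M + (t - 1) *: (c *m r))
    + (1 - s * t) *: (c *m r *m X *m (c *m r)).
Proof.
have E1 u : 1%:M + (u - 1) *: (c *m r) = (1%:M - c *m r) + u *: (c *m r).
  by rewrite scalerBl scale1r addrA addrAC.
rewrite /twist !E1; set Q := 1%:M - c *m r.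
have -> : c *m (r *m X *m Q) = c *m r *m X *m Q by rewrite !mulmxA.
have -> : Q *m X *m c *m r = Q *m X *m (c *m r) by rewrite !mulmxA.
set P := c *m r; rewrite scalerBl scale1r.
have -> : (Q + s *: P) *m X *m (Q + t *: P) =
    Q *m X *m Q + s *: (P *m X *m Q) + (t *: (Q *m X *m P) + (s * t) *: (P *m X *m P)).
  by rewrite mulmxDr -scalemxAr !mulmxDl -!scalemxAl scalerDr scalerA (mulrC t).
exact: zmod_AC.
Qed.

Lemma im_pos_twist (c : 'cV[C]_N) (r : 'rV[C]_N) X (x y : R) :
  c *m r *m H = H *m adjmx (c *m r) -> im_pos X -> x ^+ 2 + y ^+ 2 <= 1 ->
  im_pos (twist c r X (x +i* y) (x -i* y)).
Proof.
move=> PH Xp xy; rewrite twistE mulC_conj.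
have -> : 1 - (x ^+ 2 + y ^+ 2)%:C = (1 - (x ^+ 2 + y ^+ 2))%:C by rewrite rmorphB.
apply: im_posD; last first.
  by apply: im_posZ; [rewrite subr_ge0|apply: im_pos_congr].
apply: im_pos_congr Xp.
rewrite mulmxDl mul1mx -scalemxAl PH adjmxD adjmx1 mulmxDr mulmx1 adjmxZ -scalemxAr.
congr (_ + _ *: _).
by rewrite rmorphB rmorph1.
Qed.

(* A reflection multiplies the two off-diagonal blocks, relative to its axis, of
   a slot by [zeta] and [zeta^*]; replacing these by [s] and [s^*] with
   [|s| <= 1] preserves positivity, so that [ellipse] applies. *)
Lemma stable_mix L e g (p : R) z Z : stable L -> 0 <= p <= 1 ->
  (Rp e g = 1%:M /\ Rp e g^-1 = 1%:M) \/ hreflection (Rp e g) (Rp e g^-1) ->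
  0 < complex.Im z -> (forall e, im_pos (Z e)) ->
  (1 - p)%:C * avg_det L z Z + p%:C * avg_det L z (conj_step (e, g) Z) != 0.
Proof.
move=> sL p01 [[g1 g2]|[c [r [a [b [rc PH ab gE gE']]]]]] z0 Zp.
  rewrite /conj_step /= g1 g2 mul1mx mulmx1 upd_id -mulrDl -rmorphD /= subrK mul1r.
  exact: sL.
pose g0 s t := avg_det L z (upd Z e (twist c r (Z e) s t)).
have g0E1 s t : g0 s t = g0 0 t + s * (g0 1 t - g0 0 t).
  rewrite /g0 /twist; set D := _ + _ *m (c *m r).
  do 3 rewrite (addrAC D (_ *: (c *m _))).
  by rewrite avg_det_affine scale0r addr0 scale1r.
have g0E2 s t : g0 s t = g0 s 0 + t * (g0 s 1 - g0 s 0).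
  by rewrite /g0 /twist avg_det_affine scale0r addr0 scale1r.
have e1 : avg_det L z Z = g0 1 1.
  rewrite /g0 twistE mulr1 subrr !scale0r !addr0 mul1mx mulmx1.
  exact: (congr1 _ (esym (upd_id Z e))).
have abC : (a +i* b) * (a -i* b) = 1 by rewrite mulC_conj ab.
have e2 : avg_det L z (conj_step (e, g) Z) = g0 (a +i* b) (a -i* b).
  by rewrite /g0 twistE abC subrr scale0r addr0 /conj_step /= gE gE'.
rewrite e1 e2; apply: ellipse_biaffine p01 ab g0E1 g0E2 _ => x y xy.
by apply: (sL z _ z0) => e'; rewrite /upd; case: eqP => // _; apply: im_pos_twist.
Qed.

End Stability.

Lemma horner_char_poly (F : comNzRingType) n (A : 'M[F]_n) z :
  (char_poly A).[z] = \det (z%:M - A).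
Proof.
rewrite /char_poly -horner_evalE -det_map_mx; congr (\det _).
by apply/matrixP => i j; rewrite !mxE /= /horner_eval hornerD hornerN hornerC hornerMn hornerX.
Qed.

(** * From nonvanishing in the upper half-plane to real roots *)

Section RealRooted.
Variable R : rcfType.
Local Notation C := R[i].
Local Notation toC := (map_poly (real_complex R)).

Lemma real_roots_split (n : nat) (p : {poly C}) :
  p \is monic -> size p = n.+1 -> (forall z, root p z -> complex.Im z = 0) ->
  exists2 f : {poly R}, real_split n f & p = toC f.
Proof.
move=> mp sp rp; have [rs pE] := closed_field_poly_normal p.
rewrite (monicP mp) scale1r in pE.
exists (\prod_(z <- map (@complex.Re R) rs) ('X - z%:P)).
  exists (map (@complex.Re R) rs) => //; rewrite size_map.
  by move: sp; rewrite pE size_prod_XsubC => -[].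
rewrite [LHS]pE rmorph_prod big_map; apply: eq_big_seq => z zrs.
have /rp : root p z by rewrite pE root_prod_XsubC.
by case: z zrs => a b zrs /= b0; rewrite rmorphB /= map_polyX map_polyC /= b0.
Qed.

Definition monic_deg n (f : {poly R}) := f`_n = 1 /\ forall k, (n < k)%N -> f`_k = 0.

Lemma real_split_monic n f : real_split n f -> monic_deg n f.
Proof.
move=> [s sn ->]; split.
  have := monicP (monic_prod_XsubC s predT id).
  by rewrite /lead_coef size_prod_XsubC sn.
by move=> k nk; rewrite nth_default // size_prod_XsubC sn.
Qed.

Lemma monic_deg_mix n f g t : monic_deg n f -> monic_deg n g ->
  monic_deg n ((1 - t) *: f + t *: g).
Proof.
move=> [f1 f0] [g1 g0]; split=> [|k nk]; rewrite coefD !coefZ.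
  by rewrite f1 g1 !mulr1 subrK.
by rewrite f0 // g0 // !mulr0 addr0.
Qed.

Lemma horner_toC_conj (f : {poly R}) z : (toC f).[conjc z] = conjc (toC f).[z].
Proof.
rewrite -horner_map -map_poly_comp; congr (_.[_]).
by apply: eq_map_poly => x /=; rewrite oppr0.
Qed.

(** Real coefficients make the root set symmetric under conjugation, so the lower half-plane is free
    of roots as well. *)
Lemma stable_real_split n f : monic_deg n f ->
  (forall z : C, 0 < complex.Im z -> (toC f).[z] != 0) -> real_split n f.
Proof.
move=> [f1 f0] fs.
have sf : size f = n.+1.
  apply/eqP; rewrite eqn_leq; apply/andP; split.
    by apply/leq_sizeP => k /f0.
  by rewrite ltnNge; apply/negP => /leq_sizeP /(_ n (leqnn n)) /eqP; rewrite f1 oner_eq0.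
have mf : toC f \is monic by rewrite map_monic monicE /lead_coef sf f1.
have szf : size (toC f) = n.+1 by rewrite size_map_poly.
have [z|g gs fg] := real_roots_split mf szf.
  rewrite /root => fz; apply/eqP; case: ltgtP => // h.
    have := fs (conjc z); rewrite horner_toC_conj conjc_eq0 fz => /(_ _)/negP; case.
      by case: z h {fz} => a b /=; rewrite oppr_gt0.
    by [].
  by have := fs z h; rewrite fz.
by have -> : f = g by apply: (map_poly_inj (real_complex R)).
Qed.

Lemma real_split_lower_bound n f y : real_split n f ->
  exists2 B : R, 0 <= B & forall x, y <= x -> - B <= f.[x].
Proof.
move=> [s _ ->].
(* [M] bounds [|y|] and the modulus of every root: beyond [M] all factors are nonnegative, and
   between [y] and [M] each has modulus at most [2 M]. *)
pose M := `|y| + \sum_(a <- s) `|a|.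
have sM : forall a, a \in s -> `|a| <= \sum_(a <- s) `|a|.
  move=> a sa; rewrite (big_rem a) //= lerDl sumr_ge0 //.
have M0 : 0 <= M by rewrite addr_ge0 // sumr_ge0.
exists ((M + M) ^+ size s); first by rewrite exprn_ge0 // addr_ge0.
move=> x yx; rewrite horner_prod.
under eq_bigr do rewrite hornerXsubC.
have [Mx|xM] := leP M x.
  apply: (@le_trans _ _ 0); first by rewrite oppr_le0 exprn_ge0 // addr_ge0.
  rewrite big_seq prodr_ge0 // => a sa; rewrite subr_ge0.
  apply: le_trans Mx; apply: le_trans (ler_norm _) _.
  by apply: le_trans (sM a sa) _; rewrite /M lerDr.
have xM' : `|x| <= M.
  rewrite ler_norml (ltW xM) andbT; apply: le_trans yx.
  rewrite lerNl; apply: le_trans (ler_norm _) _; rewrite normrN /M lerDl sumr_ge0 //.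
suff : `|\prod_(a <- s) (x - a)| <= (M + M) ^+ size s by rewrite ler_norml => /andP[].
rewrite normr_prod.
have -> : (M + M) ^+ size s = \prod_(a <- s) (M + M) by rewrite big_const_seq count_predT iter_mulr_1.
rewrite big_seq [leRHS]big_seq; apply: ler_prod => a sa; rewrite normr_ge0 /=.
apply: le_trans (ler_normB _ _) _; apply: lerD => //.
by apply: le_trans (sM a sa) _; rewrite /M lerDr.
Qed.

End RealRooted.

(** * The walk on characteristic polynomials of labelings *)

Section RoundingWalk.
Variables (R : realType) (N : nat).
Local Notation C := R[i].
Local Notation toC := (map_poly (real_complex R)).
Variable H : 'M[C]_N.
Hypothesis H_pos : forall v : 'rV_N, v != 0 -> 0 < (v *m H *m adjmx v) 0 0.
Variables (E : finType) (gT : finGroupType) (Rp : E -> gT -> 'M[C]_N).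
Hypothesis RpM : forall e g h, Rp e (g * h)%g = Rp e g *m Rp e h.
Hypothesis RpH : forall e g, Rp e g^-1 *m H = H *m adjmx (Rp e g).
Variable S : {set gT}.
Hypothesis genS : <<S>>%g = [set: gT].
Hypothesis reflS : forall e g, g \in S ->
  (Rp e g = 1%:M /\ Rp e g^-1 = 1%:M) \/ hreflection H (Rp e g) (Rp e g^-1).
Variable B : E -> 'M[C]_N.
Hypothesis B_real : forall e v, complex.Im (hform H (B e) v) = 0.

Implicit Types (g : {ffun E -> gT}) (L : seq (E * gT)).

Definition labelled g : 'M[C]_N := \sum_e Rp e (g e) *m B e *m Rp e (g e)^-1.

(** The sign turns [z%:M - labelled g] into [z] plus a sum of slots, as in [avg_det]. The form of
    each slot is real, so the sign does not affect [im_pos]. *)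
Definition slots g e := - (Rp e (g e) *m B e *m Rp e (g e)^-1).

Lemma sum_slots g : \sum_e slots g e = - labelled g.
Proof. exact: sumrN. Qed.

Lemma hform_slots g e v : complex.Im (hform H (Rp e (g e) *m B e *m Rp e (g e)^-1) v) = 0.
Proof.
suff -> : hform H (Rp e (g e) *m B e *m Rp e (g e)^-1) v = hform H (B e) (v *m Rp e (g e)).
  exact: B_real.
by rewrite /hform adjmxM -!mulmxA (mulmxA (Rp e (g e)^-1)) RpH !mulmxA.
Qed.

Lemma hform_labelled g v : complex.Im (hform H (labelled g) v) = 0.
Proof.
rewrite /labelled; elim/big_ind: _ => [|X Y hX hY|e _].
- by rewrite /hform mulmx0 !mul0mx mxE.
- by rewrite hformD ImD hX hY addr0.
- exact: hform_slots.
Qed.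

Lemma im_pos_slots g e : im_pos H (slots g e).
Proof.
move=> v; rewrite /slots -scaleN1r hformZ.
have := hform_slots g e v; set w := hform _ _ _.
by rewrite mulN1r; case: w => a b /= ->; rewrite oppr0.
Qed.

Lemma slots_step s g : slots (act_step s g) = conj_step Rp s (slots g).
Proof.
apply/boolp.funext => e; rewrite /conj_step /upd /slots ffunE.
case: eqP => [->|//]; rewrite invMg !RpM mulmxN mulNmx; congr (- _).
by rewrite !mulmxA.
Qed.

Lemma steps_stable L : steps_in S L -> stable H Rp L.
Proof.
elim: L => [_|[e g] L IH /andP[gS LS]] z Z z0 Zp.
  by apply: (im_pos_det H_pos z0); apply: im_pos_sum.
have := stable_mix (p := 2^-1) (e := e) (g := g) (IH LS) _ (reflS e gS) z0 Zp.
rewrite /= invr_ge0 ler0n invf_le1 ?ltr0n // ler1n => /(_ isT).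
have -> : 1 - 2^-1 = 2^-1 :> R by lra.
by rewrite mulrDr.
Qed.

Lemma eigenvalue_labelled_real g z : root (char_poly (labelled g)) z -> complex.Im z = 0.
Proof.
rewrite /root horner_char_poly => /det0P[v v0 vz].
have := H_pos v0; have : hform H (z%:M - labelled g) v = 0.
  by rewrite /hform vz !mul0mx mxE.
rewrite hformD -scaleN1r -scalemx1 !hformZ {1}/hform mulmx1.
have := hform_labelled g v; set w := hform H (labelled g) v.
set u := (v *m H *m adjmx v) 0 0; case: u => c d; case: w => x y; case: z {vz} => a b /= y0.
move=> /eqP; rewrite eq_complex ltcE /= => /andP[_ /eqP e] /andP[/eqP d0 c0].
have {e}/eqP : b * c = 0 by move: e; rewrite y0 d0; lra.
by rewrite mulf_eq0 (gt_eqF c0) orbF => /eqP.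
Qed.

(** Taking real parts loses nothing: the coefficients are real by [label_polyP]. *)
Definition label_poly g : {poly R} := map_poly (@complex.Re R) (char_poly (labelled g)).

Lemma label_polyP g :
  real_split N (label_poly g) /\ toC (label_poly g) = char_poly (labelled g).
Proof.
have [|||f fs fE] := @real_roots_split R N (char_poly (labelled g)).
- exact: char_poly_monic.
- exact: size_char_poly.
- exact: eigenvalue_labelled_real.
suff -> : label_poly g = f by [].
by apply/polyP => k; rewrite /label_poly fE coef_map_id0 // coef_map.
Qed.

Lemma horner_lazy_avg L g z :
  (toC (lazy_avg L label_poly g)).[z] = avg_det Rp L z (slots g).
Proof.
elim: L g => [|s L IH] g /=.
  by rewrite (label_polyP g).2 horner_char_poly sum_slots.
by rewrite -slots_step -!IH map_polyZ hornerZ rmorphD hornerD.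
Qed.

Lemma monic_deg_lazy_avg L g : monic_deg N (lazy_avg L label_poly g).
Proof.
elim: L g => [|s L IH] g /=; first exact: real_split_monic (label_polyP g).1.
have := monic_deg_mix 2^-1 (IH g) (IH (act_step s g)).
have -> : 1 - 2^-1 = 2^-1 :> R by lra.
by rewrite scalerDr.
Qed.

Lemma real_split_mix s L g t : steps_in S (s :: L) -> 0 <= t <= 1 ->
  real_split N ((1 - t) *: lazy_avg L label_poly g
                + t *: lazy_avg L label_poly (act_step s g)).
Proof.
case: s => e r /andP[rS LS] t01; apply: stable_real_split => [|z z0].
  by apply: monic_deg_mix; apply: monic_deg_lazy_avg.
rewrite rmorphD /= !map_polyZ hornerD !hornerZ !horner_lazy_avg slots_step.
by apply: (stable_mix (steps_stable LS) t01 (reflS e rS) z0) => e'; apply: im_pos_slots.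
Qed.

(** At each letter the current average is half the sum of the two branches; [rounding] keeps one
    that is positive on the half-line, until the word is used up and a single labeling remains. *)
Lemma rounding_walk L y g : steps_in S L ->
  (forall x, y <= x -> 0 < (lazy_avg L label_poly g).[x]) ->
  exists g', forall x, y <= x -> 0 < (label_poly g').[x].
Proof.
elim: L g => [|s L IH] g; first by exists g.
move=> sL /= pos; have LS : steps_in S L by case/andP: sL.
have [] := @rounding R N (lazy_avg L label_poly g)
    (lazy_avg L label_poly (act_step s g)) y; last 2 first.
- exact: IH.
- exact: IH.
- by move=> t; apply: real_split_mix.
- by move=> x /pos; rewrite hornerZ pmulr_rgt0 // invr_gt0 ltr0n.
Qed.

Theorem exists_label y c : 0 < c ->
  (forall x, y <= x ->
    c *+ #|{ffun E -> gT}| <= \sum_(g : {ffun E -> gT}) (label_poly g).[x]) ->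
  exists g, forall x, y <= x -> 0 < (label_poly g).[x].
Proof.
move=> c0 avg.
have [b bP] : exists b : {ffun E -> gT} -> R, forall g, 0 <= b g /\
    forall x, y <= x -> - b g <= (label_poly g).[x].
  have h g := boolp.cid2 (real_split_lower_bound y (label_polyP g).1).
  by exists (fun g => s2val (h g)) => g; case: (h g).
have [L LS Lpos] := lazy_avg_pos E genS (\sum_g b g) c0.
(* One word [L] serves all [x >= y]: the bounds given to [lazy_avg_pos], namely [c] and the sum of
   the [b g], are independent of [x]. *)
apply: (@rounding_walk L y [ffun => 1%g] LS) => x yx.
have -> : forall g, (lazy_avg L label_poly g).[x] =
    lazy_avg L (fun g => (label_poly g).[x] : R^o) g.
  by elim: L {LS Lpos} => //= s L IH g; rewrite hornerZ hornerD !IH.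
apply: Lpos => [g|]; last exact: avg.
apply: le_trans ((bP g).2 x yx); rewrite lerN2 (bigD1 g) //= lerDl.
by apply: sumr_ge0 => g' _; case: (bP g').
Qed.

End RoundingWalk.

(** * Averages of determinants and orthogonality of minors *)

Section DetExpansion.
Variable F : numFieldType.

Lemma det1_add_mulmxC n m (c : 'M[F]_(n, m)) (r : 'M_(m, n)) :
  \det (1%:M + c *m r) = \det (1%:M + r *m c).
Proof.
rewrite det_add_mulmx.
have -> : block_mx 1%:M (- c) r 1%:M =
    block_mx 1%:M 0 r 1%:M *m block_mx 1%:M (- c) 0 (1%:M + r *m c).
  by rewrite mulmx_block !mul1mx !mul0mx !mulmx1 !addr0 mulmxN [- _ + _]addrC addrK.
by rewrite det_mulmx det_ublock det_lblock !det1 !mul1r.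
Qed.

Section Rows.
Variables (N : nat) (T : {set 'I_N}).
Local Notation m := #|T|.
Local Notation tau := (@enum_val 'I_N (mem T)).

(** With these, [row_off *m A + row_sel *m Z] is [A] with its rows in [T] replaced by the rows of
    [Z], so row replacement becomes matrix algebra. *)
Definition row_sel : 'M[F]_(N, m) := \matrix_(i, k) (i == tau k)%:R.
Definition row_off : 'M[F]_N := \matrix_(i, j) ((i == j) && (i \notin T))%:R.

Lemma row_offE p (A : 'M_(N, p)) i j : (row_off *m A) i j = (i \notin T)%:R * A i j.
Proof.
rewrite mxE (bigD1 i) //= mxE eqxx /= big1 ?addr0 // => k ki.
by rewrite mxE eq_sym (negbTE ki) mul0r.
Qed.

Lemma row_selE p (Z : 'M_(m, p)) k j : (row_sel *m Z) (tau k) j = Z k j.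
Proof.
rewrite mxE (bigD1 k) //= mxE eqxx mul1r big1 ?addr0 // => l lk.
by rewrite mxE (inj_eq enum_val_inj) eq_sym (negbTE lk) mul0r.
Qed.

Lemma row_sel_off p (Z : 'M_(m, p)) i j : i \notin T -> (row_sel *m Z) i j = 0.
Proof.
move=> iT; rewrite mxE big1 // => k _; rewrite mxE; case: eqP => [E|]; last by rewrite mul0r.
by move: iT; rewrite E enum_valP.
Qed.

Lemma row_selTE p (A : 'M_(N, p)) : row_sel^T *m A = rowsub tau A.
Proof.
apply/matrixP => k j; rewrite !mxE (bigD1 (tau k)) //= !mxE eqxx mul1r big1 ?addr0 //.
by move=> i ik; rewrite !mxE (negbTE ik) mul0r.
Qed.

Lemma prod_rows (A : 'M_N) (Z : 'M_(m, N)) (s : 'I_N -> 'I_N) :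
  \prod_i (row_off *m A + row_sel *m Z) i (s i) =
  (\prod_(i | i \notin T) A i (s i)) * \prod_k Z k (s (tau k)).
Proof.
rewrite (bigID (mem T)) /= mulrC; congr (_ * _).
  by apply: eq_bigr => i iT; rewrite mxE row_offE row_sel_off // addr0 iT mul1r.
rewrite big_enum_val /=; apply: eq_bigr => k _.
by rewrite mxE row_offE row_selE enum_valP mul0r add0r.
Qed.

Lemma det_row_functions (A : 'M_N) L (Y : 'M_(m, L)) (b : 'M_(L, N)) :
  \det (row_off *m A + row_sel *m (Y *m b)) =
  \sum_(f : {ffun 'I_m -> 'I_L})
     (\prod_k Y k (f k)) * \det (row_off *m A + row_sel *m rowsub f b).
Proof.
under [RHS]eq_bigr do rewrite /determinant mulr_sumr.
rewrite exchange_big /=; apply: eq_bigr => s _.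
rewrite prod_rows.
have -> : \prod_k (Y *m b) k (s (tau k)) = \prod_k \sum_l Y k l * b l (s (tau k)).
  by apply: eq_bigr => k _; rewrite mxE.
rewrite bigA_distr_bigA !mulr_sumr; apply: eq_bigr => f _.
rewrite prod_rows big_split /= [RHS]mulrCA; congr (_ * _).
rewrite mulrCA; congr (_ * (_ * _)); apply: eq_bigr => k _.
by rewrite mxE.
Qed.

Lemma det_row_perm (A : 'M_N) (Z : 'M_(m, N)) (t : 'S_m) :
  \det (row_off *m A + row_sel *m (perm_mx t *m Z)) =
  (-1) ^+ t * \det (row_off *m A + row_sel *m Z).
Proof.
have selT_sel : row_sel^T *m row_sel = 1%:M.
  by rewrite row_selTE; apply/matrixP => k l; rewrite !mxE (inj_eq enum_val_inj).
have selT_off : row_sel^T *m (row_off *m A) = 0.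
  by rewrite row_selTE; apply/matrixP => k j; rewrite mxE row_offE enum_valP mul0r mxE.
have -> : row_off *m A + row_sel *m (perm_mx t *m Z) =
    (1%:M + row_sel *m ((perm_mx t - 1%:M) *m row_sel^T)) *m (row_off *m A + row_sel *m Z).
  rewrite [RHS]mulmxDl mul1mx -!mulmxA (mulmxDr row_sel^T) selT_off add0r.
  rewrite (mulmxA row_sel^T) selT_sel mul1mx mulmxBl mul1mx mulmxBr.
  by rewrite -addrA; congr (_ + _); rewrite addrC subrK.
rewrite det_mulmx det1_add_mulmxC -mulmxA selT_sel mulmx1 addrC subrK det_perm.
by [].
Qed.

(** Permuting the replaced rows changes only the sign. Summing [det_row_functions] over all
    permutations [t] therefore assembles the products of entries of [Y] into minors, at the cost of
    the factor [m!]. *)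
Lemma det_row_minors (A : 'M_N) L (Y : 'M_(m, L)) (b : 'M_(L, N)) :
  (m`!)%:R * \det (row_off *m A + row_sel *m (Y *m b)) =
  \sum_(f : {ffun 'I_m -> 'I_L})
     \det (colsub f Y) * \det (row_off *m A + row_sel *m rowsub f b).
Proof.
have step (t : 'S_m) : \det (row_off *m A + row_sel *m (Y *m b)) =
   \sum_(f : {ffun 'I_m -> 'I_L}) (-1) ^+ t * (\prod_k Y k (f (t k)))
      * \det (row_off *m A + row_sel *m rowsub f b).
  rewrite det_row_functions (reindex (fun f : {ffun 'I_m -> 'I_L} => [ffun k => f (t k)])) /=.
    apply: eq_bigr => f _.
    have -> : rowsub [ffun k => f (t k)] b = perm_mx t *m rowsub f b.
      by rewrite -row_permE; apply/matrixP => k j; rewrite !mxE ffunE.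
    rewrite det_row_perm; under eq_bigr do rewrite ffunE.
    by rewrite mulrCA mulrA.
  exists (fun f : {ffun 'I_m -> 'I_L} => [ffun k => f ((t^-1)%g k)]) => f _;
    by apply/ffunP => k; rewrite !ffunE ?permK ?permKV.
have -> x : (m`!)%:R * x = \sum_(t : 'S_m) x :> F.
  by rewrite sumr_const card_Sn mulr_natl.
rewrite (eq_bigr _ (fun t _ => step t)).
rewrite exchange_big /=; apply: eq_bigr => f _.
rewrite -mulr_suml; congr (_ * _); apply: eq_bigr => t _; congr (_ * _).
by apply: eq_bigr => k _; rewrite mxE.
Qed.

End Rows.

Lemma det_add_rows N (A B : 'M[F]_N) :
  \det (A + B) =
  \sum_(T : {set 'I_N}) \det (row_off T *m A + row_sel T *m rowsub (@enum_val _ (mem T)) B).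
Proof.
rewrite /determinant exchange_big /=; apply: eq_bigr => s _.
under eq_bigr do rewrite mxE addrC.
rewrite bigA_distr -mulr_sumr; congr (_ * _); apply: eq_bigr => T _.
rewrite prod_rows (bigID (mem T)) /= mulrC; congr (_ * _).
  by apply: eq_bigr => i /negbTE ->.
rewrite big_enum_val /=; apply: eq_bigr => k _.
by rewrite enum_valP mxE.
Qed.

(** The point is the separation of variables: [X] is confined to the first determinant, [A] to the
    second. *)
Lemma det_add_mulmx_expansion N d (A : 'M[F]_N) (P : 'M_(N, d)) (X : 'M_d) (Q : 'M_(d, N)) :
  \det (A + P *m X *m Q) =
  \sum_(T : {set 'I_N}) (#|T| `!)%:R^-1 *
    \sum_(f : {ffun 'I_#|T| -> 'I_d})
      \det (rowsub (@enum_val _ (mem T)) P *m X *m colsub f 1%:M) *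
      \det (row_off T *m A + row_sel T *m rowsub f Q).
Proof.
rewrite det_add_rows; apply: eq_bigr => T _.
have -> : rowsub (@enum_val _ (mem T)) (P *m X *m Q) =
    rowsub (@enum_val _ (mem T)) P *m X *m Q.
  by rewrite -!mul_rowsub_mx.
have n0 : (#|T| `!)%:R != 0 :> F by rewrite pnatr_eq0 -lt0n fact_gt0.
apply: (mulfI n0); rewrite mulVKf // det_row_minors; apply: eq_bigr => f _.
by rewrite mulmx_colsub mulmx1.
Qed.

Lemma det_mulmx3_minors m d (p : 'M[F]_(m, d)) (X : 'M_d) (q : 'M_(d, m)) :
  \det (p *m X *m q) =
  \sum_(I : msubset d m) \sum_(J : msubset d m)
    \det (colsub (msubset_nth I) p) * \det (rowsub (msubset_nth J) q)
      * \det (mxsub (msubset_nth I) (msubset_nth J) X).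
Proof.
rewrite CauchyBinet exchange_big /=; apply: eq_bigr => J _.
rewrite -mulmx_colsub CauchyBinet mulr_suml; apply: eq_bigr => I _.
have -> : rowsub (msubset_nth I) (colsub (msubset_nth J) X) =
   mxsub (msubset_nth I) (msubset_nth J) X by apply/matrixP => i j; rewrite !mxE.
ring.
Qed.

End DetExpansion.

(** * Averages of determinants determined by orthogonality of minors *)

Section SameAverage.
Variables (F : numFieldType) (d : nat).

(** Schur orthogonality for the matrix coefficients of all exterior powers at once, with [Y w] in
    the role of the inverse of [X w]. Subsets are compared through [val] because [m] and [m'] may
    differ. *)
Definition orthogonal_minors (Om : finType) (X Y : Om -> 'M[F]_d) :=
  forall m m' (I J : msubset d m) (K L : msubset d m'),
    #|Om|%:R^-1 * \sum_w \det (mxsub (msubset_nth I) (msubset_nth J) (X w))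
       * \det (mxsub (msubset_nth K) (msubset_nth L) (Y w))
    = if (val I == val L) && (val J == val K) then (ext_dim d m)%:R^-1 else 0.

Variables (Om1 Om2 : finType) (X1 Y1 : Om1 -> 'M[F]_d) (X2 Y2 : Om2 -> 'M[F]_d).
Hypotheses (orth1 : orthogonal_minors X1 Y1) (orth2 : orthogonal_minors X2 Y2).

Definition same_avg (g : 'M[F]_d -> 'M[F]_d -> F) :=
  #|Om1|%:R^-1 * \sum_w g (X1 w) (Y1 w) = #|Om2|%:R^-1 * \sum_w g (X2 w) (Y2 w).

Lemma same_avg_ext g h : (forall X Y, g X Y = h X Y) -> same_avg h -> same_avg g.
Proof.
move=> gh hs; rewrite /same_avg (eq_bigr (fun w => h (X1 w) (Y1 w))) //.
by rewrite [in RHS](eq_bigr (fun w => h (X2 w) (Y2 w))).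
Qed.

Lemma same_avg_scale c g : same_avg g -> same_avg (fun X Y => c * g X Y).
Proof. by rewrite /same_avg -!mulr_sumr ![_^-1 * (c * _)]mulrCA => ->. Qed.

Lemma same_avg_sum (I : finType) (g : I -> 'M[F]_d -> 'M[F]_d -> F) :
  (forall i, same_avg (g i)) -> same_avg (fun X Y => \sum_i g i X Y).
Proof.
move=> h; rewrite /same_avg exchange_big [in RHS]exchange_big /= !mulr_sumr.
by apply: eq_bigr => i _; apply: h.
Qed.

Lemma same_avg_minors m m' (p : 'M_(m, d)) q (p' : 'M_(m', d)) q' :
  same_avg (fun X Y => \det (p *m X *m q) * \det (p' *m Y *m q')).
Proof.
pose c (I J : msubset d m) (K L : msubset d m') :=
  \det (colsub (msubset_nth I) p) * \det (rowsub (msubset_nth J) q) *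
  (\det (colsub (msubset_nth K) p') * \det (rowsub (msubset_nth L) q')).
pose mi (I J : msubset d m) (K L : msubset d m') (X Y : 'M[F]_d) :=
  \det (mxsub (msubset_nth I) (msubset_nth J) X) *
  \det (mxsub (msubset_nth K) (msubset_nth L) Y).
apply: (@same_avg_ext _ (fun X Y => \sum_I \sum_J \sum_K \sum_L c I J K L * mi I J K L X Y)).
  move=> X Y; rewrite !det_mulmx3_minors mulr_suml; apply: eq_bigr => I _.
  rewrite mulr_suml; apply: eq_bigr => J _; rewrite mulr_sumr; apply: eq_bigr => K _.
  rewrite mulr_sumr; apply: eq_bigr => L _; rewrite /c /mi; ring.
do 4 apply: same_avg_sum => ?.
apply: same_avg_scale; rewrite /same_avg /mi orth1 orth2.
by [].
Qed.

Lemma same_avg_minor_det m N (p : 'M_(m, d)) q (A : 'M_N) P Q :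
  same_avg (fun X Y => \det (p *m X *m q) * \det (A + P *m Y *m Q)).
Proof.
apply: same_avg_ext => [X Y|]; first by rewrite det_add_mulmx_expansion mulr_sumr.
apply: same_avg_sum => T.
apply: same_avg_ext => [X Y|]; first by rewrite mulrCA mulr_sumr.
apply: same_avg_scale; apply: same_avg_sum => f.
apply: same_avg_ext => [X Y|]; first by rewrite mulrA mulrC.
apply: same_avg_scale; exact: same_avg_minors.
Qed.

(** Expanding in [X] leaves a determinant in [X] times one that is again of the form
    [\det (A + P *m Y *m Q)]. Expanding the latter in [Y] leaves products of minors, whose averages
    are prescribed by orthogonality. *)
Lemma same_avg_det N (A : 'M_N) P Q P' Q' :
  same_avg (fun X Y => \det (A + (P *m X *m Q + P' *m Y *m Q'))).
Proof.
apply: same_avg_ext => [X Y|].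
  by rewrite addrCA addrC det_add_mulmx_expansion.
apply: same_avg_sum => T; apply: same_avg_scale; apply: same_avg_sum => f.
apply: same_avg_ext => [X Y|].
  by rewrite mulmxDr -addrA (addrC (_ *m (_ *m Q'))) addrA !mulmxA.
exact: same_avg_minor_det.
Qed.

End SameAverage.

(** * Schur orthogonality for signed permutations and for the representation *)

Section Orthogonality.
Variables (F : numFieldType) (d : nat).

Lemma msubset_le m (I : msubset d m) : (m <= d)%N.
Proof. by rewrite -(eqP (valP I)) -[X in (_ <= X)%N](card_ord d) max_card. Qed.

Lemma ext_mxE m (A : 'M[F]_d) (I J : msubset d m) :
  ext_mx m A (enum_rank I) (enum_rank J) = \det (mxsub (msubset_nth I) (msubset_nth J) A).
Proof. by rewrite mxE !enum_rankK. Qed.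

Lemma mulmx_delta_mx m1 m2 n1 n2 (A : 'M[F]_(m1, m2)) (B : 'M_(n1, n2)) j k i l :
  (A *m delta_mx j k *m B) i l = A i j * B k l.
Proof.
rewrite mxE (bigD1 k) //= mxE (bigD1 j) //= mxE !eqxx mulr1 !big1 ?addr0 //.
- by move=> a ak; rewrite mxE big1 ?mul0r // => b _; rewrite mxE (negbTE ak) andbF mulr0.
- by move=> b bj; rewrite mxE (negbTE bj) mulr0.
Qed.

Section Twirl.
Variables (Om : finType) (X Y : Om -> 'M[F]_d).

Definition twirl m m' (Z : 'M_(ext_dim d m, ext_dim d m')) :=
  \sum_w ext_mx m (X w) *m Z *m ext_mx m' (Y w).

Lemma twirl_intertwines m m' (Z : 'M_(ext_dim d m, ext_dim d m')) U (phi : Om -> Om) :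
  injective phi -> (forall w, U *m X w = X (phi w)) ->
  (forall w, Y w = Y (phi w) *m U) ->
  ext_mx m U *m twirl Z = twirl Z *m ext_mx m' U.
Proof.
move=> phi_inj hX hY; rewrite /twirl mulmx_sumr mulmx_suml [RHS](reindex_inj phi_inj) /=.
apply: eq_bigr => w _; rewrite !mulmxA -ext_mxM hX -[RHS]mulmxA -ext_mxM.
by rewrite -hY.
Qed.

(** The average of a product of two minors is an entry of the twirl of a matrix unit. When the twirl
    is a scalar, its trace determines it, since [Y w *m X w = 1%:M] gives every summand the trace of
    [Z]. *)
Lemma twirl_orthogonal : (0 < #|Om|)%N -> (forall w, Y w *m X w = 1%:M) ->
  (forall m m' (Z : 'M_(ext_dim d m, ext_dim d m')),
     (m <= d)%N -> (m' <= d)%N -> m != m' -> twirl Z = 0) ->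
  (forall m (Z : 'M_(ext_dim d m)), (m <= d)%N -> exists c, twirl Z = c%:M) ->
  orthogonal_minors X Y.
Proof.
move=> Om0 YX off diag m m' I J K L.
have md := msubset_le I; have md' := msubset_le K.
(* [Z] stays a variable with an equation, so that eliminating [m = m'] can rewrite its type. *)
have [Z ZE] : exists Z : 'M[F]_(ext_dim d m, ext_dim d m'),
  Z = delta_mx (enum_rank J) (enum_rank K) by eexists.
have -> : \sum_w \det (mxsub (msubset_nth I) (msubset_nth J) (X w)) *
       \det (mxsub (msubset_nth K) (msubset_nth L) (Y w)) =
    twirl Z (enum_rank I) (enum_rank L).
  rewrite summxE; apply: eq_bigr => w _.
  by rewrite ZE mulmx_delta_mx !ext_mxE.
have [mm|mm] := eqVneq m m'; last first.
  rewrite off // mxE mulr0; case: eqP => //= IL.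
  case/eqP: mm; have /eqP <- := valP I; have /eqP <- := valP L.
  exact: (congr1 (fun A : {set 'I_d} => #|A|) IL).
case: m' / mm md' K L Z ZE => _ K L Z ZE.
have [c Tc] := diag m Z md; rewrite Tc mxE (inj_eq enum_rank_inj) !val_eqE.
have n0 : (ext_dim d m)%:R != 0 :> F.
  by rewrite pnatr_eq0 -lt0n; apply/card_gt0P; exists I.
have Om0' : #|Om|%:R != 0 :> F by rewrite pnatr_eq0 -lt0n.
have : \tr (twirl Z) = #|Om|%:R * (J == K)%:R.
  rewrite /twirl linear_sum /= (eq_bigr (fun=> \tr Z)).
    rewrite sumr_const -[LHS]mulr_natl; congr (_ * _).
    rewrite ZE /mxtrace (bigD1 (enum_rank J)) //= mxE eqxx (inj_eq enum_rank_inj).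
    by rewrite big1 ?addr0 // => i ij; rewrite mxE (negbTE ij).
  by move=> w _; rewrite -mulmxA mxtrace_mulC -mulmxA -ext_mxM YX ext_mx1 mulmx1.
rewrite Tc mxtrace_scalar -[c *+ _]mulr_natr => cE.
have -> : c = #|Om|%:R * (J == K)%:R / (ext_dim d m)%:R by rewrite -cE mulfK.
case: (I == L); case: (J == K); rewrite /= ?mulr1n ?mulr0n ?mulr0 ?mul0r ?mulr0 //.
by rewrite mulr1 mulKf.
Qed.

End Twirl.

Definition signed_perm := ('S_d * {ffun 'I_d -> bool})%type.
Definition sign_mx (e : {ffun 'I_d -> bool}) : 'M[F]_d :=
  diag_mx (\row_k (-1) ^+ e k).
Definition sp_mx (w : signed_perm) : 'M[F]_d := sign_mx w.2 *m perm_mx w.1.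
Definition sp_inv (w : signed_perm) : 'M[F]_d := perm_mx (w.1^-1)%g *m sign_mx w.2.

Lemma sign_mxM e e' :
  sign_mx e *m sign_mx e' = sign_mx [ffun k => e k (+) e' k].
Proof.
rewrite mul_diag_mx; apply/matrixP => i j; rewrite !mxE ffunE.
by case: eqP => [->|]; rewrite ?mulr1n ?mulr0n ?mulr0 // signr_addb.
Qed.

Lemma sign_mxK e : sign_mx e *m sign_mx e = 1%:M.
Proof.
rewrite sign_mxM; apply/matrixP => i j; rewrite !mxE ffunE addbb expr0.
by case: eqP.
Qed.

Lemma sign_mxC e e' : sign_mx e *m sign_mx e' = sign_mx e' *m sign_mx e.
Proof. by rewrite !sign_mxM; congr sign_mx; apply/ffunP => k; rewrite !ffunE addbC. Qed.

Lemma sp_invK w : sp_inv w *m sp_mx w = 1%:M.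
Proof.
by rewrite /sp_inv /sp_mx mulmxA -(mulmxA (perm_mx _)) sign_mxK mulmx1 -perm_mxM mulVg perm_mx1.
Qed.

Lemma perm_sign_mx (t : 'S_d) e :
  perm_mx t *m sign_mx e = sign_mx [ffun k => e (t k)] *m perm_mx t.
Proof.
rewrite mul_mx_diag mul_diag_mx; apply/matrixP => i j; rewrite !mxE ffunE mulrC.
by case: eqP => [->|]; rewrite ?mulr0.
Qed.

Lemma ext_mx_diag m (a : 'rV[F]_d) i j :
  ext_mx m (diag_mx a) i j =
  (i == j)%:R * \prod_k a 0 (msubset_nth (enum_val i) k).
Proof.
have := ext_mx1 F d m => /matrixP /(_ i j); rewrite !mxE => E1.
have -> : mxsub (msubset_nth (enum_val i)) (msubset_nth (enum_val j)) (diag_mx a) =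
    diag_mx (\row_k a 0 (msubset_nth (enum_val i) k)) *m
    mxsub (msubset_nth (enum_val i)) (msubset_nth (enum_val j)) 1%:M.
  by rewrite mul_diag_mx; apply/matrixP => k l; rewrite !mxE mulr_natr.
rewrite det_mulmx E1 det_diag mulrC; congr (_ * _).
by apply: eq_bigr => k _; rewrite mxE.
Qed.

Lemma prod_sign_msubset m (I : msubset d m) (x : 'I_d) :
  \prod_k (-1) ^+ (msubset_nth I k == x) = (-1) ^+ (x \in val I) :> F.
Proof.
have [xI|xI] := boolP (x \in val I).
  have [k0 <-] := msubset_nth_surj xI.
  rewrite (bigD1 k0) //= eqxx big1 ?mulr1 // => k kk0.
  by rewrite (inj_eq (@msubset_nth_inj _ _ I)) (negbTE kk0).
rewrite big1 // => k _; case: eqP => // E; move: xI.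
by rewrite -E mem_msubset_nth.
Qed.

(** List ['I_d] twice, once with the values of [f] in front and once with those of [g], and match
    equal positions. *)
Lemma perm_extend m (f g : 'I_m -> 'I_d) : injective f -> injective g ->
  exists t : 'S_d, forall k, t (f k) = g k.
Proof.
move=> fi gi.
pose ext (h : 'I_m -> 'I_d) := codom h ++ [seq x <- enum 'I_d | x \notin codom h].
have uext h : injective h -> uniq (ext h).
  move=> hi; rewrite cat_uniq filter_uniq ?enum_uniq // andbT; apply/andP; split.
    by rewrite map_inj_uniq ?enum_uniq.
  by apply/hasPn => x; rewrite mem_filter => /andP[].
have memext h x : x \in ext h by rewrite mem_cat mem_filter mem_enum andbT orbN.
have sext h : injective h -> size (ext h) = d.
  move=> hi; rewrite -[RHS](card_ord d) cardE; apply/perm_size/uniq_perm.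
  - exact: uext.
  - exact: enum_uniq.
  - by move=> x; rewrite memext mem_enum.
pose t x := nth x (ext g) (index x (ext f)).
have ti : injective t.
  have idx x : (index x (ext f) < size (ext g))%N.
    have <- : size (ext f) = size (ext g) by rewrite !sext.
    by rewrite index_mem.
  move=> x y; rewrite /t (set_nth_default x y) ?idx // => /eqP.
  rewrite nth_uniq ?idx ?uext // => /eqP; exact: index_inj.
exists (perm ti) => k; rewrite permE /t /ext index_cat codom_f nth_cat.
have idx : index (f k) (codom f) = k.
  by rewrite /codom /image_mem index_map // index_enum_ord.
rewrite idx size_codom card_ord ltn_ord.
by rewrite /codom /image_mem (nth_map k) ?size_enum_ord // nth_ord_enum.
Qed.

(** Entries of a twirl between distinct subsets vanish: flipping the sign at an element of only one
    of them negates the entry. A permutation carrying one subset to another equates the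
    corresponding diagonal entries. So the twirl is scalar for [m = m'] and zero otherwise. *)
Lemma signed_perm_orthogonal : orthogonal_minors sp_mx sp_inv.
Proof.
have sign_inv m m' (Z : 'M_(ext_dim d m, ext_dim d m')) e :
    ext_mx m (sign_mx e) *m twirl sp_mx sp_inv Z = twirl sp_mx sp_inv Z *m ext_mx m' (sign_mx e).
  apply: (@twirl_intertwines _ _ _ _ _ Z _
    (fun w : signed_perm => (w.1, [ffun k => e k (+) w.2 k]))).
  - move=> [s u] [s' u'] [-> /ffunP h]; congr (_, _); apply/ffunP => k.
    by move: (h k); rewrite !ffunE => /addbI.
  - by move=> w; rewrite /sp_mx mulmxA sign_mxM.
  - move=> w; rewrite /sp_inv -sign_mxM /= -!mulmxA; congr (_ *m _).
    by rewrite (sign_mxC w.2) mulmxA sign_mxK mul1mx.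
have perm_inv m m' (Z : 'M_(ext_dim d m, ext_dim d m')) (t : 'S_d) :
    ext_mx m (perm_mx t) *m twirl sp_mx sp_inv Z = twirl sp_mx sp_inv Z *m ext_mx m' (perm_mx t).
  apply: (@twirl_intertwines _ _ _ _ _ Z _
    (fun w : signed_perm => ((t * w.1)%g, [ffun k => w.2 (t k)]))).
  - move=> [s u] [s' u'] [/mulgI -> /ffunP h]; congr (_, _); apply/ffunP => k.
    by move: (h ((t^-1)%g k)); rewrite !ffunE permKV.
  - by move=> w; rewrite /sp_mx mulmxA perm_sign_mx -mulmxA -perm_mxM.
  - move=> w; rewrite /sp_inv /= invMg perm_mxM -!mulmxA -perm_sign_mx.
    by rewrite (mulmxA (perm_mx t^-1)) -perm_mxM mulVg perm_mx1 mul1mx.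
have off m m' (Z : 'M_(ext_dim d m, ext_dim d m')) i l :
    val (enum_val i) != val (enum_val l) -> twirl sp_mx sp_inv Z i l = 0.
  move=> il; have [x xil] : exists x, (x \in val (enum_val i)) != (x \in val (enum_val l)).
    apply/existsP; apply: contraNT il => /existsPn h; apply/eqP/setP => x.
    by apply/eqP; have := h x; rewrite negbK.
  have := sign_inv _ _ Z [ffun k => k == x] => /matrixP /(_ i l).
  rewrite [in LHS]mxE (bigD1 i) //= ext_mx_diag eqxx mul1r [X in _ + X]big1 ?addr0; last first.
    by move=> j ji; rewrite ext_mx_diag eq_sym (negbTE ji) !mul0r.
  rewrite [in RHS]mxE (bigD1 l) //= ext_mx_diag eqxx mul1r [X in _ = _ + X]big1 ?addr0; last first.
    by move=> j jl; rewrite ext_mx_diag (negbTE jl) mul0r mulr0.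
  under eq_bigr do rewrite mxE ffunE; rewrite prod_sign_msubset.
  under eq_bigr do rewrite mxE ffunE; rewrite prod_sign_msubset.
  move: xil; case: (x \in val (enum_val i)); case: (x \in val (enum_val l)) => //= _;
    rewrite ?expr0 ?expr1 ?mulr1 ?mul1r ?mulrN1 ?mulN1r => h.
    by apply/eqP; rewrite -eqNr h.
  by apply/eqP; rewrite -eqNr -h.
apply: twirl_orthogonal.
- by apply/card_gt0P; exists (1%g, [ffun => false]).
- exact: sp_invK.
- move=> m m' Z _ _ mm; apply/matrixP => i l; rewrite mxE off //.
  apply: contraNneq mm => E.
  by rewrite -(eqP (valP (enum_val i))) -(eqP (valP (enum_val l))) E.
- move=> m Z _.
  case: (pickP [pred i : 'I_(ext_dim d m) | true]) => [i0 _|no]; last first.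
    by exists 0; apply/matrixP => i; have := no i.
  exists (twirl sp_mx sp_inv Z i0 i0); apply/matrixP => i l; rewrite mxE.
  have [<-|il] := eqVneq i l; last first.
    by rewrite mulr0n off //; apply: contraNneq il => /val_inj/enum_val_inj ->.
  rewrite mulr1n.
  have [t tP] := perm_extend (@msubset_nth_inj _ _ (enum_val i)) (@msubset_nth_inj _ _ (enum_val i0)).
  have Pt1 : ext_mx m (perm_mx t : 'M[F]_d) i i0 = 1.
    rewrite mxE -[RHS](det1 F m); congr (\det _); apply/matrixP => k k'.
    by rewrite !mxE tP (inj_eq (@msubset_nth_inj _ _ _)).
  have := perm_inv _ _ Z t => /matrixP /(_ i i0).
  rewrite [in LHS]mxE (bigD1 i0) //= Pt1 mul1r big1 ?addr0; last first.
    move=> j ji; rewrite off ?mulr0 //; apply: contraNneq ji => /val_inj/enum_val_inj ->.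
    by [].
  rewrite [in RHS]mxE (bigD1 i) //= Pt1 mulr1 big1 ?addr0 //.
  move=> j ji; rewrite off ?mul0r //; rewrite eq_sym in ji.
  by apply: contraNneq ji => /val_inj/enum_val_inj ->.
Qed.

End Orthogonality.

Section RepresentationOrthogonality.
Variables (F : numClosedFieldType) (gT : finGroupType) (Gam : {group gT}) (d : nat).
Variable pi : mx_representation F Gam d.
Hypothesis pi_ext : ext_powers_irr_noniso pi.

Lemma mx_irreducible_scalar n (rG : mx_representation F Gam n) (f : 'M_n) :
  mx_irreducible rG -> {in Gam, forall x, rG x *m f = f *m rG x} -> exists c, f = c%:M.
Proof.
move=> irr cf.
have [n0|n0] := posnP n.
  by exists 0; apply/matrixP => -[i hi]; exfalso; rewrite n0 in hi.
have [c /eqP rc] : exists c, root (char_poly f) c.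
  by apply/closed_rootP; rewrite size_char_poly; case: (n) n0.
exists c; apply/eqP; rewrite -subr_eq0; apply: contraT => nz.
have : f - c%:M \in unitmx.
  apply: (mx_Schur irr) nz; apply/centgmxP => x xG.
  by rewrite mulmxBl mulmxBr cf // scalar_mxC.
have : eigenvalue f c by rewrite eigenvalue_root_char; apply/eqP.
by rewrite /eigenvalue /eigenspace kermx_eq0 row_free_unit => /negbTE ->.
Qed.

Lemma mx_irreducible_intertwiner0 n n' (rG : mx_representation F Gam n)
    (rG' : mx_representation F Gam n') (f : 'M_(n, n')) :
  mx_irreducible rG -> mx_irreducible rG' -> ~ mx_rsim rG rG' ->
  {in Gam, forall x, rG x *m f = f *m rG' x} -> f = 0.
Proof.
move=> /mx_irrP[_ irr] /mx_irrP[_ irr'] nsim cf.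
case: (eqVneq f 0) => // nz; case: nsim.
have kf : kermx f = 0.
  apply: contraNeq nz => /(irr _ _) full.
  have ku : kermx f \in unitmx.
    rewrite -row_full_unit full //; apply/mxmoduleP => x xG; apply/sub_kermxP.
    by rewrite -mulmxA cf // mulmxA mulmx_ker mul0mx.
  by rewrite -[f]mul1mx -(mulVmx ku) -mulmxA mulmx_ker mulmx0.
have free : row_free f by rewrite -kermx_eq0 kf.
have full : row_full f.
  have : row_full <<f>>%MS.
    apply: irr'; last by rewrite -mxrank_eq0 genmxE mxrank_eq0.
    rewrite (eqmx_module _ (genmxE f)); apply/mxmoduleP => x xG.
    by rewrite -cf // submxMl.
  by rewrite /row_full genmxE.
apply: (@MxReprSim _ _ _ _ _ _ _ f) => //.
by rewrite -(eqP free); apply/eqP.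
Qed.

Lemma rep_orthogonal :
  orthogonal_minors (fun g : subg_of Gam => pi (sgval g)) (fun g => pi (sgval g^-1%g)).
Proof.
pose X (g : subg_of Gam) := pi (sgval g); pose Y (g : subg_of Gam) := pi (sgval g^-1%g).
have tw m m' (Z : 'M_(ext_dim d m, ext_dim d m')) x : x \in Gam ->
    ext_mx m (pi x) *m twirl X Y Z = twirl X Y Z *m ext_mx m' (pi x).
  move=> xG; apply: (@twirl_intertwines _ _ _ _ _ _ _ Z _ (fun g => (subg Gam x * g)%g)).
  - exact: mulgI.
  - by move=> g; rewrite /X -repr_mxM ?subgP //= subgK.
  - by move=> g; rewrite /Y -repr_mxM ?subgP //= invMg /= subgK // mulgKV.
apply: twirl_orthogonal.
- by apply/card_gt0P; exists 1%g.
- by move=> g; rewrite -repr_mxM ?subgP //= mulVg repr_mx1.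
- move=> m m' Z md m'd mm; case: pi_ext => irr nsim.
  apply: (mx_irreducible_intertwiner0 (irr m md) (irr m' m'd)).
    by apply: nsim => //; apply/eqP.
  by move=> x xG; apply: tw.
- move=> m Z md; case: pi_ext => irr _.
  by apply: (mx_irreducible_scalar (irr m md)) => x xG; apply: tw.
Qed.

End RepresentationOrthogonality.

(** Resampling one coordinate preserves the uniform measure: exchanging [g e] with the fresh value
    [a] is an involution on pairs [(g, a)]. *)
Lemma sum_ffupd (F : numFieldType) (E Om : finType) (phi : {ffun E -> Om} -> F) e :
  (0 < #|Om|)%N ->
  \sum_g phi g = #|Om|%:R^-1 * \sum_g \sum_a phi (ffupd g e a).
Proof.
move=> Om0; have n0 : #|Om|%:R != 0 :> F by rewrite pnatr_eq0 -lt0n.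
apply: (mulfI n0); rewrite mulVKf // pair_big /=.
pose swap (p : {ffun E -> Om} * Om) := (ffupd p.1 e p.2, p.1 e).
have swapK : involutive swap.
  move=> [g a]; rewrite /swap /=; congr (_, _); last by rewrite ffunE eqxx.
  by apply/ffunP => e'; rewrite !ffunE; case: eqP => // ->.
rewrite [RHS](reindex_inj (inv_inj swapK)) /=.
rewrite (eq_bigr (fun p => phi p.1)); last first.
  move=> [g a] _ /=; congr phi; apply/ffunP => e'; rewrite !ffunE.
  by case: eqP => // ->.
rewrite -(pair_big xpredT xpredT (fun g _ => phi g)) /= mulr_sumr.
by apply: eq_bigr => g _; rewrite sumr_const mulr_natl.
Qed.

Section SwapLabels.
Variables (F : numFieldType) (d N : nat) (E Om1 Om2 : finType).
Variables (X1 Y1 : Om1 -> 'M[F]_d) (X2 Y2 : Om2 -> 'M[F]_d).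
Hypotheses (orth1 : orthogonal_minors X1 Y1) (orth2 : orthogonal_minors X2 Y2).
Hypotheses (Om1_gt0 : (0 < #|Om1|)%N) (Om2_gt0 : (0 < #|Om2|)%N).
Variables (A : 'M[F]_N) (P P' : E -> 'M[F]_(N, d)) (Q Q' : E -> 'M[F]_(d, N)).

Definition det_lab (X Y : E -> 'M[F]_d) :=
  \det (A + \sum_e (P e *m X e *m Q e + P' e *m Y e *m Q' e)).

Let mixX (s : seq E) (g : {ffun E -> Om1}) (w : {ffun E -> Om2}) e :=
  if e \in s then X2 (w e) else X1 (g e).
Let mixY (s : seq E) (g : {ffun E -> Om1}) (w : {ffun E -> Om2}) e :=
  if e \in s then Y2 (w e) else Y1 (g e).

(** A hybrid argument: the edges in [s] already carry labels of the second family. With all other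
    labels fixed, [same_avg_det] exchanges the label of the single edge [e]. *)
Lemma det_lab_swap e s : e \notin s ->
  \sum_g \sum_w det_lab (mixX s g w) (mixY s g w) =
  \sum_g \sum_w det_lab (mixX (e :: s) g w) (mixY (e :: s) g w).
Proof.
move=> es; rewrite (sum_ffupd _ e Om1_gt0).
under [RHS]eq_bigr do rewrite (sum_ffupd _ e Om2_gt0).
rewrite mulr_sumr; apply: eq_bigr => g _.
rewrite exchange_big !mulr_sumr /=; apply: eq_bigr => w _.
pose B := A + \sum_(e' | e' != e)
  (P e' *m mixX s g w e' *m Q e' + P' e' *m mixY s g w e' *m Q' e').
have E1 a : det_lab (mixX s (ffupd g e a) w) (mixY s (ffupd g e a) w) =
    \det (B + (P e *m X1 a *m Q e + P' e *m Y1 a *m Q' e)).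
  rewrite /det_lab (bigD1 e) //= {1 2}/mixX {1}/mixY (negbTE es) ffunE eqxx.
  rewrite [X in A + X]addrC addrA; congr (\det (_ + _ + _)).
  by apply: eq_bigr => e' /negbTE ee; rewrite /mixX /mixY ffunE ee.
have E2 b : det_lab (mixX (e :: s) g (ffupd w e b)) (mixY (e :: s) g (ffupd w e b)) =
    \det (B + (P e *m X2 b *m Q e + P' e *m Y2 b *m Q' e)).
  rewrite /det_lab (bigD1 e) //= {1 2}/mixX {1}/mixY mem_head ffunE eqxx.
  rewrite [X in A + X]addrC addrA; congr (\det (_ + _ + _)).
  by apply: eq_bigr => e' /negbTE ee; rewrite /mixX /mixY ffunE inE ee.
rewrite (eq_bigr _ (fun a _ => E1 a)) [in RHS](eq_bigr _ (fun b _ => E2 b)).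
exact: (same_avg_det orth1 orth2).
Qed.

(** Each cardinality arises by summing over the family of labels on which the determinant no longer
    depends. *)
Lemma avg_det_lab :
  #|{ffun E -> Om2}|%:R * \sum_(g : {ffun E -> Om1}) det_lab (fun e => X1 (g e)) (fun e => Y1 (g e)) =
  #|{ffun E -> Om1}|%:R * \sum_(w : {ffun E -> Om2}) det_lab (fun e => X2 (w e)) (fun e => Y2 (w e)).
Proof.
have all_swap s : uniq s ->
    \sum_g \sum_w det_lab (mixX [::] g w) (mixY [::] g w) =
    \sum_g \sum_w det_lab (mixX s g w) (mixY s g w).
  elim: s => // e s IH /andP[es us]; rewrite IH //; exact: det_lab_swap.
have := all_swap _ (enum_uniq E).
have -> : \sum_g \sum_w det_lab (mixX [::] g w) (mixY [::] g w) =
  #|{ffun E -> Om2}|%:R * \sum_(g : {ffun E -> Om1}) det_lab (fun e => X1 (g e)) (fun e => Y1 (g e)).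
  rewrite mulr_sumr; apply: eq_bigr => g _.
  rewrite (eq_bigr (fun=> det_lab (fun e => X1 (g e)) (fun e => Y1 (g e)))) //.
  by rewrite sumr_const mulr_natl.
move=> ->; rewrite mulr_natl -sumr_const; apply: eq_bigr => g _.
apply: eq_bigr => w _; rewrite /det_lab; congr (\det (_ + _)).
by apply: eq_bigr => e _; rewrite /mixX /mixY mem_enum.
Qed.

End SwapLabels.

(** * Signed adjacency matrices and matching polynomials *)

Section UnitRows.
Variables (F : comNzRingType) (N : nat).
Implicit Types (M A B : 'M[F]_N) (v j k u : 'I_N).

(** Cofactors are represented by determinants of full size with unit rows and columns, so that
    deleting vertices never changes the index type. *)
Definition setrow v j M : 'M[F]_N := \matrix_(i, l) if i == v then (l == j)%:R else M i l.
Definition setcol v k M : 'M[F]_N := \matrix_(i, l) if l == v then (i == k)%:R else M i l.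

Lemma cofactor_off A B i j : (forall i' j', i' != i -> j' != j -> A i' j' = B i' j') ->
  cofactor A i j = cofactor B i j.
Proof.
move=> AB; rewrite /cofactor; congr (_ * \det _); apply/matrixP => i' j'; rewrite !mxE.
by apply: AB; rewrite eq_sym neq_lift.
Qed.

Lemma det_unit_row M v j : (forall l, M v l = (l == j)%:R) -> \det M = cofactor M v j.
Proof.
move=> Mv; rewrite (expand_det_row _ v) (bigD1 j) //= Mv eqxx mul1r big1 ?addr0 //.
by move=> l lj; rewrite Mv (negbTE lj) mul0r.
Qed.

Lemma det_unit_col M v k : (forall i, M i v = (i == k)%:R) -> \det M = cofactor M k v.
Proof.
move=> Mv; rewrite (expand_det_col _ v) (bigD1 k) //= Mv eqxx mul1r big1 ?addr0 //.
by move=> l lj; rewrite Mv (negbTE lj) mul0r.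
Qed.

Lemma det_expand_setrow M v : \det M = \sum_j M v j * \det (setrow v j M).
Proof.
rewrite (expand_det_row _ v); apply: eq_bigr => j _; congr (_ * _).
rewrite (det_unit_row (M := setrow v j M) (v := v) (j := j)).
  by apply: cofactor_off => i l iv _; rewrite mxE (negbTE iv).
by move=> l; rewrite mxE eqxx.
Qed.

Lemma det_expand_setcol M v : \det M = \sum_k M k v * \det (setcol v k M).
Proof.
rewrite (expand_det_col _ v); apply: eq_bigr => k _; congr (_ * _).
rewrite (det_unit_col (M := setcol v k M) (v := v) (k := k)).
  by apply: cofactor_off => i l _ lv; rewrite mxE (negbTE lv).
by move=> l; rewrite mxE eqxx.
Qed.

(* Exchanging the rows [u] and [v] of the left-hand matrix makes both of them
   unit rows up to terms which do not matter. *)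
Lemma det_setrow_setcol M (D : 'M[F]_N) u v : u != v ->
  (forall i j, D i j = if (i \in [set u; v]) || (j \in [set u; v]) then (i == j)%:R else M i j) ->
  \det (setcol v u (setrow v u M)) = - \det D.
Proof.
move=> uv DE; have vu : (v == u) = false by rewrite eq_sym (negbTE uv).
pose A := xrow u v (setcol v u (setrow v u M)).
have detA : \det A = - \det (setcol v u (setrow v u M)).
  by rewrite /A xrowE det_mulmx det_perm odd_tperm uv expr1 mulN1r.
pose B := setrow v v A.
have AE i j : A i j = (setcol v u (setrow v u M)) (tperm u v i) j by rewrite mxE.
have Av i : A i v = (i == v)%:R.
  rewrite AE mxE eqxx; congr (_%:R); congr nat_of_bool.
  by rewrite -(inj_eq (@perm_inj _ (tperm u v)) i) tpermR.
have Bv j : B v j = (j == v)%:R by rewrite mxE eqxx.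
have detB : \det A = \det B.
  rewrite (det_unit_col Av) (det_unit_row Bv).
  by apply: cofactor_off => i j iv jv; rewrite [in RHS]mxE (negbTE iv).
have Bu j : B u j = (j == u)%:R.
  rewrite mxE (negbTE uv) AE tpermL !mxE eqxx.
  by case: eqP => // ->; rewrite vu.
have Du j : D u j = (j == u)%:R by rewrite DE !inE eqxx /= eq_sym.
have -> : \det D = \det B.
  rewrite (det_unit_row Du) (det_unit_row Bu); apply: cofactor_off => i j iu ju.
  rewrite DE !inE (negbTE iu) (negbTE ju) /= mxE.
  have [->|iv] := eqVneq i v; first by rewrite eq_sym.
  rewrite AE tpermD 1?eq_sym // mxE.
  have [->|jv] := eqVneq j v; first by rewrite /= (negbTE iv) (negbTE iu).
  by rewrite /= mxE (negbTE iv).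
by rewrite -detB detA opprK.
Qed.

End UnitRows.

(** * Averages over edge signs and the recursion of matching polynomials *)

Section Matching.
Variables (R : realFieldType) (N : nat) (Fe : finType) (a b : Fe -> 'I_N).
Hypothesis loopless : forall f, a f != b f.

Definition dart := (Fe * bool)%type.
Definition dtail (p : dart) := if p.2 then a p.1 else b p.1.
Definition dhead (p : dart) := if p.2 then b p.1 else a p.1.
Definition drev (p : dart) : dart := (p.1, ~~ p.2).

Lemma dhead_neq p : dhead p != dtail p.
Proof. by rewrite /dhead /dtail; case: p.2; rewrite // eq_sym. Qed.

Implicit Types (e : {ffun Fe -> bool}) (S : {set 'I_N}) (x : R).

Definition dsign e (p : dart) : R := (-1) ^+ e p.1.

Definition signed_adj e : 'M[R]_N := \sum_(p : dart) dsign e p *: delta_mx (dtail p) (dhead p).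

Definition deleted_mx x S e : 'M[R]_N :=
  \matrix_(i, j) if (i \in S) || (j \in S) then (i == j)%:R else (x%:M - signed_adj e) i j.

(* Averaging over the signs kills all but the matching terms: up to the factor
   [#|{ffun Fe -> bool}|] this is the matching polynomial of the graph without [S]. *)
Definition sign_sum x S := \sum_e \det (deleted_mx x S e).

Lemma signed_adjE e i j :
  signed_adj e i j = \sum_(p | (dtail p == i) && (dhead p == j)) dsign e p.
Proof.
rewrite summxE [RHS]big_mkcond /=; apply: eq_bigr => p _.
by rewrite !mxE (eq_sym i) (eq_sym j); case: andP; rewrite ?mulr1 ?mulr0.
Qed.

Lemma drevK : involutive drev. Proof. by case=> f c; rewrite /drev /= negbK. Qed.

Lemma signed_adj_sym e i j : signed_adj e i j = signed_adj e j i.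
Proof.
rewrite !signed_adjE (reindex_inj (inv_inj drevK)) /=; apply: eq_bigl => p.
by rewrite /dtail /dhead /=; case: p.2; rewrite andbC.
Qed.

Section Recursion.
Variables (x : R) (S : {set 'I_N}) (v : 'I_N).
Hypothesis vS : v \notin S.

Let out p := (dtail p == v) && (dhead p \notin S).

Lemma deleted_mx_row e j :
  deleted_mx x S e v j = x *+ (v == j) - \sum_(p | out p && (dhead p == j)) dsign e p.
Proof.
rewrite mxE (negbTE vS) /=; have [jS|jS] := boolP (j \in S).
  have -> : (v == j) = false by apply: contraNF vS => /eqP ->.
  rewrite big1 ?mulr0n ?subr0 // => p /andP[/andP[_ pS] /eqP pj].
  by rewrite pj jS in pS.
rewrite !mxE signed_adjE; congr (_ - _); apply: eq_bigl => p.
by rewrite /out -andbA; case: eqP => //= _; case: eqP => [->|]; rewrite ?jS ?andbF.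
Qed.

Lemma deleted_mx_sym e i j : deleted_mx x S e i j = deleted_mx x S e j i.
Proof.
rewrite !mxE orbC eq_sym; case: ifP => // _.
by congr (_ - _); exact: signed_adj_sym.
Qed.

Let G e j k := \det (setcol v k (setrow v j (deleted_mx x S e))).

Lemma deleted_mx_v e : \det (setrow v v (deleted_mx x S e)) = \det (deleted_mx x (v |: S) e).
Proof.
rewrite (@det_unit_row _ _ _ v v) => [|l]; last by rewrite mxE eqxx.
rewrite [RHS](@det_unit_row _ _ _ v v) => [|l]; last by rewrite mxE setU11 eq_sym.
by apply: cofactor_off => i j iv jv; rewrite !mxE !inE (negbTE iv) (negbTE jv).
Qed.

(** Expanding along row [v] and then along column [v] pulls out the signs of the edges at [v]. By
    [G_flip] the remaining factor [G] does not involve them. *)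
Lemma det_deleted_expand e : \det (deleted_mx x S e) =
  x * \det (deleted_mx x (v |: S) e) +
  \sum_(p | out p) \sum_(p' | out p') dsign e p * dsign e p' * G e (dhead p) (dhead p').
Proof.
rewrite (det_expand_setrow _ v).
have -> : \sum_j deleted_mx x S e v j * \det (setrow v j (deleted_mx x S e)) =
    x * \det (setrow v v (deleted_mx x S e)) -
    \sum_(p | out p) dsign e p * \det (setrow v (dhead p) (deleted_mx x S e)).
  under eq_bigr do rewrite deleted_mx_row mulrBl.
  rewrite sumrB; congr (_ - _).
    rewrite (bigD1 v) //= eqxx mulr1n big1 ?addr0 // => j jv.
    by rewrite eq_sym (negbTE jv) mulr0n mul0r.
  rewrite [RHS](partition_big dhead xpredT) //=; apply: eq_bigr => j _.
  by rewrite mulr_suml; apply: eq_bigr => p /andP[_ /eqP ->].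
rewrite deleted_mx_v; congr (_ + _); rewrite -sumrN; apply: eq_bigr => p op.
rewrite (det_expand_setcol _ v).
have -> : \sum_k setrow v (dhead p) (deleted_mx x S e) k v *
     \det (setcol v k (setrow v (dhead p) (deleted_mx x S e))) =
   - \sum_(p' | out p') dsign e p' * G e (dhead p) (dhead p').
  rewrite (partition_big dhead xpredT) //= -sumrN; apply: eq_bigr => k _.
  have [->|kv] := eqVneq k v.
    rewrite mxE eqxx; move: op => /andP[/eqP pv _].
    rewrite -[in X in X * _]pv eq_sym (negbTE (dhead_neq p)) mul0r.
    rewrite big1 ?oppr0 // => p' /andP[/andP[/eqP <- _] h].
    by move: (dhead_neq p'); rewrite h.
  rewrite mxE (negbTE kv) deleted_mx_sym deleted_mx_row eq_sym (negbTE kv) sub0r mulNr.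
  by congr (- _); rewrite mulr_suml; apply: eq_bigr => p' /andP[_ /eqP ->].
rewrite mulrN opprK mulr_sumr; apply: eq_bigr => p' _; exact: mulrA.
Qed.

Definition flip (f : Fe) e : {ffun Fe -> bool} := [ffun f' => e f' (+) (f' == f)].

Lemma flipK f : involutive (flip f).
Proof. by move=> e; apply/ffunP => f'; rewrite !ffunE -addbA addbb addbF. Qed.

Lemma G_flip e p j k : dtail p = v -> G (flip p.1 e) j k = G e j k.
Proof.
move=> pv; congr (\det _); apply/matrixP => i l; rewrite [LHS]mxE [RHS]mxE.
case: eqP => // /eqP lv; rewrite [LHS]mxE [RHS]mxE; case: eqP => // /eqP iv.
rewrite !mxE; case: ifP => // _; rewrite !signed_adjE; congr (_ - _).
apply: eq_bigr => q /andP[/eqP qi /eqP ql]; rewrite /dsign ffunE.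
case: eqP => [qp|_]; last by rewrite addbF.
move: pv qi ql; rewrite /dtail /dhead qp; case: p.2; case: q.2 => -> E1 E2;
  by rewrite -?E1 -?E2 eqxx in iv lv *.
Qed.

(** The matching polynomial recursion at [v]. In the double sum over darts leaving [v] the average
    over signs leaves only the diagonal, where the square of the sign is 1. *)
Lemma sign_sum_rec :
  sign_sum x S = x * sign_sum x (v |: S) -
    \sum_(p | out p) sign_sum x (dhead p |: (v |: S)).
Proof.
rewrite /sign_sum (eq_bigr _ (fun e _ => det_deleted_expand e)) big_split /= -mulr_sumr.
congr (_ + _); rewrite exchange_big /= -sumrN; apply: eq_bigr => p op.
have pv : dtail p = v by case/andP: op => /eqP.
rewrite exchange_big /= (bigD1 p) //= [X in _ + X]big1 ?addr0 => [|p' /andP[op' pp']].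
  rewrite -sumrN; apply: eq_bigr => e _.
  rewrite -expr2 /dsign sqrr_sign mul1r.
  apply: det_setrow_setcol; first by rewrite -pv dhead_neq.
  move=> i j; rewrite mxE !inE.
  case: (i == dhead p); case: (i == v); case: (j == dhead p); case: (j == v) => //=;
    rewrite ?orbT //.
  by rewrite [RHS]mxE.
have p'v : dtail p' = v by case/andP: op' => /eqP.
(* Distinct darts leaving [v] lie on distinct edges, as a common edge would be a loop. Flipping the
   sign of one edge then negates the sum. *)
have p1 : p'.1 != p.1.
  apply: contraNneq pp' => E; apply/eqP; case: p p' E pv p'v {op op'} => [f c] [f' c'] /= ->.
  rewrite /dtail /=; case: c; case: c' => // h1 h2; move: (loopless f);
  by rewrite h1 h2 eqxx.
set s := \sum_i _; have : s = - s.
  rewrite {1}/s (reindex_inj (inv_inj (flipK p.1))) /= /s -sumrN; apply: eq_bigr => e _.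
  rewrite G_flip // /dsign !ffunE eqxx (negbTE p1) addbF addbT.
  by rewrite signrN !mulNr.
move=> sE; apply/eqP; rewrite -eqNr -sE; exact: eqxx.
Qed.

End Recursion.

Lemma sign_sum_setT x : sign_sum x [set: 'I_N]%SET = #|{ffun Fe -> bool}|%:R.
Proof.
rewrite /sign_sum (eq_bigr (fun=> 1)); first by rewrite sumr_const.
move=> e _; rewrite -[RHS](det1 R N); congr (\det _); apply/matrixP => i j.
by rewrite !mxE inE.
Qed.

Section Supersolution.
Variables (W : Type) (ends : W -> 'I_N) (nx : W -> dart -> W) (lev : W -> nat).
Variables (h : W -> R) (n : nat) (y : R).
Hypothesis ends_nx : forall w p, dtail p = ends w -> ends (nx w p) = dhead p.
Hypothesis nxK : forall w p, dtail p = ends w -> nx (nx w p) (drev p) = w.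
Hypothesis lev_nx : forall w p, (lev (nx w p) <= (lev w).+1)%N.
Hypothesis h_ge0 : forall w, 0 <= h w.
Hypothesis h_super : forall w, (lev w <= n)%N ->
  1 + \sum_(p | dtail p == ends w) h (nx w p) <= y * h w.
Hypothesis ends_onto : forall i, exists2 w, ends w = i & (lev w + N <= n)%N.

(** Let [Q S] be [sign_sum x S] and [w] lie over [v]. The second bound drives the induction: applied
    to [v |: S] at the neighbour [nx w p], with the reversed dart leading back to the deleted [v],
    it controls each term subtracted in [sign_sum_rec] by [Q (v |: S) * h (nx w p)]. The inequality
    for [h] at [w] then leaves [Q (v |: S)] times 1 plus the values of [h] towards [S]. As each
    deletion raises the level by at most one, [lev w + k <= n] keeps all lifts in the ball. *)
Lemma supersolution_ratio k : forall S x, #|~: S| = k -> y <= x ->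
  0 < sign_sum x S /\
  forall w, ends w \notin S -> (lev w + k <= n)%N ->
    sign_sum x (ends w |: S) <= sign_sum x S * h w /\
    forall p, dtail p = ends w -> dhead p \in S ->
      h (nx w p) * sign_sum x (ends w |: S) <= sign_sum x S * h w.
Proof.
elim: k => [|k IH] S x Sk yx.
  have -> : S = [set: 'I_N]%SET by apply/finset.setP => i; rewrite inE; have /eqP := Sk; rewrite cards_eq0 => /eqP/finset.setP/(_ i); rewrite !inE => /negbFE.
  split; last by move=> w; rewrite inE.
  by rewrite sign_sum_setT ltr0n; apply/card_gt0P; exists [ffun => false].
have cardU v : v \notin S -> #|~: (v |: S)| = k.
  move=> vS; have := cardsC S; have := cardsC (v |: S); rewrite cardsU1 vS Sk => <-.
  by rewrite add1n addSn addnS => -[/addnI].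
have main w : ends w \notin S -> (lev w + k.+1 <= n)%N ->
    sign_sum x (ends w |: S) *
      (1 + \sum_(p | (dtail p == ends w) && (dhead p \in S)) h (nx w p)) <= sign_sum x S * h w.
  move=> wS wn; set v := ends w in wS *; rewrite (sign_sum_rec x wS).
  have [Qpos IHv] := IH (v |: S) x (cardU _ wS) yx.
  set Q := sign_sum x (v |: S) in Qpos IHv *.
  have step p : (dtail p == v) && (dhead p \notin S) ->
      sign_sum x (dhead p |: (v |: S)) * h w <= Q * h (nx w p).
    move=> /andP[/eqP pv pS]; have [||_ H] := IHv (nx w p).
    - by rewrite ends_nx // !inE negb_or pS -pv dhead_neq.
    - by apply: leq_trans wn; rewrite addnS -addSn leq_add2r.
    rewrite ends_nx // in H; have := H (drev p).
    rewrite nxK // mulrC; apply.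
      by rewrite /dtail /dhead /=; case: p.2.
    by rewrite !inE /dhead /= -pv /dtail; case: p.2; rewrite eqxx.
  rewrite mulrBl [X in _ - X]mulr_suml.
  have sle : \sum_(p | (dtail p == v) && (dhead p \notin S)) sign_sum x (dhead p |: (v |: S)) * h w
     <= \sum_(p | (dtail p == v) && (dhead p \notin S)) Q * h (nx w p).
    by apply: ler_sum.
  rewrite -mulr_sumr in sle.
  have wn' : (lev w <= n)%N by apply: leq_trans wn; apply: leq_addr.
  have := h_super wn'; rewrite (bigID (fun p => dhead p \in S)) /= -/v => hs.
  set s1 := \sum_(p | _ && (_ \in _)) _ in hs *; set s2 := \sum_(p | _) _ in hs sle.
  have hx : y * h w <= x * h w by rewrite ler_wpM2r.
  have : Q * (1 + (s1 + s2)) <= Q * (x * h w).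
    by rewrite ler_wpM2l ?(ltW Qpos) // (le_trans hs).
  move: sle; set s3 := \sum_(p | _) _; lra.
split.
  have [v vS] : exists v, v \notin S.
    by have /card_gt0P[v] : (0 < #|~: S|)%N by [rewrite Sk]; rewrite inE; exists v.
  have [w wv wn] := ends_onto v.
  have [Qpos _] := IH (v |: S) x (cardU _ vS) yx.
  have kN : (k.+1 <= N)%N by rewrite -Sk -[X in (_ <= X)%N](card_ord N) max_card.
  have := main w; rewrite wv => /(_ vS); have wk : (lev w + k.+1 <= n)%N.
    by apply: leq_trans wn; rewrite leq_add2l.
  move=> /(_ wk) hm.
  have : 0 < sign_sum x S * h w.
    apply: lt_le_trans hm; rewrite mulr_gt0 // ltr_pwDl // sumr_ge0 // => p _.
  have [h0|h0] := leP (h w) 0; last by rewrite pmulr_lgt0.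
  have -> : h w = 0 by apply/le_anti; rewrite h0 h_ge0.
  by rewrite mulr0 ltxx.
move=> w wS wn; have hm := main w wS wn.
have [Qpos _] := IH (ends w |: S) x (cardU _ wS) yx.
have s0 : 0 <= \sum_(p | (dtail p == ends w) && (dhead p \in S)) h (nx w p) by rewrite sumr_ge0.
split; first by apply: le_trans hm; rewrite ler_peMr ?(ltW Qpos) // lerDl.
move=> p pw pS; apply: le_trans hm; rewrite mulrC ler_wpM2l ?(ltW Qpos) //.
rewrite (bigD1 p) ?pw ?eqxx //= addrCA lerDl addr_ge0 // sumr_ge0 //.
Qed.

Lemma sign_sum_lower_bound :
  exists2 c : R, 0 < c & forall x, y <= x -> c <= sign_sum x finset.set0.
Proof.
have [w wP] : exists w : 'I_N -> W, forall i, ends (w i) = i /\ (lev (w i) + N <= n)%N.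
  have H i : {w | ends w = i /\ (lev w + N <= n)%N}.
    by apply: boolp.cid; have [w] := ends_onto i; exists w.
  by exists (fun i => sval (H i)) => i; case: (H i).
(* [Hm] bounds [h] at one chosen lift of each vertex. Restoring a deleted vertex costs at most a
   factor [Hm], and the recursion starts at the full set, where [sign_sum] is at least 1. *)
pose Hm := 1 + \sum_i h (w i).
have Hm0 : 0 < Hm by rewrite ltr_pwDl // sumr_ge0.
have hHm i : h (w i) <= Hm.
  by rewrite /Hm (bigD1 i) //= addrCA lerDl addr_ge0 // sumr_ge0.
exists (Hm^-1 ^+ N); first by rewrite exprn_gt0 // invr_gt0.
move=> x yx; suff H k S : #|~: S| = k -> Hm^-1 ^+ k <= sign_sum x S.
  by apply: H; rewrite finset.setC0 cardsT card_ord.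
elim: k S => [|k IH] S Sk.
  have -> : S = [set: 'I_N]%SET by apply/finset.setP => i; rewrite inE; have /eqP := Sk; rewrite cards_eq0 => /eqP/finset.setP/(_ i); rewrite !inE => /negbFE.
  by rewrite sign_sum_setT expr0 ler1n; apply/card_gt0P; exists [ffun => false].
have [v vS] : exists v, v \notin S.
  by have /card_gt0P[v] : (0 < #|~: S|)%N by [rewrite Sk]; rewrite inE; exists v.
have kN : (k.+1 <= N)%N by rewrite -Sk -[X in (_ <= X)%N](card_ord N) max_card.
have [Spos H] := supersolution_ratio Sk yx.
have [wv wn] := wP v.
have [||le1 _] := H (w v); rewrite ?wv //.
  by apply: leq_trans wn; rewrite leq_add2l.
rewrite wv in le1.
have cU : #|~: (v |: S)| = k.
  have := cardsC S; have := cardsC (v |: S); rewrite cardsU1 vS Sk => <-.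
  by rewrite add1n addSn addnS => -[/addnI].
rewrite exprS mulrC ler_pdivrMr //; apply: le_trans (IH _ cU) _.
by apply: le_trans le1 _; rewrite ler_wpM2l // ltW.
Qed.

End Supersolution.
End Matching.

(** * Spectral radius of a graph of bounded degree *)

Section NestedIntervals.
Variable R : realType.

Lemma expr4_small (c e : R) : 0 <= c -> 0 < e -> exists n, c * 4^-1 ^+ n <= e.
Proof.
move=> c0 e0; pose n := Num.bound (c / e); exists n.
have h4 : n%:R <= 4 ^+ n :> R.
  by rewrite -natrX ler_nat; apply/ltnW/ltn_expl.
have p4 : 0 < 4 ^+ n :> R by rewrite exprn_gt0.
rewrite exprVn ler_pdivrMr // mulrC -ler_pdivrMr //.
apply: le_trans h4; apply/ltW/archi_boundP; exact: divr_ge0 c0 (ltW e0).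
Qed.

Lemma expr4_le0 (x c : R) : 0 <= c -> (forall n, x <= c * 4^-1 ^+ n) -> x <= 0.
Proof.
move=> c0 h; rewrite leNgt; apply/negP => x0.
have [n hn] := expr4_small c0 (divr_gt0 x0 (ltr0n R 2)).
by have := le_trans (h n) hn; lra.
Qed.

(** The radius [t n] is the tail of the geometric series from [n] on, so the intervals around [x n]
    are nested; [l] is the supremum of their left ends. *)
Lemma geometric_limit (x : nat -> R) (c : R) : 0 <= c ->
  (forall n, `|x n.+1 - x n| <= c * 2^-1 ^+ n) ->
  exists l, forall n, `|l - x n| <= 2 * c * 2^-1 ^+ n.
Proof.
move=> c0 xc; pose t n : R := 2 * c * 2^-1 ^+ n.
have t0 n : 0 <= t n by rewrite !mulr_ge0 ?exprn_ge0 ?invr_ge0.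
have tS n : t n.+1 = t n - c * 2^-1 ^+ n by rewrite /t exprS; field.
have inc n m : x n - t n <= x (n + m)%N - t (n + m)%N.
  elim: m => [|m IH]; first by rewrite addn0.
  apply: le_trans IH _; rewrite addnS tS.
  have := xc (n + m)%N; rewrite ler_norml => /andP[h _]; lra.
have dec n m : x (n + m)%N + t (n + m)%N <= x n + t n.
  elim: m => [|m IH]; first by rewrite addn0.
  apply: le_trans IH; rewrite addnS tS.
  have := xc (n + m)%N; rewrite ler_norml => /andP[_ h]; lra.
have le n m : x n - t n <= x m + t m.
  apply: le_trans (inc n m) _; rewrite addnC; apply: le_trans (dec m n).
  have := t0 (m + n)%N; lra.
pose S := [set x n - t n | n in setT]%classic.
have ubS m : ubound S (x m + t m) by move=> _ [n _ <-]; exact: le.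
have S0 : (S !=set0)%classic by exists (x 0%N - t 0%N); exists 0%N.
exists (sup S) => n; rewrite ler_norml; apply/andP; split.
  have : x n - t n <= sup S by apply: ub_le_sup; [exists (x 0%N + t 0%N)|exists n].
  by rewrite -/(t n); lra.
by have := ge_sup S0 (ubS n); rewrite -/(t n); lra.
Qed.

End NestedIntervals.

Section SquareNorm.
Variable R : realType.
Local Notation C := R[i].

Definition nsq (z : C) : R := complex.Re z ^+ 2 + complex.Im z ^+ 2.

Lemma nsq_ge0 z : 0 <= nsq z.
Proof. by rewrite addr_ge0 ?sqr_ge0. Qed.

Lemma normc_sqr z : Normc.normc z ^+ 2 = nsq z.
Proof. by case: z => a b; rewrite sqr_sqrtr // addr_ge0 ?sqr_ge0. Qed.

Lemma nsqM z w : nsq (z * w) = nsq z * nsq w.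
Proof. by rewrite -!normc_sqr Normc.normcM exprMn. Qed.

Lemma nsqV z : nsq z^-1 = (nsq z)^-1.
Proof. by rewrite -!normc_sqr Normc.normcV exprVn. Qed.

Lemma nsqD z w : nsq (z + w) <= 2 * nsq z + 2 * nsq w.
Proof.
case: z => a b; case: w => c d; rewrite /nsq /=.
by have := sqr_ge0 (a - c); have := sqr_ge0 (b - d); nra.
Qed.

Lemma sum_const_seq (I : Type) (s : seq I) (x : R) :
  \sum_(i <- s) x = (size s)%:R * x.
Proof. by rewrite big_const_seq count_predT iter_addr_0 -[LHS]mulr_natl. Qed.

Lemma nsqN z : nsq (- z) = nsq z.
Proof. by case: z => a b; rewrite /nsq /=; ring. Qed.

Lemma nsq_real (x : R) : nsq x%:C = x ^+ 2.
Proof. by rewrite /nsq /= expr0n addr0. Qed.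

Lemma nsq_eq0 z : nsq z <= 0 -> z = 0.
Proof.
move=> z0; apply: Normc.eq0_normc; apply/eqP; rewrite -sqrf_eq0 normc_sqr.
by rewrite eq_le z0 nsq_ge0.
Qed.

Lemma nsq_sum (I : Type) (s : seq I) (f : I -> C) :
  nsq (\sum_(i <- s) f i) <= (size s)%:R * \sum_(i <- s) nsq (f i).
Proof.
have cs (g : I -> R) : (\sum_(i <- s) g i) ^+ 2 <= (size s)%:R * \sum_(i <- s) g i ^+ 2.
  elim: s => [|i s IH]; first by rewrite !big_nil expr0n mulr0.
  rewrite !big_cons /= -natr1; set a := \sum_(_ <- _) _ in IH *.
  set b := \sum_(_ <- _) _ in IH *; set k := (size s)%:R in IH *.
  have k0 : 0 <= k by rewrite ler0n.
  have b0 : 0 <= b by rewrite sumr_ge0 // => j _; rewrite sqr_ge0.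
  suff : 2 * (g i * a) <= k * g i ^+ 2 + b by nra.
  have [k1|k1] := eqVneq k 0.
    have -> : a = 0 by apply/eqP; rewrite -sqrf_eq0 eq_le sqr_ge0 andbT; move: IH; rewrite k1 mul0r.
    by rewrite !mulr0 k1 mul0r add0r.
  have kp : 0 < k by rewrite lt_def k1.
  by rewrite -(ler_pM2l kp); have := sqr_ge0 (k * g i - a); nra.
have re : complex.Re (\sum_(i <- s) f i) = \sum_(i <- s) complex.Re (f i).
  elim: (s) => [|i s' IH]; first by rewrite !big_nil.
  by rewrite !big_cons -IH; case: (f i) => a b; case: (\sum_(_ <- _) _).
have im : complex.Im (\sum_(i <- s) f i) = \sum_(i <- s) complex.Im (f i).
  elim: (s) => [|i s' IH]; first by rewrite !big_nil.
  by rewrite !big_cons -IH; case: (f i) => a b; case: (\sum_(_ <- _) _).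
by rewrite /nsq re im big_split mulrDr lerD.
Qed.

End SquareNorm.

Section EllTwoBounds.
Variables (R : realType) (T : choiceType).
Local Notation C := R[i].
Implicit Types (f g : T -> C) (s : seq T).

(** Square-summability through finite sums in [R]; [l2sum_le] links it to the sum in the extended
    reals. *)
Definition l2_bound f (c : R) := forall s, uniq s -> \sum_(v <- s) nsq (f v) <= c.

Lemma l2_bound_ge0 f c : l2_bound f c -> 0 <= c.
Proof. by move=> /(_ [::] isT); rewrite big_nil. Qed.

Lemma l2sum_le f c : (l2sum f <= c%:E)%E <-> l2_bound f c.
Proof.
have fsE s : uniq s -> (\sum_(v \in [set` s]) (Normc.normc (f v) ^+ 2)%:E)%E
    = (\sum_(v <- s) nsq (f v))%:E.
  move=> us; rewrite -fsbig_seq // -sumEFin; apply: eq_bigr => v _.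
  by rewrite normc_sqr.
split=> [h s us|h].
  rewrite -lee_fin -fsE //; apply: le_trans h; apply: ereal_sup_ubound.
  by exists [set` s]%classic => //; split => //; exact: finite_seq.
apply: ge_ereal_sup => _ [A [finA _] <-].
have [s Es] := (finite_seqP A).1 finA.
have -> : A = [set` undup s]%classic.
  by rewrite Es; apply/seteqP; split => x /=; rewrite mem_undup.
by rewrite fsE ?undup_uniq // lee_fin; apply: h; exact: undup_uniq.
Qed.

Lemma l2sum_ge0 f : (0 <= l2sum f)%E.
Proof. by apply: esum_ge0 => x _; rewrite lee_fin sqr_ge0. Qed.

Lemma l2P f : l2 f <-> exists c, l2_bound f c.
Proof.
split=> [h|[c /l2sum_le h]]; last by apply: le_lt_trans h _; rewrite ltry.
exists (fine (l2sum f)); apply/l2sum_le; rewrite fineK //.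
by rewrite ge0_fin_numE // l2sum_ge0.
Qed.

Lemma l2norm_sqr_bound f : l2 f -> l2_bound f (l2norm f ^+ 2).
Proof.
move=> h; apply/l2sum_le; rewrite sqr_sqrtr ?fine_ge0 ?l2sum_ge0 // fineK //.
by rewrite ge0_fin_numE // l2sum_ge0.
Qed.

Lemma l2norm_sqr_le f c : l2_bound f c -> l2norm f ^+ 2 <= c.
Proof.
move=> h; have h' := (l2sum_le f c).2 h.
rewrite sqr_sqrtr ?fine_ge0 ?l2sum_ge0 // -lee_fin fineK //.
by rewrite ge0_fin_numE ?l2sum_ge0 //; apply: le_lt_trans h' _; rewrite ltry.
Qed.

Lemma l2_boundW f c c' : c <= c' -> l2_bound f c -> l2_bound f c'.
Proof. by move=> cc h s us; apply: le_trans cc; exact: h. Qed.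

Lemma l2_boundD f g c c' : l2_bound f c -> l2_bound g c' ->
  l2_bound (fun v => f v + g v) (2 * c + 2 * c').
Proof.
move=> hf hg s us.
apply: (@le_trans _ _ (\sum_(v <- s) (2 * nsq (f v) + 2 * nsq (g v)))).
  by apply: ler_sum => v _; exact: nsqD.
rewrite big_split /= -!mulr_sumr; have := hf s us; have := hg s us; lra.
Qed.

Lemma l2_boundZ a f c : l2_bound f c -> l2_bound (fun v => a * f v) (nsq a * c).
Proof.
move=> hf s us; under eq_bigr do rewrite nsqM.
by rewrite -mulr_sumr ler_wpM2l ?nsq_ge0 // hf.
Qed.

Lemma l2_boundN f c : l2_bound f c -> l2_bound (fun v => - f v) c.
Proof. by move=> hf s us; under eq_bigr do rewrite nsqN; exact: hf. Qed.

End EllTwoBounds.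

(** * The adjacency operator in bounded degree: resolvent, norm, supersolutions *)

Section BoundedDegree.
Variables (R : realType) (T : choiceType) (adj : rel T) (nbs : T -> seq T) (D : nat).
Local Notation C := R[i].
Hypothesis adj_sym : forall u v, adj u v = adj v u.
Hypothesis nbsP : forall u v, (u \in nbs v) = adj v u.
Hypothesis nbs_uniq : forall v, uniq (nbs v).
Hypothesis nbs_size : forall v, (size (nbs v) <= D)%N.
Local Notation A := (@adjacency_operator R T adj).
Implicit Types (f g : T -> C) (s : seq T).

Lemma adjacencyE f v : A f v = \sum_(u <- nbs v) f u.
Proof.
rewrite /adjacency_operator (fsbig_seq _ _ (nbs_uniq v)).
by congr (\sum_(u \in _) _); apply/seteqP; split => u /=; rewrite nbsP.
Qed.

Lemma adjacency_linear a f g v : A (fun v => a * f v + g v) v = a * A f v + A g v.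
Proof. by rewrite !adjacencyE big_split /= mulr_sumr. Qed.

(** Double counting: a vertex [u] is a neighbour of at most [D] vertices [v]. *)
Lemma sum_neighbours (F : T -> R) c : (forall v, 0 <= F v) ->
  (forall s, uniq s -> \sum_(v <- s) F v <= c) ->
  forall s, uniq s -> \sum_(v <- s) \sum_(u <- nbs v) F u <= D%:R * c.
Proof.
move=> F0 Fc s us; pose U := undup (flatten (map nbs s)).
have inU v u : v \in s -> u \in nbs v -> u \in U.
  by move=> vs uv; rewrite mem_undup; apply/flattenP; exists (nbs v) => //; exact: map_f.
have -> : \sum_(v <- s) \sum_(u <- nbs v) F u =
    \sum_(u <- U) \sum_(v <- s | adj u v) F u.
  rewrite [RHS](exchange_big_dep xpredT) //= big_seq [RHS]big_seq.
  apply: eq_bigr => v vs; rewrite -[RHS]big_filter; apply: perm_big.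
  apply: uniq_perm; rewrite ?filter_uniq ?undup_uniq // => u.
  rewrite mem_filter adj_sym -nbsP; case: (boolP (u \in nbs v)) => //= uv.
  by rewrite (inU v).
apply: (@le_trans _ _ (\sum_(u <- U) D%:R * F u)); last first.
  by rewrite -mulr_sumr ler_wpM2l ?ler0n // Fc ?undup_uniq.
apply: ler_sum => u _; rewrite -big_filter sum_const_seq.
rewrite ler_wpM2r // ler_nat; apply: leq_trans (nbs_size u).
apply: uniq_leq_size; first exact: filter_uniq.
by move=> v; rewrite mem_filter nbsP => /andP[].
Qed.

Lemma l2_bound_adjacency f c : l2_bound f c -> l2_bound (A f) (D%:R ^+ 2 * c).
Proof.
move=> hf s us.
apply: (@le_trans _ _ (\sum_(v <- s) D%:R * \sum_(u <- nbs v) nsq (f u))).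
  apply: ler_sum => v _; rewrite adjacencyE; apply: le_trans (nsq_sum _ _) _.
  by rewrite ler_wpM2r ?ler_nat // sumr_ge0 // => u _; exact: nsq_ge0.
rewrite -mulr_sumr expr2 -mulrA ler_wpM2l ?ler0n //.
by apply: sum_neighbours => // v; exact: nsq_ge0.
Qed.

Section Resolvent.
Variable z : C.
Hypothesis z_large : 4 * D%:R ^+ 2 + 4 <= nsq z.

Let D2_ge0 : 0 <= D%:R ^+ 2 :> R. Proof. exact: sqr_ge0. Qed.
Let nz_gt0 : 0 < nsq z. Proof. by apply: lt_le_trans z_large; have := D2_ge0; lra. Qed.
Let z_neq0 : z != 0.
Proof. by apply: contraTneq nz_gt0 => ->; rewrite /nsq /= expr0n addr0 ltxx. Qed.

Lemma eigenfunction_eq0 f : l2 f -> (forall v, A f v = z * f v) -> f = fun=> 0.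
Proof.
move=> /l2norm_sqr_bound hf Af; set c := _ ^+ 2 in hf.
have c0 : 0 <= c by exact: l2_bound_ge0 hf.
have h1 : l2_bound f (D%:R ^+ 2 * c / nsq z).
  move=> s us; rewrite ler_pdivlMr // mulrC mulr_sumr.
  rewrite (eq_bigr (fun v => nsq (A f v))) => [|v _]; last by rewrite Af nsqM.
  exact: l2_bound_adjacency.
have := l2norm_sqr_le h1; rewrite -/c ler_pdivlMr // => h2.
have h3 : c * (4 * D%:R ^+ 2 + 4) <= c * nsq z by rewrite ler_wpM2l.
have c1 : c <= 0 by have := mulr_ge0 c0 D2_ge0; lra.
apply/funext => v; apply: nsq_eq0.
by have := hf [:: v] isT; rewrite big_seq1 => /le_trans; apply.
Qed.

(** Neumann iteration for [A u - z u = f], read as [u = (A u - f) / z]. As [A] multiplies squared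
    norms by at most [D^2], the hypothesis on [z] makes this contract them by [1/4] and keeps all
    iterates below the bound of [f]. *)
Fixpoint iterate f n : T -> C :=
  if n is n'.+1 then fun v => (A (iterate f n') v - f v) / z else fun=> 0.

Lemma iterate_bound f c n : l2_bound f c -> l2_bound (iterate f n) c.
Proof.
move=> hf; have c0 := l2_bound_ge0 hf; elim: n => [|n IH] /=.
  move=> s _; rewrite big1 // => v _; by rewrite /nsq /= expr0n addr0.
have := l2_boundZ z^-1 (l2_boundD (l2_bound_adjacency IH) (l2_boundN hf)).
rewrite nsqV => h; apply: (@l2_boundW _ _ _ ((nsq z)^-1 * (2 * (D%:R ^+ 2 * c) + 2 * c))).
  rewrite ler_pdivrMl //.
  have h3 : c * (4 * D%:R ^+ 2 + 4) <= c * nsq z by rewrite ler_wpM2l.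
  by have := mulr_ge0 c0 D2_ge0; lra.
by move=> s us; have := h s us; under eq_bigr do rewrite mulrC.
Qed.

Lemma iterate_diff f c n : l2_bound f c ->
  l2_bound (fun v => iterate f n.+1 v - iterate f n v) (c * 4^-1 ^+ n).
Proof.
move=> hf; have c0 := l2_bound_ge0 hf; elim: n => [|n IH].
  rewrite expr0 mulr1 => s us; have := iterate_bound 1 hf us.
  by under [X in _ -> X <= _]eq_bigr do rewrite subr0.
have := l2_boundZ z^-1 (l2_bound_adjacency IH); rewrite nsqV => h.
apply: (@l2_boundW _ _ _ ((nsq z)^-1 * (D%:R ^+ 2 * (c * 4^-1 ^+ n)))).
  rewrite ler_pdivrMl // [4^-1 ^+ n.+1]exprS [c * (4^-1 * _)]mulrCA.
  have : 0 <= c * 4^-1 ^+ n by rewrite mulr_ge0 // exprn_ge0 // invr_ge0.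
  move: (c * _) => x x0.
  have h3 : x * (4 * D%:R ^+ 2 + 4) <= x * nsq z by rewrite ler_wpM2l.
  by have := mulr_ge0 x0 D2_ge0; lra.
move=> s us; have := h s us; rewrite [X in X <= _ -> _](eq_bigr
  (fun v => nsq (iterate f n.+2 v - iterate f n.+1 v))) // => v _; congr nsq.
have -> : A (fun v => iterate f n.+1 v - iterate f n v) v
    = A (iterate f n.+1) v - A (iterate f n) v.
  by rewrite !adjacencyE sumrB.
by rewrite /= -mulrBl mulrC; congr (_ * _); rewrite opprB addrA subrK.
Qed.

(** The limit is pointwise. Real and imaginary parts each contribute [(2 sqrt c)^2 = 4 c], hence the
    constant 8. *)
Lemma iterate_limit f c : l2_bound f c ->
  exists u : T -> C, forall n v, nsq (u v - iterate f n v) <= 8 * c * 4^-1 ^+ n.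
Proof.
move=> hf; have c0 := l2_bound_ge0 hf.
have sq2 n : (Num.sqrt c * 2^-1 ^+ n) ^+ 2 = c * 4^-1 ^+ n.
  rewrite exprMn sqr_sqrtr // -exprM mulnC exprM; congr (_ * _ ^+ _).
  by rewrite expr2; field.
have dn n v : nsq (iterate f n.+1 v - iterate f n v) <= c * 4^-1 ^+ n.
  by have := iterate_diff n hf (s := [:: v]) isT; rewrite big_seq1.
have p0 n : 0 <= Num.sqrt c * 2^-1 ^+ n by rewrite mulr_ge0 ?sqrtr_ge0 // exprn_ge0 // invr_ge0.
have lim (P : C -> R) : (forall x y, P (x - y) = P x - P y) -> (forall x, P x ^+ 2 <= nsq x) ->
    forall v, exists l, forall n, (l - P (iterate f n v)) ^+ 2 <= 4 * c * 4^-1 ^+ n.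
  move=> PB Psq v.
  have [|l hl] := @geometric_limit R (fun n => P (iterate f n v)) _ (sqrtr_ge0 c).
    move=> n; rewrite -(@ler_pXn2r _ 2) ?nnegrE // sq2 real_normK ?num_real // -PB.
    exact: le_trans (Psq _) (dn n v).
  exists l => n; have q0 : 0 <= 2 * Num.sqrt c * 2^-1 ^+ n by rewrite -mulrA mulr_ge0.
  have := hl n; rewrite -(@ler_pXn2r _ 2) ?nnegrE ?q0 ?normr_ge0 //.
  rewrite real_normK ?num_real // -!mulrA exprMn sq2 => h; apply: le_trans h _.
  by rewrite expr2; have -> : 2 * 2 = 4 :> R by ring.
have [|x|lr hr] := @choice _ _ _ (lim (@complex.Re R) _ _).
- by move=> [? ?] [].
- by rewrite /nsq lerDl sqr_ge0.
have [|x|li hi] := @choice _ _ _ (lim (@complex.Im R) _ _).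
- by move=> [? ?] [].
- by rewrite /nsq lerDr sqr_ge0.
exists (fun v => lr v +i* li v) => n v.
have -> : 8 * c * 4^-1 ^+ n = 4 * c * 4^-1 ^+ n + 4 * c * 4^-1 ^+ n by ring.
have := lerD (hr v n) (hi v n); apply: le_trans.
by rewrite /nsq; case: (iterate f n v) => a b /=.
Qed.

Lemma solve_resolvent f : l2 f -> exists2 u, l2 u & forall v, A u v - z * u v = f v.
Proof.
move=> /l2P[c hf]; have c0 := l2_bound_ge0 hf.
have [u hu] := iterate_limit hf; exists u.
  apply/l2P; exists (2 * 1 + 2 * c) => s us.
  (* The index [n] depends on the finite set [s] and makes its accumulated error at most 1, while
     the resulting bound [2 + 2 c] is the same for all [s]. *)
  have [n hn] := expr4_small (mulr_ge0 (ler0n R (size s)) (mulr_ge0 (ler0n R 8) c0)) ltr01.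
  apply: (@le_trans _ _ (\sum_(v <- s) (2 * nsq (u v - iterate f n v) + 2 * nsq (iterate f n v)))).
    by apply: ler_sum => v _; rewrite -{1}[u v](subrK (iterate f n v)); exact: nsqD.
  rewrite big_split /= -!mulr_sumr; apply: lerD; rewrite ler_pM2l //; last exact: iterate_bound.
  apply: le_trans hn.
  apply: (@le_trans _ _ (\sum_(v <- s) 8 * c * 4^-1 ^+ n)); first by apply: ler_sum => v _.
  by rewrite sum_const_seq !mulrA.
move=> v; apply/eqP; rewrite -subr_eq0; apply/eqP/nsq_eq0.
have sz0 : 0 <= (size (nbs v))%:R :> R by rewrite ler0n.
apply: (@expr4_le0 _ _ (2 * ((size (nbs v))%:R * ((size (nbs v))%:R * (8 * c))) + 2 * (nsq z * (8 * c)))).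
  have n0 := nsq_ge0 z; have c8 : 0 <= 8 * c by rewrite mulr_ge0.
  by apply: addr_ge0; apply: mulr_ge0 => //; apply: mulr_ge0 => //; apply: mulr_ge0.
move=> n.
have itE : A (iterate f n) v - f v = z * iterate f n.+1 v by rewrite /= mulrC divfK.
have -> : A u v - z * u v - f v =
    \sum_(w <- nbs v) (u w - iterate f n w) + - (z * (u v - iterate f n.+1 v)).
  rewrite sumrB -!adjacencyE mulrBr -itE; ring.
apply: le_trans (nsqD _ _) _; rewrite nsqN nsqM [leRHS]mulrDl; apply: lerD.
  rewrite -!mulrA ler_pM2l // [in leRHS]mulrCA; apply: le_trans (nsq_sum _ _) _.
  rewrite ler_wpM2l //.
  apply: (@le_trans _ _ (\sum_(w <- nbs v) 8 * c * 4^-1 ^+ n)); first by apply: ler_sum => w _.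
  by rewrite sum_const_seq !mulrA.
rewrite -!mulrA ler_pM2l // ler_pM2l //.
have := hu n.+1 v => /le_trans; apply.
rewrite -mulrA exprS; have : 0 <= c * 4^-1 ^+ n by rewrite mulr_ge0 // exprn_ge0 // invr_ge0.
by move: (4^-1 ^+ n) => w; lra.
Qed.

(** This bounds the moduli of the spectrum, so that the [sup] defining the spectral radius is an
    upper bound of them. *)
Lemma resolvent_large : l2_resolvent A z.
Proof.
pose shift f v := A f v - z * f v.
have shift_l2 f : l2 f -> l2 (shift f).
  move=> /l2P[c hf]; apply/l2P; eexists.
  exact: l2_boundD (l2_bound_adjacency hf) (l2_boundN (l2_boundZ z hf)).
have shiftD a f g v : shift (fun v => a * f v + g v) v = a * shift f v + shift g v.
  rewrite /shift adjacency_linear; ring.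
have l2lin a f g : l2 f -> l2 g -> l2 (fun v => a * f v + g v).
  move=> /l2P[c hf] /l2P[c' hg]; apply/l2P; eexists.
  exact: l2_boundD (l2_boundZ a hf) hg.
have shift_inj f g : l2 f -> l2 g -> shift f = shift g -> f = g.
  move=> lf lg fg; have := l2lin (-1) f g lf lg => l.
  have := eigenfunction_eq0 l.
  have h v : A (fun v => -1 * f v + g v) v = z * (-1 * f v + g v).
    apply/eqP; rewrite -subr_eq0 -/(shift _ _) shiftD fg mulN1r addNr. exact: eqxx.
  move=> /(_ h) E; apply/funext => v; have := congr1 (fun k => k v) E.
  by move=> /= /eqP; rewrite mulN1r addrC subr_eq0 => /eqP ->.
pose B f : T -> C := if pselect (l2 f) is left lf then s2val (cid2 (solve_resolvent lf)) else f.
have BP f : l2 f -> l2 (B f) /\ shift (B f) = f.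
  rewrite /B; case: pselect => // lf _; case: (cid2 _) => u lu hu /=.
  by split => //; apply/funext => v; exact: hu.
exists B; split; last first.
  move=> f lf; split; last by case: (BP f lf).
  have [l1 l2] := BP _ (shift_l2 f lf); exact: shift_inj.
split.
- by move=> f /BP[].
- move=> a f g lf lg.
  have [lB lBE] := BP _ (l2lin a f g lf lg).
  have [lf1 lf2] := BP f lf; have [lg1 lg2] := BP g lg.
  apply: shift_inj => //; first exact: l2lin.
  by rewrite lBE; apply/funext => v; rewrite shiftD lf2 lg2.
exists 1 => f lf; rewrite mul1r; have [lB lBE] := BP f lf.
rewrite -(@ler_pXn2r _ 2) ?nnegrE ?sqrtr_ge0 //.
have hB := l2norm_sqr_bound lB; have hf := l2norm_sqr_bound lf.
set c := l2norm (B f) ^+ 2 in hB *; set c' := l2norm f ^+ 2 in hf *.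
have c0 := l2_bound_ge0 hB; have c0' := l2_bound_ge0 hf.
have : l2_bound (B f) ((nsq z)^-1 * (2 * (D%:R ^+ 2 * c) + 2 * c')).
  move=> s us; have := l2_boundZ z^-1 (l2_boundD (l2_bound_adjacency hB) (l2_boundN hf)) us.
  rewrite nsqV [X in X <= _ -> _](eq_bigr (fun v => nsq (B f v))) // => v _.
  congr nsq; rewrite -[in - f v]lBE /shift opprB addrCA subrr addr0 mulKf //.
move=> /l2norm_sqr_le; rewrite -/c ler_pdivlMl // => h.
have h3 : c * (4 * D%:R ^+ 2 + 4) <= c * nsq z by rewrite ler_wpM2l.
by have := mulr_ge0 c0 D2_ge0; nra.
Qed.

End Resolvent.

Section RealFunctions.
Implicit Types y w : T -> R.

Definition radj y v := \sum_(u <- nbs v) y u.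
Definition supported s y := forall v, v \notin s -> y v = 0.

Lemma sum_widen (F : T -> R) s s' : uniq s -> uniq s' -> {subset s <= s'} ->
  (forall v, v \notin s -> F v = 0) -> \sum_(v <- s') F v = \sum_(v <- s) F v.
Proof.
move=> us us' ss F0; rewrite (bigID (mem s)) /= [X in _ + X]big1 // addr0.
rewrite -big_filter; apply: perm_big; apply: uniq_perm; rewrite ?filter_uniq // => v.
by rewrite mem_filter; case: (boolP (v \in s)) => // /ss ->.
Qed.

Lemma sum_le_sub (F : T -> R) s s' : uniq s -> uniq s' -> {subset s <= s'} ->
  (forall v, 0 <= F v) -> \sum_(v <- s) F v <= \sum_(v <- s') F v.
Proof.
move=> us us' ss F0; rewrite [leRHS](bigID (mem s)) /= -[X in _ <= X + _]big_filter.
rewrite [X in _ <= X + _](perm_big s); first by rewrite lerDl sumr_ge0.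
apply: uniq_perm; rewrite ?filter_uniq // => v.
by rewrite mem_filter; case: (boolP (v \in s)) => // /ss ->.
Qed.

Lemma l2_bound_supported s y : uniq s -> supported s y ->
  l2_bound (fun v => (y v)%:C) (\sum_(v <- s) y v ^+ 2).
Proof.
move=> us ys s' us'; under eq_bigr do rewrite nsq_real.
rewrite -(@sum_widen (fun v => y v ^+ 2) s (undup (s ++ s'))) ?undup_uniq //.
- apply: sum_le_sub; rewrite ?undup_uniq // => v.
    by rewrite mem_undup mem_cat => ->; rewrite orbT.
  exact: sqr_ge0.
- by move=> v vs; rewrite mem_undup mem_cat vs.
- by move=> v /ys ->; rewrite expr0n.
Qed.

Lemma l2norm_supported s y : uniq s -> supported s y ->
  l2norm (fun v => (y v)%:C) ^+ 2 = \sum_(v <- s) y v ^+ 2.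
Proof.
move=> us ys; have hb := l2_bound_supported us ys.
apply/eqP; rewrite eq_le l2norm_sqr_le //=.
have l : l2 (fun v => (y v)%:C) by apply/l2P; eexists; exact: hb.
have := l2norm_sqr_bound l us; rewrite (eq_bigr (fun v => y v ^+ 2)) // => v _.
exact: nsq_real.
Qed.

Lemma adjacency_real y v : A (fun v => (y v)%:C) v = (radj y v)%:C.
Proof. by rewrite adjacencyE rmorph_sum. Qed.

(** [k] bounds the squared norm of the operator on finitely supported real functions. The set [s']
    is independent of [s] because [radj y] spreads beyond the support of [y]. *)
Definition adj_bound k := forall s y, uniq s -> supported s y ->
  forall s', uniq s' -> \sum_(v <- s') radj y v ^+ 2 <= k * \sum_(v <- s) y v ^+ 2.

Lemma adj_bound_D : adj_bound (D%:R ^+ 2).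
Proof.
move=> s y us ys s' us'.
have := l2_bound_adjacency (l2_bound_supported us ys) us'.
by under eq_bigr do rewrite adjacency_real nsq_real.
Qed.

Definition nbh s := undup (s ++ flatten (map nbs s)).

Lemma sub_nbh s : {subset s <= nbh s}.
Proof. by move=> v vs; rewrite mem_undup mem_cat vs. Qed.

Lemma supported_radj s y : supported s y -> supported (nbh s) (radj y).
Proof.
move=> ys v vN; rewrite /radj big_seq big1 // => u uv; apply: ys.
apply: contraNN vN => us; rewrite mem_undup mem_cat; apply/orP; right.
by apply/flattenP; exists (nbs u); rewrite ?map_f // nbsP adj_sym -nbsP.
Qed.

Lemma radj_supported s y v : uniq s -> supported s y ->
  radj y v = \sum_(u <- s) (adj v u)%:R * y u.
Proof.
move=> us ys; rewrite /radj.
rewrite -(@sum_widen (fun u => (adj v u)%:R * y u) s (undup (s ++ nbs v))) ?undup_uniq //.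
- rewrite (@sum_widen _ (nbs v)) ?undup_uniq //.
  + by rewrite big_seq [RHS]big_seq; apply: eq_bigr => u; rewrite nbsP => ->; rewrite mul1r.
  + by move=> u uv; rewrite mem_undup mem_cat uv orbT.
  + by move=> u; rewrite nbsP => /negbTE ->; rewrite mul0r.
- by move=> u uv; rewrite mem_undup mem_cat uv.
- by move=> u /ys ->; rewrite mulr0.
Qed.

Lemma radj_symmetric s y w : uniq s -> supported s y -> supported s w ->
  \sum_(v <- s) radj y v * w v = \sum_(v <- s) y v * radj w v.
Proof.
move=> us ys ws; under eq_bigr do rewrite (radj_supported _ us ys) mulr_suml.
rewrite exchange_big /=; apply: eq_bigr => u _.
rewrite (radj_supported _ us ws) mulr_sumr; apply: eq_bigr => v _.
by rewrite adj_sym; ring.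
Qed.

Variable t0 : T.

Let S : set R := [set k | 0 <= k /\ adj_bound k]%classic.
Let K := inf S.

Let S_D : S (D%:R ^+ 2). Proof. by split; [exact: sqr_ge0 | exact: adj_bound_D]. Qed.
Let S_lb : has_lbound S. Proof. by exists 0 => k []. Qed.

Lemma norm_sqr_ge0 : 0 <= K.
Proof. by apply: lb_le_inf; [exists (D%:R ^+ 2) | move=> k []]. Qed.

Lemma adj_bound_norm : adj_bound K.
Proof.
move=> s y us ys s' us'; set q := \sum_(v <- s) _.
have q0 : 0 <= q by rewrite sumr_ge0 // => v _; exact: sqr_ge0.
have [q1|q1] := eqVneq q 0.
  by have := adj_bound_D us ys us'; rewrite -/q q1 !mulr0.
have qp : 0 < q by rewrite lt_def q1.
rewrite -ler_pdivrMr //; apply: lb_le_inf; first by exists (D%:R ^+ 2).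
by move=> k [k0 hk]; rewrite ler_pdivrMr //; exact: hk.
Qed.

Lemma supportedB s y w a : supported s y -> supported s w ->
  supported s (fun v => y v + a * w v).
Proof. by move=> ys ws v vs; rewrite ys // ws // mulr0 addr0. Qed.

(** A bounded inverse makes [A - m] bounded below. For [y] supported in [s] its image is supported
    in [nbh s], so finite sums express both norms. *)
Lemma resolvent_lower_bound (m : R) : l2_resolvent A m%:C ->
  exists2 c, 0 <= c & forall s y, uniq s -> supported s y ->
    \sum_(v <- s) y v ^+ 2 <= c * \sum_(v <- nbh s) (radj y v - m * y v) ^+ 2.
Proof.
move=> [B [[Bl2 _ [c hc]] hB]]; exists (c ^+ 2); first exact: sqr_ge0.
move=> s y us ys; pose g v := radj y v + (- m) * y v.
have gs : supported (nbh s) g.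
  apply: supportedB; first exact: supported_radj.
  by move=> v vN; apply: ys; apply: contraNN vN => /sub_nbh.
have un : uniq (nbh s) by exact: undup_uniq.
have -> : \sum_(v <- nbh s) (radj y v - m * y v) ^+ 2 = \sum_(v <- nbh s) g v ^+ 2.
  by apply: eq_bigr => v _; rewrite /g mulNr.
rewrite -(l2norm_supported us ys) -(l2norm_supported un gs) -exprMn.
have yl : l2 (fun v => (y v)%:C) by apply/l2P; eexists; exact: l2_bound_supported us ys.
have gl : l2 (fun v => (g v)%:C) by apply/l2P; eexists; exact: l2_bound_supported un gs.
have := hc _ gl; have [E _] := hB _ yl.
have -> : (fun v => (g v)%:C) = (fun v => A (fun v => (y v)%:C) v - m%:C * (y v)%:C).
  by apply/funext => v; rewrite adjacency_real /g rmorphD rmorphM rmorphN /= mulNr.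
rewrite E => h; rewrite lerXn2r ?nnegrE ?sqrtr_ge0 //.
exact: le_trans (sqrtr_ge0 _) h.
Qed.

(* [norm^2 - adj^2] is not bounded below, as vectors almost reaching the norm show,
   and it factors as [(norm - adj) (norm + adj)]. *)
Lemma norm_in_spectrum :
  l2_spectrum A (Num.sqrt K)%:C \/ l2_spectrum A (- Num.sqrt K)%:C.
Proof.
set M := Num.sqrt K; have M2 : M ^+ 2 = K by rewrite sqr_sqrtr // norm_sqr_ge0.
apply: contrapT => /not_orP[/contrapT r1 /contrapT r2].
have [c1 c10 h1] := resolvent_lower_bound r1.
have [c2 c20 h2] := resolvent_lower_bound r2.
pose c := c1 * c2 + 1.
have c0 : 0 < c by rewrite ltr_wpDl ?mulr_ge0.
have K0 := norm_sqr_ge0.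
(* Expand [|(A^2 - K) y|^2] as [|A^2 y|^2 - 2 K |A y|^2 + K^2 |y|^2]. Since
   [|A^2 y|^2 <= K |A y|^2], this is at most [K (K |y|^2 - |A y|^2)]. *)
have key s y : uniq s -> supported s y -> forall s', uniq s' ->
    \sum_(v <- s) y v ^+ 2 <= c * (K * (K * \sum_(v <- s) y v ^+ 2 - \sum_(v <- s') radj y v ^+ 2)).
  move=> us ys s' us'.
  have un r : uniq (nbh r) by exact: undup_uniq.
  pose s1 := nbh s; pose s2 := nbh s1.
  have ys1 : supported s1 y by move=> v vN; apply: ys; apply: contraNN vN => /sub_nbh.
  have Ay1 : supported s1 (radj y) by exact: supported_radj.
  have ys2 : supported s2 y by move=> v vN; apply: ys1; apply: contraNN vN => /sub_nbh.
  have Ay2 : supported s2 (radj y) by move=> v vN; apply: Ay1; apply: contraNN vN => /sub_nbh.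
  pose g v := radj y v + (- M) * y v.
  have gs1 : supported s1 g by exact: supportedB.
  have hy := h1 s y us ys; have hg := h2 s1 g (un _) gs1.
  have E1 v : radj g v - - M * g v = radj (radj y) v - K * y v.
    by rewrite {1}/radj big_split /= -mulr_sumr -/(radj _ _) -/(radj _ _) /g -M2; ring.
  rewrite (eq_bigr _ (fun v _ => congr1 (fun x => x ^+ 2) (E1 v))) in hg.
  have E2 : \sum_(v <- s2) (radj (radj y) v - K * y v) ^+ 2 =
     \sum_(v <- s2) radj (radj y) v ^+ 2 - 2 * K * \sum_(v <- s2) radj y v ^+ 2
       + K ^+ 2 * \sum_(v <- s2) y v ^+ 2.
    have -> : \sum_(v <- s2) radj y v ^+ 2 = \sum_(v <- s2) radj (radj y) v * y v.
      by rewrite [RHS](radj_symmetric (un s1) Ay2 ys2).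
    rewrite !mulr_sumr -sumrB -big_split /=; apply: eq_bigr => v _; ring.
  rewrite -/s2 E2 in hg.
  have e2 : \sum_(v <- s2) y v ^+ 2 = \sum_(v <- s) y v ^+ 2.
    apply: (@sum_widen (fun v => y v ^+ 2) s s2 us (un _)) => v.
      by move=> vs; apply/sub_nbh/sub_nbh.
    by move=> /ys ->; rewrite expr0n.
  have e1 : \sum_(v <- s2) radj y v ^+ 2 = \sum_(v <- s1) radj y v ^+ 2.
    apply: (@sum_widen (fun v => radj y v ^+ 2) s1 s2 (un _) (un _)) => v.
      exact: sub_nbh.
    by move=> /Ay1 ->; rewrite expr0n.
  have b1 := adj_bound_norm (un _) Ay1 (un s1).
  have b2 : \sum_(v <- s') radj y v ^+ 2 <= \sum_(v <- s1) radj y v ^+ 2.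
    rewrite -(@sum_widen (fun v => radj y v ^+ 2) s1 (undup (s1 ++ s'))) ?undup_uniq //.
    - apply: sum_le_sub; rewrite ?undup_uniq // => v.
        by rewrite mem_undup mem_cat => ->; rewrite orbT.
      exact: sqr_ge0.
    - by move=> v vs; rewrite mem_undup mem_cat vs.
    - by move=> v /Ay1 ->; rewrite expr0n.
  rewrite -/s2 in b1; rewrite e1 e2 in hg.
  have E3 : \sum_(v <- s1) (radj y v - M * y v) ^+ 2 = \sum_(v <- s1) g v ^+ 2.
    by apply: eq_bigr => v _; rewrite /g mulNr.
  rewrite -/s1 E3 in hy.
  move: hy hg b1 b2; set q := \sum_(v <- s) _; set p := \sum_(v <- s1) g v ^+ 2.
  set a := \sum_(v <- s1) _; set b := \sum_(v <- s2) _; set a' := \sum_(v <- s') _.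
  move=> hy hg b1 b2.
  have h : c1 * p <= c1 * (c2 * (b - 2 * K * a + K ^+ 2 * q)) by rewrite ler_wpM2l.
  have le1 : b - 2 * K * a + K ^+ 2 * q <= K * (K * q - a') by nra.
  have q0 : 0 <= q by rewrite sumr_ge0 // => v _; exact: sqr_ge0.
  have a'q : a' <= K * q by exact: (adj_bound_norm us ys us').
  have x0 : 0 <= K * (K * q - a') by rewrite mulr_ge0 // subr_ge0.
  have le2 : c1 * c2 * (b - 2 * K * a + K ^+ 2 * q) <= c1 * c2 * (K * (K * q - a')).
    by rewrite ler_wpM2l // mulr_ge0.
  by rewrite /c; move: x0 le2 h hy; rewrite mulrA; move: (K * (K * q - a')) => X; lra.
(* For [K = 0] the bound [key] fails at the indicator of [t0]. *)
have [K1|K1] := eqVneq K 0.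
  have := @key [:: t0] (fun v => (v == t0)%:R) isT _ [::] isT.
  rewrite !big_seq1 eqxx big_nil K1 mul0r mulr0 expr1n => /(_ _).
  have H : supported [:: t0] (fun v => (v == t0)%:R) by move=> v; rewrite inE => /negbTE ->.
  by move=> /(_ H); rewrite ler10.
have Kp : 0 < K by rewrite lt_def K1.
(* Rearranged, [key] says that [K - (c K)^-1] still bounds the squared norm, against [K] being the
   infimum. *)
pose k := Num.max 0 (K - (c * K)^-1).
have : S k.
  split; first by rewrite le_max lexx.
  move=> s y us ys s' us'; have := key s y us ys s' us'.
  set q := \sum_(v <- s) _; set a := \sum_(v <- s') _ => hk.
  have q0 : 0 <= q by rewrite sumr_ge0 // => v _; exact: sqr_ge0.
  apply: (@le_trans _ _ ((K - (c * K)^-1) * q)); last by rewrite ler_wpM2r // le_max lexx orbT.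
  have cK : 0 < c * K by rewrite mulr_gt0.
  rewrite mulrA -ler_pdivrMl // in hk; rewrite mulrBl; lra.
move=> /(ge_inf S_lb); rewrite -/K le_max leNgt Kp /= leNgt => /negP; apply.
by rewrite ltrBlDr ltrDl invr_gt0 mulr_gt0.
Qed.

Lemma spectral_radius_bound : 0 <= l2_spectral_radius A /\
  forall k, l2_spectral_radius A <= k -> adj_bound (k ^+ 2).
Proof.
have ub : has_ubound [set Normc.normc z | z in l2_spectrum A]%classic.
  exists (4 * D%:R ^+ 2 + 4) => _ [z hz <-]; rewrite leNgt; apply/negP => h; apply: hz.
  apply: resolvent_large; rewrite -normc_sqr.
  have d0 : 0 <= D%:R ^+ 2 :> R by exact: sqr_ge0.
  by move: (Normc.normc z) h => x h; nra.
have Kr : Num.sqrt K <= l2_spectral_radius A.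
  have nE (x : R) : Normc.normc x%:C = `|x| by rewrite /Normc.normc /= expr0n addr0 sqrtr_sqr.
  have aM : `|Num.sqrt K| = Num.sqrt K by rewrite ger0_norm // sqrtr_ge0.
  case: norm_in_spectrum => h; apply: (ub_le_sup ub).
    by exists (Num.sqrt K)%:C => //; rewrite nE.
  by exists (- Num.sqrt K)%:C => //; rewrite nE normrN.
split; first exact: le_trans (sqrtr_ge0 _) Kr.
move=> k hk s y us ys s' us'; apply: le_trans (adj_bound_norm us ys us') _.
rewrite ler_wpM2r ?sumr_ge0 // => [v _|]; first exact: sqr_ge0.
rewrite -[leLHS]sqr_sqrtr ?norm_sqr_ge0 // lerXn2r ?nnegrE ?sqrtr_ge0 //.
  exact: le_trans (sqrtr_ge0 _) (le_trans Kr hk).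
exact: le_trans Kr hk.
Qed.

(** Truncate to [s]: the finite matrix [x - A] is invertible because [x] exceeds the norm, and [h]
    is its solution with right-hand side 1, extended by zero. Nonnegativity comes from testing the
    equation against the negative part of [h]. *)
Lemma finite_supersolution x s : l2_spectral_radius A < x -> uniq s ->
  exists h : T -> R, [/\ forall v, 0 <= h v &
    forall v, v \in s -> x * h v = 1 + radj h v].
Proof.
move=> rx us; have [r0 rb] := spectral_radius_bound.
set r := l2_spectral_radius A in rx r0 rb.
(* The midpoint is positive even if [r = 0], so it can be divided by, and it lies strictly below
   [x]. *)
pose x0 := (r + x) / 2.
have x0r : r <= x0 by rewrite /x0; lra.
have x0x : x0 < x by rewrite /x0; lra.
have x0p : 0 < x0 by rewrite /x0; lra.
have bnd := rb _ x0r.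
pose n := size s; pose e (i : 'I_n) := nth t0 s i.
have es i : e i \in s by rewrite mem_nth.
have einj i j : (e i == e j) = (i == j) by rewrite nth_uniq.
pose ext (y : 'I_n -> R) v := \sum_i (v == e i)%:R * y i.
have ext_e (y : 'I_n -> R) i : ext y (e i) = y i.
  rewrite /ext (bigD1 i) //= eqxx mul1r big1 ?addr0 // => j ji.
  by rewrite einj eq_sym (negbTE ji) mul0r.
have ext_s (y : 'I_n -> R) : supported s (ext y).
  move=> v vs; rewrite /ext big1 // => i _; case: eqP => [E|]; last by rewrite mul0r.
  by rewrite E es in vs.
have sumE (F : T -> R) : \sum_(v <- s) F v = \sum_i F (e i).
  by rewrite (big_nth t0) big_mkord.
pose L : 'M[R]_n := x%:M - \matrix_(i, j) (adj (e i) (e j))%:R.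
have Lmul (y : 'cV_n) i : (L *m y) i 0 = x * y i 0 - radj (ext (fun j => y j 0)) (e i).
  rewrite mulmxBl mul_scalar_mx !mxE; congr (_ - _).
  rewrite (radj_supported _ us (ext_s _)) sumE; apply: eq_bigr => j _.
  by rewrite mxE ext_e.
have L_unit : L \in unitmx.
  rewrite -unitmx_tr unitmxE unitfE; apply/det0P => -[y y0 /(congr1 trmx)].
  rewrite trmx_mul trmxK trmx0 => Ly; move/negP: y0; apply; apply/eqP.
  have Ey i : radj (ext (fun j => y^T j 0)) (e i) = x * y^T i 0.
    by have := Lmul y^T i; rewrite Ly mxE => /esym/eqP; rewrite subr_eq0 => /eqP ->.
  have := bnd s _ us (ext_s (fun j => y^T j 0)) s us.
  rewrite !sumE; under eq_bigr do rewrite Ey exprMn; rewrite -mulr_sumr.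
  under [X in _ <= _ * X]eq_bigr do rewrite ext_e; set q := \sum_i _ => h.
  have q0 : q <= 0.
    have : (x ^+ 2 - x0 ^+ 2) * q <= 0 by rewrite mulrBl subr_le0.
    by rewrite pmulr_rle0 // subr_gt0 ltrXn2r ?nnegrE // ltW // (lt_trans x0p).
  apply/rowP => i; rewrite [RHS]mxE; apply/eqP; rewrite -sqrf_eq0 eq_le sqr_ge0 andbT.
  apply: le_trans q0; rewrite /q (bigD1 i) //= mxE lerDl sumr_ge0 // => j _; exact: sqr_ge0.
pose y := invmx L *m const_mx 1 : 'cV_n; pose h := ext (fun j => y j 0).
have hE v : v \in s -> x * h v = 1 + radj h v.
  move=> vs; have iv : (index v s < n)%N by rewrite index_mem.
  have -> : v = e (Ordinal iv) by rewrite /e /= nth_index.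
  have := Lmul y (Ordinal iv); rewrite mulKVmx // mxE -/h => E.
  by rewrite /h ext_e -/h; move/eqP: E; rewrite eq_sym subr_eq => /eqP.
exists h; split => //.
have hs : supported s h by exact: ext_s.
(* Multiplying the equation for [h] by its negative part [g] and summing gives
   [x |g|^2 <= <A g, g>]. The weighted inequality [s2] and the norm bound give
   [<A g, g> <= x0 |g|^2], which forces [g = 0]. *)
pose g v := Num.max 0 (- h v); pose p v := Num.max 0 (h v).
have hpg v : h v = p v - g v.
  by rewrite /p /g; case: (lerP 0 (h v)) => h0; case: (lerP 0 (- h v)) => h1; lra.
have g0 v : 0 <= g v by rewrite le_max lexx.
have p0 v : 0 <= p v by rewrite le_max lexx.
have hg v : h v * g v = - g v ^+ 2.
  by rewrite /g; case: (lerP 0 (- h v)) => h0; rewrite ?mulr0 ?expr0n ?oppr0 //; ring.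
have gs : supported s g by move=> v /hs hv; rewrite /g hv oppr0 maxxx.
have s1 v : v \in s -> x * g v ^+ 2 <= radj g v * g v.
  move=> vs; have := congr1 (fun z => z * g v) (hE v vs).
  rewrite /= -mulrA hg mulrDl mul1r.
  have -> : radj h v = radj p v - radj g v.
    by rewrite /radj -sumrB; apply: eq_bigr => u _; exact: hpg.
  have : 0 <= radj p v * g v by rewrite mulr_ge0 // sumr_ge0.
  by have := g0 v; nra.
have s2 v : radj g v * g v <= (2 * x0)^-1 * radj g v ^+ 2 + x0 / 2 * g v ^+ 2.
  have -> : (2 * x0)^-1 * radj g v ^+ 2 + x0 / 2 * g v ^+ 2 =
    radj g v * g v + (radj g v - x0 * g v) ^+ 2 / (2 * x0) by field; exact: lt0r_neq0.
  by rewrite lerDl divr_ge0 ?sqr_ge0 // mulr_ge0 // ltW.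
have : x * \sum_(v <- s) g v ^+ 2 <=
    (2 * x0)^-1 * \sum_(v <- s) radj g v ^+ 2 + x0 / 2 * \sum_(v <- s) g v ^+ 2.
  rewrite !mulr_sumr -big_split /= big_seq [leRHS]big_seq; apply: ler_sum => v vs.
  exact: le_trans (s1 v vs) (s2 v).
have b := bnd s g us gs s us; set q := \sum_(v <- s) g v ^+ 2 in b *.
set a := \sum_(v <- s) radj g v ^+ 2 in b * => le.
have q0 : 0 <= q by rewrite sumr_ge0 // => v _; exact: sqr_ge0.
have le2 : (2 * x0)^-1 * a <= x0 / 2 * q.
  have x20 : 0 < 2 * x0 by rewrite mulr_gt0.
  rewrite ler_pdivrMl //; apply: le_trans b _.
  by rewrite le_eqVlt; apply/orP; left; apply/eqP; field.
have {}q0 : q <= 0 by nra.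
move=> v; rewrite hpg; have [vs|vs] := boolP (v \in s); last by rewrite (gs v vs) subr0.
suff -> : g v = 0 by rewrite subr0.
apply/eqP; rewrite -sqrf_eq0 eq_le sqr_ge0 andbT; apply: le_trans q0.
by rewrite /q (big_rem v) //= lerDl sumr_ge0 // => u _; exact: sqr_ge0.
Qed.

End RealFunctions.

End BoundedDegree.

(** * The universal covering tree *)

Section UniversalCover.
Variables (G : multigraph) (v0 : vertex G).
Local Notation oe := (oedge G).
Local Notation nbw := (nonbacktracking_walk v0).
Implicit Types (w : seq oe) (o : oe).

Lemma oedge_oppK : involutive (@oedge_opp G).
Proof. by case=> e c; rewrite /oedge_opp /= negbK. Qed.

Lemma edge_tail_opp o : edge_tail (oedge_opp o) = edge_head o.
Proof. by case: o => e []. Qed.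

Definition walk_end w := if w is e :: w' then edge_head (last e w') else v0.
Definition last_edge w := if w is e :: w' then Some (last e w') else None.

(* One step along [o] in the covering tree: a step back deletes the last edge. *)
Definition walk_step w o :=
  if last_edge w == Some (oedge_opp o) then take (size w).-1 w else rcons w o.

Lemma walk_end_rcons w o : walk_end (rcons w o) = edge_head o.
Proof. by case: w => //= e w; rewrite last_rcons. Qed.

Lemma last_edge_rcons w o : last_edge (rcons w o) = Some o.
Proof. by case: w => //= e w; rewrite last_rcons. Qed.

Lemma nbw_rcons w o :
  nbw (rcons w o) = [&& nbw w, edge_tail o == walk_end w & last_edge w != Some (oedge_opp o)].
Proof.
case: w => [|e w] /=; first by rewrite !andbT.
rewrite rcons_path /= -andbA; congr (_ && (_ && (_ && _))).
rewrite (inj_eq Some_inj) -(inj_eq (inv_inj oedge_oppK) (last e w)) oedge_oppK.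
by rewrite eq_sym.
Qed.

Lemma take_rcons w o : take (size (rcons w o)).-1 (rcons w o) = w.
Proof. by rewrite size_rcons /= -cats1 take_size_cat. Qed.

Lemma walk_step_back w o : walk_step (rcons w (oedge_opp o)) o = w.
Proof. by rewrite /walk_step last_edge_rcons eqxx take_rcons. Qed.

Lemma last_edge_back w o : last_edge w = Some (oedge_opp o) ->
  exists w', w = rcons w' (oedge_opp o).
Proof.
by elim/last_ind: w => // w e _; rewrite last_edge_rcons => -[->]; exists w.
Qed.

Lemma walk_stepP w o : nbw w -> edge_tail o = walk_end w ->
  [/\ nbw (walk_step w o), walk_end (walk_step w o) = edge_head o,
      walk_step (walk_step w o) (oedge_opp o) = w
    & (size (walk_step w o) <= (size w).+1)%N].
Proof.
move=> ww ow; case: (eqVneq (last_edge w) (Some (oedge_opp o))) => [/last_edge_back[w' E]|h].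
  rewrite E walk_step_back; move: ww; rewrite E nbw_rcons => /and3P[h1 /eqP h2 h3].
  split => //; first by rewrite -h2 edge_tail_opp.
    by rewrite /walk_step (negbTE h3).
  by rewrite size_rcons ltnW.
rewrite {1 2 4}/walk_step (negbTE h); split.
- by rewrite nbw_rcons ww ow eqxx.
- exact: walk_end_rcons.
- by rewrite /walk_step last_edge_rcons oedge_oppK eqxx take_rcons.
- by rewrite /walk_step (negbTE h) size_rcons.
Qed.

Lemma walk_step_inj w o o' : walk_step w o = walk_step w o' -> o = o'.
Proof.
rewrite /walk_step; case: eqP => [E|_]; case: eqP => [E'|_].
- move=> _; rewrite E in E'; apply: (inv_inj oedge_oppK); exact: Some_inj E'.
- move=> /(congr1 size); have [w' ->] := last_edge_back E.
  by rewrite take_rcons !size_rcons => h; have := ltnn (size w'); rewrite {2}h ltnS leqnSn.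
- move=> /(congr1 size); have [w' ->] := last_edge_back E'.
  by rewrite take_rcons !size_rcons => h; have := ltnn (size w'); rewrite -{2}h ltnS leqnSn.
- by move=> /rcons_inj[].
Qed.

Local Notation T := (cover_vertex v0).

Definition cover_end (x : T) := walk_end (val x).
(** If [o] does not start where [x] ends, the extended walk is not admissible and [insubd] returns
    [x] itself. *)
Definition cover_step (x : T) o : T := insubd x (walk_step (val x) o).

Lemma val_cover_step x o : edge_tail o = cover_end x ->
  val (cover_step x o) = walk_step (val x) o.
Proof.
by move=> ox; rewrite val_insubd; have [-> _ _ _] := walk_stepP (valP x) ox.
Qed.

Lemma cover_stepP x o : edge_tail o = cover_end x ->
  [/\ cover_end (cover_step x o) = edge_head o,
      cover_step (cover_step x o) (oedge_opp o) = x
    & (size (val (cover_step x o)) <= (size (val x)).+1)%N].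
Proof.
move=> ox; have [h1 h2 h3 h4] := walk_stepP (valP x) ox.
have E : cover_end (cover_step x o) = edge_head o by rewrite /cover_end val_cover_step.
split => //; last by rewrite val_cover_step.
by apply: val_inj; rewrite !val_cover_step ?E ?edge_tail_opp.
Qed.

Definition cover_nbs (x : T) : seq T :=
  [seq cover_step x o | o <- index_enum oe & edge_tail o == cover_end x].

Lemma cover_nbs_uniq x : uniq (cover_nbs x).
Proof.
rewrite map_inj_in_uniq ?filter_uniq ?index_enum_uniq // => o o'.
rewrite !mem_filter => /andP[/eqP ox _] /andP[/eqP o'x _] /(congr1 val).
by rewrite !val_cover_step // => /walk_step_inj.
Qed.

Lemma cover_nbsP (x y : T) : (x \in cover_nbs y) = cover_adj y x.
Proof.
apply/mapP/existsP => [[o]|[o]].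
  rewrite mem_filter => /andP[/eqP oy _] ->; rewrite val_cover_step //.
  case: (eqVneq (last_edge (val y)) (Some (oedge_opp o))) => [/last_edge_back[w' E]|h].
    by exists (oedge_opp o); rewrite E walk_step_back eqxx orbT.
  by exists o; rewrite /walk_step (negbTE h) eqxx.
case/orP => /eqP E.
  have := valP x; rewrite E nbw_rcons => /and3P[_ /eqP h2 h3].
  exists o; first by rewrite mem_filter /cover_end h2 eqxx mem_index_enum.
  by apply: val_inj; rewrite val_cover_step // /walk_step (negbTE h3).
have h : edge_tail (oedge_opp o) = cover_end y.
  by rewrite edge_tail_opp /cover_end E walk_end_rcons.
exists (oedge_opp o); first by rewrite mem_filter h eqxx mem_index_enum.
apply: val_inj; rewrite val_cover_step // E /walk_step last_edge_rcons oedge_oppK eqxx.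
by rewrite take_rcons.
Qed.

Lemma cover_adj_sym (x y : T) : cover_adj x y = cover_adj y x.
Proof. by apply: eq_existsb => o; rewrite orbC. Qed.

Lemma cover_nbs_size x : (size (cover_nbs x) <= #|{: oe}|)%N.
Proof.
rewrite size_map -(card_uniqP _) ?filter_uniq ?index_enum_uniq //; exact: max_card.
Qed.

Lemma sum_cover_nbs (R : realType) (h : T -> R) x :
  radj cover_nbs h x = \sum_(o | edge_tail o == cover_end x) h (cover_step x o).
Proof. by rewrite /radj big_map big_filter. Qed.

Lemma cover_ball n : exists2 s : seq T, uniq s & forall x : T, (size (val x) <= n)%N -> x \in s.
Proof.
exists (undup (pmap insub (flatten [seq [seq val t | t <- enum {: k.-tuple oe}] | k <- iota 0 n.+1]))).
  exact: undup_uniq.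
move=> x xn; rewrite mem_undup mem_pmap_sub; apply/flattenP.
exists [seq val t | t <- enum {: (size (val x)).-tuple oe}].
  by apply/mapP; exists (size (val x)) => //; rewrite mem_iota add0n ltnS.
by apply/mapP; exists (in_tuple (val x)) => //; rewrite mem_enum.
Qed.

Definition cover_root : T := exist (fun w => nbw w) [::] isT.

Lemma cover_end_onto u : graph_connected G -> exists x : T, cover_end x = u.
Proof.
move=> conn; have /connectP[p pp ->] := conn v0 u.
suff H v : (exists x : T, cover_end x = v) ->
    forall p, path [rel x y | [exists e : oe, (edge_tail e == x) && (edge_head e == y)]] v p ->
    exists x : T, cover_end x = last v p.
  by apply: H pp; exists cover_root.
move=> Hv q; elim: q v Hv => //= v' q IH v [x xv] /andP[/existsP[o /andP[/eqP ov /eqP ov']] pq].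
apply: IH pq; exists (cover_step x o); rewrite -ov'.
by have [] : _ := cover_stepP (etrans ov (esym xv)).
Qed.

Lemma cover_end_onto_bounded : graph_connected G ->
  exists n, forall u, exists2 x : T, cover_end x = u & (size (val x) <= n)%N.
Proof.
move=> conn; have H u := cid (cover_end_onto u conn).
exists (\sum_u size (val (sval (H u))))%N => u; exists (sval (H u)); first by case: (H u).
by rewrite (bigD1 u) //= leq_addr.
Qed.

(** * Lifting the covers given by permutations to the tree *)

Section DCover.
Variables (R : realType) (d N : nat).
Variables (vt : 'I_N -> vertex G) (cd : 'I_N -> 'I_d) (idx : vertex G -> 'I_d -> 'I_N).
Hypothesis vt_idx : forall u k, vt (idx u k) = u.
Hypothesis cd_idx : forall u k, cd (idx u k) = k.
Hypothesis idxK : forall i, idx (vt i) (cd i) = i.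
Hypothesis hloop : loopless G.
Hypothesis hconn : graph_connected G.
Variable sigma : edge G -> 'S_d.

Definition lift_src (f : edge G * 'I_d) := idx (src f.1) f.2.
Definition lift_dst (f : edge G * 'I_d) := idx (dst f.1) (sigma f.1 f.2).

Lemma lift_loopless f : lift_src f != lift_dst f.
Proof.
apply/eqP => /(congr1 vt); rewrite !vt_idx; exact: hloop.
Qed.

Local Notation dart := (dart (edge G * 'I_d)%type).
Local Notation dtl := (dtail lift_src lift_dst).
Local Notation dhd := (dhead lift_src lift_dst).

Definition dart_proj (p : dart) : oe := (p.1.1, p.2).

Lemma vt_dtail p : vt (dtl p) = edge_tail (dart_proj p).
Proof. by case: p => [[e k] []]; rewrite /dtail /= vt_idx. Qed.

Lemma vt_dhead p : vt (dhd p) = edge_head (dart_proj p).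
Proof. by case: p => [[e k] []]; rewrite /dhead /= vt_idx. Qed.

(** Unique lifting: each oriented edge leaving [vt i] has one lift leaving [i], found with the
    inverse permutation when the edge is traversed backwards. *)
Lemma sum_darts (F : oe -> R) i :
  \sum_(p | dtl p == i) F (dart_proj p) = \sum_(o | edge_tail o == vt i) F o.
Proof.
pose up (o : oe) : dart :=
  ((o.1, if o.2 then cd i else (sigma o.1)^-1%g (cd i)), o.2).
rewrite (reindex_onto up dart_proj) /=.
  apply: eq_big => [[e c]|[e c] _] //.
  rewrite /up /dart_proj /= eqxx andbT /dtail /lift_src /lift_dst /edge_tail /=.
  case: c; rewrite /= ?permKV; apply/eqP/eqP => [<-|->]; rewrite ?vt_idx ?idxK //.
move=> [[e k] c] /eqP; rewrite /dtail /lift_src /lift_dst /up /dart_proj /= => E.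
by congr ((_, _), _); case: c E => /= <-; rewrite cd_idx ?permK.
Qed.

(** The fibre product over [G] of the tree and the cover. A step moves both coordinates at once, and
    the supersolution is read on the tree coordinate alone. *)
Let W := {p : T * 'I_N | cover_end p.1 == vt p.2}.

Let ends (w : W) := (val w).2.
Let step (w : W) (p : dart) : W := insubd w (cover_step (val w).1 (dart_proj p), dhd p).

Let step_val (w : W) p : dtl p = ends w ->
  val (step w p) = (cover_step (val w).1 (dart_proj p), dhd p).
Proof.
move=> pw; rewrite val_insubd /= ifT // vt_dhead.
have ow : edge_tail (dart_proj p) = cover_end (val w).1.
  by rewrite -vt_dtail pw (eqP (valP w)).
by have [-> _ _] := cover_stepP ow.
Qed.

Theorem d_cover_sign_sum y : cover_spectral_radius R v0 < y ->
  exists2 c : R, 0 < c & forall x, y <= x -> c <= sign_sum lift_src lift_dst x finset.set0.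
Proof.
move=> ry; have [m mP] := cover_end_onto_bounded hconn.
(* Radius [m] reaches a lift of every vertex; the further [N] levels leave room for deleting the [N]
   vertices of the cover one after the other. *)
have [s us sP] := cover_ball (m + N).
have [h [h0 hs]] := finite_supersolution cover_adj_sym cover_nbsP cover_nbs_uniq
  cover_nbs_size cover_root ry us.
have ow (w : W) p : dtl p = ends w -> edge_tail (dart_proj p) = cover_end (val w).1.
  by move=> pw; rewrite -vt_dtail pw (eqP (valP w)).
refine (@sign_sum_lower_bound R N _ _ _ lift_loopless W ends step
  (fun w : W => size (val (val w).1)) (fun w : W => h (val w).1) (m + N)%N y _ _ _ _ _ _).
- by move=> w p pw; rewrite /ends step_val.
- move=> w p pw; apply: val_inj; rewrite step_val ?step_val //=; last first.
    by rewrite /ends step_val // /dtail /dhead /drev /=; case: p.2.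
  have [_ E _] := cover_stepP (ow _ _ pw).
  rewrite [RHS](surjective_pairing (sval w)); congr (_, _); first exact: E.
  by rewrite -/(ends w) -pw /dtail /dhead /drev /=; case: p.2.
- move=> w p; rewrite /step val_insubd; case: ifP => // /eqP E /=.
  have [op|op] := eqVneq (edge_tail (dart_proj p)) (cover_end (val w).1).
    by have [_ _] := cover_stepP op.
  rewrite /cover_step val_insubd; case: ifP => // _.
  rewrite /walk_step; case: ifP => _; last by rewrite size_rcons.
  by rewrite size_take_min; apply: leq_trans (geq_minr _ _) (leqnSn _).
- by move=> w; exact: h0.
- move=> w wn; rewrite hs; last exact: sP.
  rewrite sum_cover_nbs (eqP (valP w)) -sum_darts lerD2l; apply: ler_sum => p /eqP pw.
  by rewrite step_val.
move=> i; have [x xi xm] := mP (vt i).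
have wP : cover_end (x, i).1 == vt (x, i).2 by rewrite /= xi.
by exists (exist _ (x, i) wP) => //=; rewrite leq_add2r.
Qed.

End DCover.
End UniversalCover.

(** * Block matrices of coverings *)

Section BlockMatrices.
Variables (R : realType) (V : finType) (d N : nat).
Local Notation C := R[i].
Variables (vt : 'I_N -> V) (cd : 'I_N -> 'I_d) (idx : V -> 'I_d -> 'I_N).
Hypothesis vt_idx : forall u k, vt (idx u k) = u.
Hypothesis cd_idx : forall u k, cd (idx u k) = k.
Hypothesis idxK : forall i, idx (vt i) (cd i) = i.
Implicit Types (u v : V) (X Y : 'M[C]_d).

Definition incl u : 'M[C]_(N, d) := \matrix_(i, k) (i == idx u k)%:R.

Lemma idx_eq u v k l : (idx u k == idx v l) = (u == v) && (k == l).
Proof.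
apply/eqP/andP => [E|[/eqP -> /eqP ->] //]; split; apply/eqP.
  by rewrite -(vt_idx u k) E vt_idx.
by rewrite -(cd_idx u k) E cd_idx.
Qed.

Lemma incl_row p (A : 'M_(p, N)) u i k : (A *m incl u) i k = A i (idx u k).
Proof.
rewrite mxE (bigD1 (idx u k)) //= mxE eqxx mulr1 big1 ?addr0 // => j ju.
by rewrite mxE (negbTE ju) mulr0.
Qed.

Lemma incl_id u : (incl u)^T *m incl u = 1%:M.
Proof. by apply/matrixP => k l; rewrite incl_row !mxE idx_eq eqxx eq_sym. Qed.

Lemma incl_neq u v : u != v -> (incl u)^T *m incl v = 0.
Proof. by move=> uv; apply/matrixP => k l; rewrite incl_row !mxE idx_eq eq_sym (negbTE uv). Qed.

Lemma incl_mulE p u (A : 'M_(d, p)) i j :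
  (incl u *m A) i j = if vt i == u then A (cd i) j else 0.
Proof.
rewrite mxE; have [<-|iu] := eqVneq (vt i) u.
  rewrite (bigD1 (cd i)) //= mxE idxK eqxx mul1r big1 ?addr0 // => k ki.
  by rewrite mxE -{1}(idxK i) idx_eq eqxx eq_sym (negbTE ki) mul0r.
by rewrite big1 // => k _; rewrite mxE -{1}(idxK i) idx_eq (negbTE iu) mul0r.
Qed.

Lemma block_entry u v X i j :
  (incl u *m X *m (incl v)^T) i j =
  if (vt i == u) && (vt j == v) then X (cd i) (cd j) else 0.
Proof.
have -> : incl u *m X *m (incl v)^T = incl u *m (incl v *m X^T)^T.
  by rewrite trmx_mul trmxK mulmxA.
by rewrite incl_mulE mxE incl_mulE mxE; case: ifP.
Qed.

Lemma adj_incl u : adjmx (incl u) = (incl u)^T.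
Proof.
by apply/matrixP => k i; rewrite !mxE; case: eqP => _; rewrite ?conjc1 ?conjc0.
Qed.

Lemma adj_inclT u : adjmx (incl u)^T = incl u.
Proof. by rewrite -adj_incl adjmxK. Qed.

Lemma adjmx_sum m n (I : finType) (F : I -> 'M[C]_(m, n)) :
  adjmx (\sum_i F i) = \sum_i adjmx (F i).
Proof.
apply: (big_morph _ (@adjmxD R m n)).
by rewrite /adjmx map_mx0 trmx0.
Qed.

Lemma adjmxB m n (A B : 'M[C]_(m, n)) : adjmx (A - B) = adjmx A - adjmx B.
Proof. by apply/matrixP => i j; rewrite !mxE rmorphB. Qed.

Definition emb u X : 'M[C]_N := 1%:M + incl u *m (X - 1%:M) *m (incl u)^T.

Lemma emb1 u : emb u 1%:M = 1%:M.
Proof. by rewrite /emb subrr mulmx0 mul0mx addr0. Qed.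

Lemma emb_incl u X : emb u X *m incl u = incl u *m X.
Proof.
by rewrite mulmxDl mul1mx -!mulmxA incl_id mulmx1 mulmxBr mulmx1 addrC subrK.
Qed.

Lemma emb_incl_neq u v X : u != v -> emb u X *m incl v = incl v.
Proof. by move=> uv; rewrite mulmxDl mul1mx -!mulmxA incl_neq // !mulmx0 addr0. Qed.

Lemma incl_emb u X : (incl u)^T *m emb u X = X *m (incl u)^T.
Proof.
by rewrite mulmxDr mulmx1 !mulmxA incl_id mul1mx mulmxBl mul1mx addrC subrK.
Qed.

Lemma incl_emb_neq u v X : u != v -> (incl v)^T *m emb u X = (incl v)^T.
Proof.
by move=> uv; rewrite mulmxDr mulmx1 !mulmxA incl_neq 1?eq_sym // !mul0mx addr0.
Qed.

Lemma embM u X Y : emb u (X *m Y) = emb u X *m emb u Y.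
Proof.
rewrite {3}/emb mulmxDr mulmx1 !mulmxA emb_incl /emb -addrA; congr (_ + _).
rewrite -mulmxDl -(mulmxA (incl u) X) -mulmxDr; congr (_ *m _ *m _).
by rewrite mulmxBr mulmx1 [RHS]addrC addrA subrK.
Qed.

Definition edge_block u v X Y : 'M[C]_N :=
  incl u *m X *m (incl v)^T + incl v *m Y *m (incl u)^T.

(** The label of an edge can be concentrated at its source: conjugation there turns the unlabelled
    block into the labelled one. This brings coverings into the conjugated form of [labelled]. *)
Lemma emb_edge_block u v X Y : u != v ->
  emb u X *m edge_block u v 1%:M 1%:M *m emb u Y = edge_block u v X Y.
Proof.
move=> uv; rewrite /edge_block !mulmx1 mulmxDr mulmxDl !mulmxA emb_incl emb_incl_neq //.
by rewrite -!mulmxA incl_emb incl_emb_neq.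
Qed.

Section Form.
Variables (gT : finGroupType) (Gam : {group gT}) (pi : mx_representation C Gam d).
Local Notation sT := (subg_of Gam).
Definition rho (g : sT) := pi (sgval g).

Lemma rhoM (g h : sT) : rho (g * h)%g = rho g *m rho h.
Proof. by rewrite /rho repr_mxM ?subgP. Qed.

Lemma rho1 : rho 1%g = 1%:M.
Proof. by rewrite /rho repr_mx1. Qed.

Lemma rhoVM (g : sT) : rho g^-1%g *m rho g = 1%:M.
Proof. by rewrite -rhoM mulVg rho1. Qed.

(* [pi] need not be unitary: this form is the one for which it becomes so. *)
Definition inv_form : 'M[C]_d := \sum_(g : sT) rho g *m adjmx (rho g).

Lemma inv_form_adj : adjmx inv_form = inv_form.
Proof. by rewrite adjmx_sum; apply: eq_bigr => g _; rewrite adjmxM adjmxK. Qed.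

Lemma inv_form_rho (g : sT) : rho g *m inv_form *m adjmx (rho g) = inv_form.
Proof.
rewrite /inv_form mulmx_sumr mulmx_suml [RHS](reindex_inj (mulgI g)) /=.
by apply: eq_bigr => h _; rewrite rhoM adjmxM !mulmxA.
Qed.

Lemma inv_form_rhoV (g : sT) : rho g^-1%g *m inv_form = inv_form *m adjmx (rho g).
Proof. by rewrite -{1}(inv_form_rho g) !mulmxA rhoVM mul1mx. Qed.

Definition cover_form : 'M[C]_N := \sum_u incl u *m inv_form *m (incl u)^T.

Lemma cover_form_incl u : cover_form *m incl u = incl u *m inv_form.
Proof.
rewrite mulmx_suml (bigD1 u) //= -!mulmxA incl_id mulmx1 big1 ?addr0 // => v vu.
by rewrite -!mulmxA incl_neq // !mulmx0.
Qed.

Lemma incl_cover_form u : (incl u)^T *m cover_form = inv_form *m (incl u)^T.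
Proof.
rewrite mulmx_sumr (bigD1 u) //= !mulmxA incl_id mul1mx big1 ?addr0 // => v vu.
by rewrite !mulmxA incl_neq 1?eq_sym // !mul0mx.
Qed.

Lemma emb_cover_form u (g : sT) :
  emb u (rho g^-1%g) *m cover_form = cover_form *m adjmx (emb u (rho g)).
Proof.
rewrite /emb mulmxDl mul1mx adjmxD adjmx1 [RHS]mulmxDr mulmx1; congr (_ + _).
rewrite !adjmxM adj_incl adj_inclT -!mulmxA incl_cover_form !mulmxA.
rewrite cover_form_incl -!mulmxA; congr (_ *m _); rewrite !mulmxA; congr (_ *m _).
by rewrite mulmxBl mul1mx inv_form_rhoV adjmxB adjmx1 mulmxBr mulmx1.
Qed.

Lemma mulmx_adj_ge0 n (w : 'rV[C]_n) : 0 <= (w *m adjmx w) 0 0.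
Proof. by rewrite mxE sumr_ge0 // => k _; rewrite !mxE; exact: mulcJ_ge0. Qed.

Lemma mulmx_adj_eq0 n (w : 'rV[C]_n) : (w *m adjmx w) 0 0 = 0 -> w = 0.
Proof.
rewrite mxE => /psumr_eq0P h; apply/rowP => k; rewrite mxE.
have /eqP : w 0 k * (adjmx w) k 0 = 0.
  by apply: h => // l _; rewrite !mxE; exact: mulcJ_ge0.
by rewrite !mxE mulf_eq0 conjc_eq0 orbb => /eqP.
Qed.

Lemma cover_form_pos (v : 'rV[C]_N) : v != 0 -> 0 < (v *m cover_form *m adjmx v) 0 0.
Proof.
move=> v0.
have E : (v *m cover_form *m adjmx v) 0 0 =
   \sum_u \sum_(g : sT) (v *m incl u *m rho g *m adjmx (v *m incl u *m rho g)) 0 0.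
  rewrite /cover_form mulmx_sumr mulmx_suml summxE; apply: eq_bigr => u _.
  rewrite /inv_form !(mulmx_sumr, mulmx_suml) summxE; apply: eq_bigr => g _.
  by rewrite !adjmxM adj_incl !mulmxA.
have ge u : 0 <= \sum_(g : sT) (v *m incl u *m rho g *m adjmx (v *m incl u *m rho g)) 0 0.
  by apply: sumr_ge0 => g _; exact: mulmx_adj_ge0.
rewrite E lt_def sumr_ge0 ?andbT //; apply: contra v0 => /eqP /psumr_eq0P h.
apply/eqP/rowP => i; rewrite [RHS]mxE -(idxK i) -incl_row.
have /psumr_eq0P h' := h (fun u _ => ge u) (vt i) isT.
have := h' (fun g _ => mulmx_adj_ge0 _) 1%g isT => /mulmx_adj_eq0.
by rewrite rho1 mulmx1 => ->; rewrite mxE.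
Qed.

Lemma edge_block_real u v w : complex.Im (hform cover_form (edge_block u v 1%:M 1%:M) w) = 0.
Proof.
have [K KE] : {K | K = edge_block u v 1%:M 1%:M *m cover_form} by eexists.
have KA : adjmx K = K.
  rewrite KE /edge_block !mulmx1 mulmxDl -!mulmxA !incl_cover_form !mulmxA adjmxD.
  by rewrite !adjmxM !adj_incl !adj_inclT inv_form_adj !mulmxA addrC.
have : conjc (hform cover_form (edge_block u v 1%:M 1%:M) w) =
    hform cover_form (edge_block u v 1%:M 1%:M) w.
  have -> : hform cover_form (edge_block u v 1%:M 1%:M) w = (w *m K *m adjmx w) 0 0.
    by rewrite /hform KE !mulmxA.
  have -> : conjc ((w *m K *m adjmx w) 0 0) = adjmx (w *m K *m adjmx w) 0 0 by rewrite !mxE.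
  by rewrite adjmxM adjmxK adjmxM KA !mulmxA.
by case: (hform _ _ _) => a b [] /eqP; rewrite -subr_eq0 -opprD oppr_eq0 -mulr2n mulrn_eq0 => /eqP.
Qed.

Lemma rank1_factor (A : 'M[C]_d) : \rank A = 1%N ->
  exists (c : 'cV[C]_d) (r : 'rV[C]_d), A = c *m r.
Proof.
move=> rA; have := mulmx_base A; move: (col_base A) (row_base A); rewrite rA => c r <-.
by exists c, r.
Qed.

Lemma pow_scalar_unit (z : C) n : (0 < n)%N -> z ^+ n = 1 -> nsq z = 1.
Proof.
move=> n0 zn; have : nsq z ^+ n = 1.
  have -> : nsq z ^+ n = nsq (z ^+ n).
    elim: (n) => [|k IH]; first by rewrite !expr0 /nsq /= expr1n expr0n addr0.
    by rewrite !exprS nsqM IH.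
  by rewrite zn /nsq /= expr1n expr0n addr0.
by move/eqP; rewrite pexpr_eq1 // ?nsq_ge0 // => /eqP.
Qed.

(** With [rho g = 1 + c r] and [a = r c], the powers of [1 + a] are the eigenvalues of the powers of
    [rho g] at [c], so finite order gives [|1 + a| = 1]. It also excludes [a = 0]: then the [k]-th
    power would be [1 + k c r], never again 1 in characteristic 0. Dividing [r] by [a] gives the
    projection. *)
Lemma rank1_hreflection (u : V) (g : sT) : \rank (rho g - 1%:M) = 1%N ->
  hreflection cover_form (emb u (rho g)) (emb u (rho g^-1%g)).
Proof.
move=> rk; have [c [r cr]] := rank1_factor rk.
pose a := (r *m c) 0 0.
have cr0 : c *m r != 0 by rewrite -cr -mxrank_eq0 rk.
have ge : rho g = 1%:M + c *m r by rewrite -cr addrC subrK.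
have rcE : r *m c = a%:M by rewrite [LHS]mx11_scalar.
have pow k : rho (g ^+ k)%g *m c = (1 + a) ^+ k *: c.
  elim: k => [|k IH]; first by rewrite expg0 rho1 mul1mx expr0 scale1r.
  rewrite expgS rhoM -mulmxA IH -scalemxAr ge mulmxDl mul1mx -mulmxA rcE mul_mx_scalar.
  by rewrite -{1}[c]scale1r -scalerDl scalerA exprSr.
have c0 : c != 0 by apply: contraNneq cr0 => ->; rewrite mul0mx.
have an : (1 + a) ^+ #[g]%g = 1.
  have := pow #[g]%g; rewrite expg_order rho1 mul1mx => /eqP.
  rewrite -{1}[c]scale1r -subr_eq0 -scalerBl scaler_eq0 (negbTE c0) orbF subr_eq0.
  by move/eqP.
have a0 : a != 0.
  apply: contraNneq cr0 => az.
  have lin k : rho (g ^+ k)%g = 1%:M + k%:R *: (c *m r).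
    elim: k => [|k IH]; first by rewrite expg0 rho1 scale0r addr0.
    rewrite expgS rhoM IH ge mulmxDr mulmx1 mulmxDl mul1mx -!scalemxAr.
    rewrite mulmxA -(mulmxA c) rcE az mul_mx_scalar scale0r mul0mx scaler0 addr0.
    by rewrite -addrA -{1}(scale1r (c *m r)) -scalerDl mulrS.
  have := lin #[g]%g; rewrite expg_order rho1 -[X in X = _]addr0 => /addrI/esym/eqP.
  by rewrite scaler_eq0 pnatr_eq0 -[#[g]%g == _]negbK -lt0n order_gt0.
have za := pow_scalar_unit (order_gt0 g) an.
case E : (1 + a) => [x y].
have aE : a = (x +i* y) - 1 by rewrite -E addrC addKr.
have [r' r'E] : {r' | r' = a^-1 *: r} by eexists.
have r'c : r' *m c = 1%:M by rewrite r'E -scalemxAl rcE scale_scalar_mx mulVf.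
have cr' : c *m r = a *: (c *m r') by rewrite r'E -scalemxAr scalerA divff // scale1r.
(* [b] is the conjugate of [a]; [|1 + a| = 1] amounts to [a + b + a b = 0], which makes [1 + b c r']
   the inverse of [rho g]. *)
pose b := (x -i* y) - 1.
have xy : x ^+ 2 + y ^+ 2 = 1 by rewrite -za E.
have ab : a + b + a * b = 0.
  rewrite aE /b; apply/eqP; rewrite eq_complex /=; apply/andP; split; apply/eqP; nra.
have b0 : b != 0.
  apply: contraNneq a0 => bz; move: ab; rewrite bz mulr0 !addr0 => ->. exact: eqxx.
have gV : rho g^-1%g = 1%:M + b *: (c *m r').
  have PP : c *m r' *m (c *m r') = c *m r' by rewrite mulmxA -(mulmxA c) r'c mulmx1.
  have E2 : rho g *m (1%:M + b *: (c *m r')) = 1%:M.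
    rewrite ge cr' mulmxDr mulmx1 mulmxDl mul1mx -scalemxAr -scalemxAl PP scalerA.
    by rewrite -!addrA -!scalerDl addrA (mulrC b) ab scale0r addr0.
  transitivity (rho g^-1%g *m (rho g *m (1%:M + b *: (c *m r')))).
    by rewrite E2 mulmx1.
  by rewrite mulmxA rhoVM mul1mx.
have embE t : emb u (1%:M + t *: (c *m r')) =
    1%:M + t *: ((incl u *m c) *m (r' *m (incl u)^T)).
  rewrite /emb (addrC 1%:M (t *: (c *m r'))) addrK -scalemxAr -scalemxAl; congr (_ + _ *: _).
  by rewrite !mulmxA.
exists (incl u *m c), (r' *m (incl u)^T), x, y; split.
- by rewrite mulmxA -(mulmxA r') incl_id mulmx1.
- have := emb_cover_form u g; rewrite gV ge cr' !embE.
  set P := incl u *m c *m (r' *m (incl u)^T).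
  rewrite mulmxDl mul1mx adjmxD adjmx1 mulmxDr mulmx1 adjmxZ -scalemxAl -scalemxAr.
  move=> /addrI h; apply: (scalerI b0); rewrite h; congr (_ *: _).
  by rewrite aE /b; apply/eqP; rewrite eq_complex /=; apply/andP; split; apply/eqP; ring.
- exact: xy.
- by rewrite ge cr' embE aE.
- by rewrite gV embE.
Qed.

End Form.
End BlockMatrices.

(** The hypothesis concerns only the image of [pi]. The bound [<= 1] on the rank puts the kernel of
    [pi] in the generating set, so that lifts of the reflections generate the group itself. *)
Lemma reflections_generate (R : realType) (gT : finGroupType) (Gam : {group gT}) d
    (pi : mx_representation R[i] Gam d) :
  image_gen_by_pseudo_reflections pi ->
  <<[set g : subg_of Gam | (\rank (rho pi g - 1%:M)%R <= 1)%N]>>%g = [set: subg_of Gam]%SET.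
Proof.
move=> [S0 [S0r S0g]]; set K := <<_>>%g.
have gen A : gen_GL S0 A -> exists2 k, k \in K & A = rho pi k.
  elim=> {A} [A SA||A B _ [k kK ->] _ [l lK ->]|A _ [k kK ->]].
  - have /S0g [x xG Ax] : gen_GL S0 A by exact: gen_GL_in.
    exists (subg Gam x); last by rewrite Ax /rho subgK.
    by apply: mem_gen; rewrite inE /rho subgK // -Ax; case: (S0r _ SA) => _ _ ->.
  - by exists 1%g; rewrite ?group1 ?rho1.
  - by exists (k * l)%g; rewrite ?groupM ?rhoM.
  - by exists k^-1%g; rewrite ?groupV // /rho repr_mxV ?subgP.
apply/eqP; rewrite finset.eqEsubset finset.subsetT /=; apply/fintype.subsetP => g _.
have /S0g/gen [k kK E] : exists2 x, x \in Gam & rho pi g = pi x.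
  by exists (sgval g); rewrite ?subgP.
have gk : (g * k^-1)%g \in K.
  by apply: mem_gen; rewrite inE rhoM E -rhoM mulgV rho1 subrr mxrank0.
by rewrite -(mulgKV k g) groupM.
Qed.

Section CoverIndex.
Variables (V : finType) (d : nat).
Local Notation N := (\sum_(i < #|V|) d)%N.

Definition cover_vtx (i : 'I_N) : V := enum_val (tagnat.sig1 i).
Definition cover_coord (i : 'I_N) : 'I_d := tagnat.sig2 i.
Definition cover_idx (u : V) (k : 'I_d) : 'I_N :=
  @tagnat.Rank #|V| (fun=> d) (enum_rank u) k.

Lemma cover_vtx_idx u k : cover_vtx (cover_idx u k) = u.
Proof. by rewrite /cover_vtx tagnat.Rank1K enum_rankK. Qed.

Lemma cover_coord_idx u k : cover_coord (cover_idx u k) = k.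
Proof. by apply: val_inj; rewrite /cover_coord tagnat.Rank2K. Qed.

Lemma cover_idxK i : cover_idx (cover_vtx i) (cover_coord i) = i.
Proof. by rewrite /cover_idx enum_valK tagnat.sig2K. Qed.

End CoverIndex.

Section SignedPermutations.
Variables (R : realType) (V : finType) (d N : nat).
Variables (vt : 'I_N -> V) (cd : 'I_N -> 'I_d) (idx : V -> 'I_d -> 'I_N).
Hypothesis vt_idx : forall u k, vt (idx u k) = u.
Hypothesis cd_idx : forall u k, cd (idx u k) = k.
Hypothesis idxK : forall i, idx (vt i) (cd i) = i.

Lemma sp_mxE (w : signed_perm d) k l :
  sp_mx R[i] w k l = (-1) ^+ w.2 k * (w.1 k == l)%:R.
Proof. by rewrite /sp_mx /sign_mx mul_diag_mx !mxE. Qed.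

Lemma sp_invE (w : signed_perm d) k l :
  sp_inv R[i] w k l = (-1) ^+ w.2 l * (w.1 l == k)%:R.
Proof.
by rewrite /sp_inv /sign_mx mul_mx_diag !mxE mulrC (canF_eq (permKV w.1)) eq_sym.
Qed.

(** The bridge to signed graphs: a signed permutation on one edge of the base amounts to [d] signed
    edges of its cover. *)
Lemma edge_block_signed u v (w : signed_perm d) :
  edge_block idx u v (sp_mx R[i] w) (sp_inv R[i] w) =
  \sum_k (-1) ^+ w.2 k *: (delta_mx (idx u k) (idx v (w.1 k)) +
                           delta_mx (idx v (w.1 k)) (idx u k)).
Proof.
apply/matrixP => i j; rewrite mxE !(block_entry vt_idx cd_idx idxK) summxE.
have E k : ((-1) ^+ w.2 k *: (delta_mx (idx u k) (idx v (w.1 k)) +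
      delta_mx (idx v (w.1 k)) (idx u k)) : 'M[R[i]]_N) i j =
    (-1) ^+ w.2 k * (((vt i == u) && (cd i == k)) && ((vt j == v) && (cd j == w.1 k)))%:R +
    (-1) ^+ w.2 k * (((vt i == v) && (cd i == w.1 k)) && ((vt j == u) && (cd j == k)))%:R.
  by rewrite !mxE mulrDr -!(idx_eq vt_idx cd_idx) !idxK.
rewrite (eq_bigr _ (fun k _ => E k)) big_split /= sp_mxE sp_invE; congr (_ + _).
  case: (vt i == u) (vt j == v) => [] [] /=; last 3 first.
  - by rewrite big1 // => k _; rewrite andbF mulr0.
  - by rewrite big1 // => k _; rewrite mulr0.
  - by rewrite big1 // => k _; rewrite mulr0.
  rewrite (bigD1 (cd i)) //= eqxx /= big1 ?addr0 => [|k ki]; first by rewrite eq_sym.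
  by rewrite [cd i == k]eq_sym (negbTE ki) mulr0.
case: (vt i == v) (vt j == u) => [] [] /=; last 3 first.
- by rewrite big1 // => k _; rewrite andbF mulr0.
- by rewrite big1 // => k _; rewrite mulr0.
- by rewrite big1 // => k _; rewrite mulr0.
rewrite (bigD1 (cd j)) //= eqxx /= big1 ?addr0 => [|k ki].
  by rewrite andbT eq_sym.
by rewrite [cd j == k]eq_sym (negbTE ki) andbF mulr0.
Qed.

End SignedPermutations.

(** * Coverings of the graph: from the average to a single labeling *)

Section Assembly.
Variables (R : realType) (gT : finGroupType) (Gam : {group gT}) (d : nat).
Variable pi : mx_representation R[i] Gam d.
Hypothesis hext : ext_powers_irr_noniso pi.
Hypothesis hrefl : image_gen_by_pseudo_reflections pi.
Variables (G : multigraph) (v0 : vertex G).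
Hypotheses (hloop : loopless G) (hconn : graph_connected G).
Local Notation sT := (subg_of Gam).
Local Notation idx := (@cover_idx (vertex G) d).
Local Notation vt_idx := (@cover_vtx_idx (vertex G) d).
Local Notation cd_idx := (@cover_coord_idx (vertex G) d).
Local Notation idxK := (@cover_idxK (vertex G) d).
Local Notation spectral_radius := (cover_spectral_radius R v0).

Definition edge_rep (e : edge G) (g : sT) := emb idx (src e) (rho pi g).
Definition plain_block (e : edge G) := edge_block idx (src e) (dst e) 1%:M (1%:M : 'M[R[i]]_d).
Local Notation form := (cover_form idx pi).
Local Notation char_label := (label_poly edge_rep plain_block).

Let form_pos := cover_form_pos idxK pi.
Let edge_repM e (g h : sT) : edge_rep e (g * h)%g = edge_rep e g *m edge_rep e h.
Proof. by rewrite /edge_rep rhoM (embM vt_idx cd_idx). Qed.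
Let edge_repH e (g : sT) : edge_rep e g^-1%g *m form = form *m adjmx (edge_rep e g).
Proof. exact: (emb_cover_form vt_idx cd_idx). Qed.
Let plain_block_real e v : complex.Im (hform form (plain_block e) v) = 0.
Proof. exact: (edge_block_real vt_idx cd_idx). Qed.

Lemma labelled_blocks (g : {ffun edge G -> sT}) :
  labelled edge_rep plain_block g =
  \sum_e edge_block idx (src e) (dst e) (rho pi (g e)) (rho pi (g e)^-1%g).
Proof.
apply: eq_bigr => e _; rewrite /plain_block.
have uv : src e != dst e by apply/eqP/hloop.
exact: (emb_edge_block vt_idx cd_idx).
Qed.

Definition label_of (g : {ffun edge G -> sT}) (o : oedge G) : gT :=
  if o.2 then sgval (g o.1) else (sgval (g o.1))^-1%g.

Lemma label_of_labeling g : labeling Gam (label_of g).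
Proof.
split=> [[e []]|[e []]]; rewrite /label_of /oedge_opp /= ?groupV ?subgP //.
by rewrite invgK.
Qed.

Lemma covering_mx_labelled (g : {ffun edge G -> sT}) :
  covering_mx pi (label_of g) = labelled edge_rep plain_block g.
Proof.
rewrite labelled_blocks; apply/matrixP => i j.
rewrite /covering_mx mxE /covering_block !summxE big_mkcond /=.
transitivity (\sum_(e : edge G) \sum_(b : bool)
   (if (edge_tail (e, b) == cover_vtx i) && (edge_head (e, b) == cover_vtx j)
    then pi (label_of g (e, b)) (cover_coord i) (cover_coord j) else 0)).
  by rewrite pair_bigA; apply: eq_bigr => -[].
apply: eq_bigr => e _; rewrite big_bool mxE !(block_entry vt_idx cd_idx idxK).
by rewrite /edge_tail /edge_head /= ![_ == cover_vtx _]eq_sym /label_of /= /rho.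
Qed.

Lemma deleted_mx0 (Fe : finType) N (a b : Fe -> 'I_N) (x : R) e :
  deleted_mx a b x finset.set0 e = x%:M - signed_adj R a b e.
Proof. by apply/matrixP => i j; rewrite mxE !inE. Qed.

Definition det_cover (g : edge G -> 'M[R[i]]_d) (h : edge G -> 'M[R[i]]_d) x :=
  det_lab (x%:C)%:M (fun e => - incl R idx (src e)) (fun e => - incl R idx (dst e))
    (fun e => (incl R idx (dst e))^T) (fun e => (incl R idx (src e))^T) g h.

Lemma det_coverE g h x :
  det_cover g h x = \det ((x%:C)%:M - \sum_e edge_block idx (src e) (dst e) (g e) (h e)).
Proof.
rewrite /det_cover /det_lab; congr (\det (_ + _)); rewrite -sumrN.
by apply: eq_bigr => e _; rewrite /edge_block !mulNmx opprD.
Qed.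

Lemma eq_det_cover g h g' h' x : g =1 g' -> h =1 h' -> det_cover g h x = det_cover g' h' x.
Proof. by move=> /funext -> /funext ->. Qed.

Lemma label_poly_det_cover (g : {ffun edge G -> sT}) x :
  det_cover (fun e => rho pi (g e)) (fun e => rho pi (g e)^-1%g) x =
  ((char_label g).[x])%:C.
Proof.
rewrite det_coverE -labelled_blocks -horner_char_poly.
have [_ <-] := label_polyP form_pos edge_repH plain_block_real g.
exact: (horner_map (real_complex R)).
Qed.

Lemma signed_det_cover (sigma : edge G -> 'S_d) (eps : {ffun edge G * 'I_d -> bool}) x :
  det_cover (fun e => sp_mx R[i] (sigma e, [ffun k => eps (e, k)]))
    (fun e => sp_inv R[i] (sigma e, [ffun k => eps (e, k)])) x =
  (\det (deleted_mx (lift_src idx) (lift_dst idx sigma) x finset.set0 eps))%:C.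
Proof.
rewrite det_coverE deleted_mx0 -[RHS](det_map_mx (real_complex R)); congr (\det _).
rewrite map_mxB map_scalar_mx; congr (_ - _).
rewrite /signed_adj [RHS](raddf_sum (map_mx (real_complex R))) /=.
transitivity (\sum_(p : (edge G * 'I_d) * bool)
  (-1) ^+ eps p.1 *: delta_mx (dtail (lift_src idx) (lift_dst idx sigma) p)
     (dhead (lift_src idx) (lift_dst idx sigma) p) : 'M[R[i]]_(\sum_(i < #|vertex G|) d)).
  rewrite -(pair_bigA _ (fun f b => (-1) ^+ eps f *:
     (delta_mx (dtail (lift_src idx) (lift_dst idx sigma) (f, b))
     (dhead (lift_src idx) (lift_dst idx sigma) (f, b))
       : 'M[R[i]]_(\sum_(i < #|vertex G|) d)))) /=.
  rewrite [LHS](eq_bigr _ (fun e _ => edge_block_signed R vt_idx cd_idx idxK (src e) (dst e)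
    (sigma e, [ffun k => eps (e, k)]))).
  rewrite [LHS]pair_bigA; apply: eq_bigr => -[e k] _.
  by rewrite big_bool /= ffunE scalerDr.
apply: eq_bigr => p _; rewrite map_mxZ map_delta_mx /dsign.
by rewrite rmorphXn /= rmorphN1.
Qed.

Lemma sum_signed_det_cover x :
  \sum_(w : {ffun edge G -> signed_perm d})
    det_cover (fun e => sp_mx R[i] (w e)) (fun e => sp_inv R[i] (w e)) x =
  (\sum_(sigma : {ffun edge G -> 'S_d})
     sign_sum (lift_src idx) (lift_dst idx sigma) x finset.set0)%:C.
Proof.
rewrite rmorph_sum /=.
under [RHS]eq_bigr => sigma _ do rewrite /sign_sum rmorph_sum /=.
rewrite [RHS]pair_bigA.
(* Signed permutations on the edges of [G] are the same as permutations on these edges together with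
   signs on the edges of the cover they define. *)
pose join (p : {ffun edge G -> 'S_d} * {ffun edge G * 'I_d -> bool}) :
    {ffun edge G -> signed_perm d} :=
  [ffun e => (p.1 e, [ffun k => p.2 (e, k)])].
rewrite [LHS](reindex join); last first.
  exists (fun w : {ffun edge G -> signed_perm d} => ([ffun e => (w e).1], [ffun f => (w f.1).2 f.2])).
    move=> [sigma eps] _; congr (_, _); apply/ffunP.
      by move=> e; rewrite !ffunE.
    by move=> [e k]; rewrite !ffunE.
  move=> w _; apply/ffunP => e; rewrite !ffunE /=; case E : (w e) => [s t].
  by congr (_, _); apply/ffunP => k; rewrite !ffunE /= E.
apply: eq_bigr => -[sigma eps] _.
have joinE e : join (sigma, eps) e = (sigma e, [ffun k => eps (e, k)]) by rewrite ffunE.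
transitivity (det_cover (fun e => sp_mx R[i] (sigma e, [ffun k => eps (e, k)]))
    (fun e => sp_inv R[i] (sigma e, [ffun k => eps (e, k)])) x).
  apply: eq_det_cover => e; exact: congr1 (joinE e).
exact: signed_det_cover.
Qed.

Lemma sum_label_poly x :
  #|{ffun edge G -> signed_perm d}|%:R * (\sum_g (char_label g).[x]) =
  #|{ffun edge G -> sT}|%:R * \sum_(sigma : {ffun edge G -> 'S_d})
     sign_sum (lift_src idx) (lift_dst idx sigma) x finset.set0 :> R.
Proof.
have sT0 : (0 < #|[the finType of sT]|)%N by apply/card_gt0P; exists 1%g.
have sp0 : (0 < #|[the finType of signed_perm d]|)%N.
  by apply/card_gt0P; exists (1%g, [ffun=> false]).
have := avg_det_lab (rep_orthogonal hext) (signed_perm_orthogonal R[i] (d := d)) sT0 sp0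
  (x%:C)%:M (fun e => - incl R idx (src e)) (fun e => - incl R idx (dst e))
    (fun e => (incl R idx (dst e))^T) (fun e => (incl R idx (src e))^T).
rewrite [X in _ = _ * X]sum_signed_det_cover.
under eq_bigr => g _ do rewrite [det_lab _ _ _ _ _ _ _]label_poly_det_cover.
move=> E; apply: (fmorph_inj (real_complex R)).
by rewrite !rmorphM !rmorph_nat rmorph_sum.
Qed.

Lemma good_label y : spectral_radius < y ->
  exists g : {ffun edge G -> sT}, forall x, y <= x -> 0 < (char_label g).[x].
Proof.
move=> hy.
have /boolp.choice [f fP] : forall sigma : {ffun edge G -> 'S_d}, exists c : R, 0 < c /\
    forall x, y <= x -> c <= sign_sum (lift_src idx) (lift_dst idx sigma) x finset.set0.
  move=> sigma; have [c c0 cP] := d_cover_sign_sum vt_idx cd_idx idxK hloop hconn sigma hy.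
  by exists c.
have n0 : 0 < #|{ffun edge G -> signed_perm d}|%:R :> R.
  by rewrite ltr0n; apply/card_gt0P; exists [ffun=> (1%g, [ffun=> false])].
(* Division by the number of signed labelings cancels the factor on the left of [sum_label_poly], so
   that the polynomials of all labels average at least [c]. *)
pose c := (\sum_sigma f sigma) / #|{ffun edge G -> signed_perm d}|%:R.
have c0 : 0 < c.
  apply: divr_gt0 => //; rewrite (bigD1 [ffun=> 1%g]) //= ltr_wpDr ?(fP _).1 //.
  by apply: sumr_ge0 => sigma _; exact: ltW (fP sigma).1.
apply: (exists_label form_pos edge_repM edge_repH (reflections_generate hrefl) _
  plain_block_real c0) => [e g|x yx].
  rewrite inE leq_eqVlt ltnS leqn0 => /orP [/eqP rk|rk].
    by right; exact: (rank1_hreflection vt_idx cd_idx).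
  have g1 : rho pi g = 1%:M by apply/eqP; rewrite -subr_eq0 -mxrank_eq0.
  left; rewrite /edge_rep g1 emb1; split=> //.
  have -> : rho pi g^-1%g = 1%:M by rewrite -[LHS]mulmx1 -[X in _ *m X]g1 rhoVM.
  by rewrite emb1.
rewrite -(ler_pM2l n0) sum_label_poly -(mulr_natl c) mulrCA ler_wpM2l ?ler0n //.
rewrite /c mulrC divfK ?gt_eqF //; apply: ler_sum => sigma _.
exact: (fP sigma).2.
Qed.

(** If each labeling had a root above the spectral radius, choose one for each and let [y] be the
    least of these finitely many roots. The labeling that [good_label] gives for [y] is then
    positive at its own chosen root. *)
Lemma best_label : exists g : {ffun edge G -> sT},
  forall x, root (char_label g) x -> x <= spectral_radius.
Proof.
apply: contrapT => h.
have /boolp.choice [f fP] : forall g : {ffun edge G -> sT}, exists x : R,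
    root (char_label g) x /\ spectral_radius < x.
  move=> g; apply: contrapT => hg; apply: h; exists g => x rx; rewrite leNgt.
  by apply/negP => xr; apply: hg; exists x.
pose g0 : {ffun edge G -> sT} := [ffun=> 1%g].
case: (@Order.TotalTheory.arg_minP _ _ _ g0 xpredT f isT) => m _ mP.
have [g gP] := good_label (fP m).2.
by have := gP _ (mP g isT); rewrite (rootP (fP g).1) ltxx.
Qed.

End Assembly.

Theorem theorem1p11 (R : realType) (gT : finGroupType) (Gam : {group gT})
    (d : nat) (pi : mx_representation R[i] Gam d)
    (hext : ext_powers_irr_noniso pi)
    (hrefl : image_gen_by_pseudo_reflections pi)
    (G : multigraph) (hloop : loopless G) (hconn : graph_connected G)
    (v0 : vertex G) :
  exists gamma : oedge G -> gT,
    labeling Gam gamma /\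
    (forall lam : R[i], eigenvalue (covering_mx pi gamma) lam ->
       lam <= (cover_spectral_radius R v0)%:C).
Proof.
have [g gP] := best_label hext hrefl v0 hloop hconn.
exists (label_of g); split; first exact: label_of_labeling.
move=> lam; rewrite eigenvalue_root_char covering_mx_labelled //.
have fpos := cover_form_pos (@cover_idxK (vertex G) d) pi.
have repH e h := emb_cover_form (@cover_vtx_idx (vertex G) d)
  (@cover_coord_idx (vertex G) d) pi (src (m := G) e) h.
have Breal (e : edge G) v := edge_block_real (@cover_vtx_idx (vertex G) d)
  (@cover_coord_idx (vertex G) d) pi (src e) (dst e) v.
move=> rl; have := eigenvalue_labelled_real fpos repH Breal rl.
case: lam rl => a b rl /= b0; rewrite b0 in rl *.
rewrite lecR; apply: gP.
have [_ E] := label_polyP fpos repH Breal g.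
by move: rl; rewrite -E (fmorph_root (real_complex R)).
Qed.
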